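(* Let $f,g:E\times\mathbb R\to\mathbb R$ satisfy conditions Car), Sig), Int), qM) and M). Suppose that there exist constants $c_1,c_2,r>0$ such that $$c_1\le\frac{|f(x,y)|}{|g(x,y)|}\le c_2\quad\text{for } m\text{-a.e. }x\in E\text{ and all }|y|\ge r .$$ Then $\Pi_f=\Pi_g$ on $\mathcal M_\rho$. In particular, for positive $\mu\in\mathcal M_\rho$, $\mu^{*,f}=\mu^{*,g}$.
   Context: Setting. $E$ is a locally compact separable metric space, $m$ a positive Radon measure on $E$ with full support, $(A,D(A))$ a self-adjoint operator on $L^2(E;m)$ generating a strongly continuous Markov semigroup $(T_t)_{t\ge0}$. The associated symmetric Dirichlet form is $\mathcal E(u,v)=(\sqrt{-A}u,\sqrt{-A}v)_{L^2(E;m)}$, $D(\mathcal E)=D(\sqrt{-A})$; it is assumed regular ($C_c(E)\cap D(\mathcal E)$ is dense in $D(\mathcal E)$ for the norm $(\mathcal E(u,u)+\|u\|_{L^2}^2)^{1/2}$ and in $C_c(E)$ for the uniform norm). $(T_t)$ is assumed transient: there is a strictly positive $h_0\in L^2(E;m)$ with $\operatorname{ess\,sup}_{n\ge1}\int_0^nT_th_0\,dt<\infty$ $m$-a.e. Let $\mathbb X=(X_t,P_x)$ be the Hunt process on $E\cup\{\partial\}$ associated with $A$ (so $T_th(x)=\mathbb E_xh(X_t)$ $m$-a.e. for bounded Borel $h\in L^2(E;m)$; functions on $E$ are extended by $0$ at the cemetery $\partial$), $P_th(x)=\mathbb E_xh(X_t)$, $Rh(x)=\mathbb E_x\int_0^\infty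 h(X_s)\,ds$ for Borel $h\ge0$. A nonnegative Borel function $h$ is excessive if $\sup_{t>0}P_th(x)=h(x)$ for all $x\in E$. It is assumed that the Green function for $-A$ exists: a Borel function $G:E\times E\to[0,\infty]$ with $G(x,\cdot),G(\cdot,y)$ excessive for all $x,y$ and $Rh(x)=\int_EG(x,y)h(y)\,m(dy)$ for all $x\in E$ and all Borel $h\ge0$. For a measure $\mu$, $R\mu(x)=\int_EG(x,y)\,\mu(dy)$. Fix a strictly positive excessive function $\rho:E\to(0,\infty)$ and a strictly positive bounded Borel function $\varrho\in L^1(E;m)\cap L^2(E;m)$ such that $R\varrho$ is bounded and $R\varrho\le\rho$ $m$-a.e. $\mathcal M_\rho$ is the set of signed Borel measures $\mu=\mu^+-\mu^-$ on $E$ (with $\mu^\pm$ possibly infinite) with $\|\mu\|_\rho:=\int_E\rho\,d|\mu|<\infty$. Capacity. For open $U$, $Cap(U)=\inf\{\mathcal E(w,w):w\in D(\mathcal E),\,w\ge\mathbf 1_U\ m\text{-a.e.}\}$; for arbitrary $B$, $Cap(B)=\inf\{Cap(V):B\subset V,\ V\text{ open}\}$. Solutions. For $\mu\in\mathcal M_\rho$, a solution to $-Au=f(\cdot,u)+\mu$ is a Borel function $u$ (finite $m$-a.e.) with $f(\cdot,u)\in L^1(E;\rho\cdot m)$ and $u=Rf(\cdot,u)+R\mu$ $m$-a.e. Conditions (stated for $f$). Car): $x\mapsto f(x,y)$ is Borel for every $y$ and $y\mapsto f(x,y)$ is continuous for $m$-a.e. $x$. Sig): for every $u\in\mathbb R$,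 $f(x,u)u\le0$ for $m$-a.e. $x$. Int): for all $\underline u,\overline u\in L^1(E;\varrho\cdot m)$ with $f(\cdot,\underline u),f(\cdot,\overline u)\in L^1(E;\rho\cdot m)$, the function $x\mapsto\sup_{y\in[\underline u(x),\overline u(x)]}|f(x,y)|$ belongs to $L^1(E;\rho\cdot m)$ (sup over the empty set is $0$). qM): for every $M>0$ the function $x\mapsto\sup_{|y|\le M}|f(x,y)|$ is locally quasi-integrable, where $v$ is quasi-integrable if for every $\varepsilon>0$ there is a closed $F_\varepsilon\subset E$ with $Cap(E\setminus F_\varepsilon)\le\varepsilon$ and $\mathbf 1_{F_\varepsilon}v\in L^1(E;m)$, and locally quasi-integrable if $\mathbf 1_Kv$ is quasi-integrable for every compact $K$. M): for every $M>0$, $x\mapsto\sup_{|y|\le M}|f(x,y)|$ belongs to $L^1(E;\rho\cdot m)$. Good and reduced measures. $\mathcal G(f)$ is the set of $\mu\in\mathcal M_\rho$ for which a solution to $-Au=f(\cdot,u)+\mu$ exists; $\mathcal G_{\le\mu}(f)=\{\nu\in\mathcal G(f):\nu\le\mu\}$, $\mathcal G_{\ge\mu}(f)=\{\nu\in\mathcal G(f):\nu\ge\mu\}$. Whenever $\mathcal G_{\le\mu}(f)\ne\emptyset$ it has a greatest element, denoted $\mu^{*,f}$; whenever $\mathcal G_{\ge\mu}(f)\neq\emptyset$ it has a least element, denoted $\mu_{*,f}$. Since $0\in\mathcal G(f)$, the map $\Pi_f:\mathcal M_\rho\to\mathcal G(f)$, $\Pi_f(\mu):=(\mu^+)^{*,f}+(-\mu^-)_{*,f}$,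 is defined on all of $\mathcal M_\rho$. *)

(* Defs.v *)
From HB Require Import structures.
From mathcomp Require Import all_boot all_order all_algebra.
From mathcomp Require Import all_classical all_reals all_analysis.
From mathcomp Require Import measurable_realfun.

Set Implicit Arguments.
Unset Strict Implicit.
Unset Printing Implicit Defensive.

Import Order.TTheory GRing.Theory Num.Theory.
Import numFieldNormedType.Exports.

Local Open Scope classical_set_scope.
Local Open Scope ring_scope.

(* Measurable types are pointed in the library, so the state space is a
   nonempty metric space. *)
#[short(type="pmetricType")]
HB.structure Definition PMetric (K : numDomainType) :=
  {M of Metric K M & Pointed M}.

Definition Borel (T : ptopologicalType) := g_sigma_algebraType (@open T).

Definition separable (T : topologicalType) :=
  exists D : set T, countable D /\ dense D.

Section state_space.
Context {R : realType} {E : pmetricType R}.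

(* E with the cemetery None adjoined: the one-point compactification, None
   being an isolated point when E is compact. *)
Definition cem : ptopologicalType := one_point_compactification E.

Definition ext (h : E -> \bar R) (z : cem) : \bar R :=
  if z is Some x then h x else 0%E.

Definition borel_fun (h : E -> R) :=
  measurable_fun [set: Borel E] (h : Borel E -> R).
Definition borel_efun (h : E -> \bar R) :=
  measurable_fun [set: Borel E] (h : Borel E -> \bar R).

(* On a locally compact separable metric space such measures are
   automatically regular. *)
Definition radon (m : {measure set (Borel E) -> \bar R}) :=
  forall K : set E, compact K -> (m K < +oo)%E.

Definition full_support (m : {measure set (Borel E) -> \bar R}) :=
  forall U : set E, open U -> U !=set0 -> (0 < m U)%E.

End state_space.
Arguments cem {R} E.

Section L2.
Context {R : realType} {E : pmetricType R}.
Variable m : {measure set (Borel E) -> \bar R}.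

(* Elements of L^2(E;m) are represented by Borel functions, operators by
   maps on functions which are compatible with equality m-a.e. *)
Definition L2 (u : E -> R) := u \in Lfun m 2%:E.

Definition ip (u v : E -> R) : R := \int[m]_x (u x * v x).
Definition norm2 (u : E -> R) : R := Num.sqrt (ip u u).

Definition aeq (u v : E -> R) := \forall x \ae m, u x = v x.

Record l2op := L2Op {
  dom : set (E -> R);
  app :> (E -> R) -> (E -> R);
  dom_L2 : forall u, dom u -> L2 u;
  app_L2 : forall u, dom u -> L2 (app u);
  dom_ae : forall u v, dom u -> L2 v -> aeq u v -> dom v;
  app_ae : forall u v, dom u -> dom v -> aeq u v -> aeq (app u) (app v);
  dom0 : dom (cst 0);
  dom_lin : forall (a : R) u v, dom u -> dom v ->
    dom (fun x => a * u x + v x);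
  app_lin : forall (a : R) u v, dom u -> dom v ->
    aeq (app (fun x => a * u x + v x)) (fun x => a * app u x + app v x)
}.

Definition self_adjoint (B : l2op) :=
  (forall u, L2 u -> forall e : R, 0 < e ->
     exists2 v, dom B v & norm2 (u \- v) < e) /\
  (forall u w, L2 u -> L2 w ->
     (dom B u /\ aeq (B u) w) <-> (forall v, dom B v -> ip (B v) u = ip v w)).

(* S = sqrt (- A): the nonnegative self-adjoint operator with S^2 = - A,
   equality of domains included. *)
Definition is_sqrt_opp (A S : l2op) :=
  [/\ self_adjoint S,
      forall u, dom S u -> 0 <= ip (S u) u,
      forall u, dom A u <-> (dom S u /\ dom S (S u)) &
      forall u, dom A u -> aeq (S (S u)) (\- A u)].

Record markov_semigroup (T : R -> (E -> R) -> (E -> R)) : Prop := {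
  sg_L2 : forall t u, 0 <= t -> L2 u -> L2 (T t u);
  sg_ae : forall t u v, 0 <= t -> L2 u -> L2 v -> aeq u v ->
    aeq (T t u) (T t v);
  sg_lin : forall t (a : R) u v, 0 <= t -> L2 u -> L2 v ->
    aeq (T t (fun x => a * u x + v x)) (fun x => a * T t u x + T t v x);
  sg_contraction : forall t u, 0 <= t -> L2 u -> norm2 (T t u) <= norm2 u;
  sg0 : forall u, L2 u -> aeq (T 0 u) u;
  sgD : forall s t u, 0 <= s -> 0 <= t -> L2 u ->
    aeq (T (s + t) u) (T s (T t u));
  sg_cont : forall u, L2 u -> norm2 (T t u \- u) @[t --> 0^'+] --> (0 : R);
  sg_markov : forall t u, 0 <= t -> L2 u ->
    (\forall x \ae m, 0 <= u x <= 1) -> \forall x \ae m, 0 <= T t u x <= 1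
}.

Definition generates (A : l2op) (T : R -> (E -> R) -> (E -> R)) :=
  forall u w, L2 u -> L2 w ->
    (dom A u /\ aeq (A u) w) <->
    norm2 (fun x => t^-1 * (T t u x - u x) - w x) @[t --> 0^'+] --> (0 : R).

(* w is the L^2-valued integral of T_t h over [0, a]. *)
Definition is_L2_integral (T : R -> (E -> R) -> (E -> R)) (h : E -> R)
    (a : R) (w : E -> R) :=
  L2 w /\ forall v, L2 v ->
    ip w v = \int[lebesgue_measure]_(t in `[0, a]) ip (T t h) v.

Definition transient (T : R -> (E -> R) -> (E -> R)) :=
  exists (h0 : E -> R) (w : nat -> E -> R),
    [/\ L2 h0,
        \forall x \ae m, 0 < h0 x,
        forall n, (1 <= n)%N -> is_L2_integral T h0 n%:R (w n) &
        \forall x \ae m,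
          (ereal_sup [set (w n x)%:E | n in [set n | (1 <= n)%N]] < +oo)%E].

Definition Cc (u : E -> R) :=
  continuous u /\ compact (closure [set x | u x != 0]).

(* The Dirichlet form, in terms of S = sqrt (- A); its domain is dom S. *)
Definition dform (S : l2op) (u v : E -> R) : R := ip (S u) (S v).

Definition regular_form (S : l2op) :=
  (forall u, dom S u -> forall e : R, 0 < e ->
     exists v, [/\ Cc v, dom S v &
       Num.sqrt (dform S (u \- v) (u \- v) + norm2 (u \- v) ^+ 2) < e]) /\
  (forall u, Cc u -> forall e : R, 0 < e ->
     exists v, [/\ Cc v, dom S v & forall x, `|u x - v x| < e]).

Definition cap_open (S : l2op) (U : set E) : \bar R :=
  ereal_inf [set (dform S w w)%:E | w in
    [set w | dom S w /\ \forall x \ae m, \1_U x <= w x]].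

Definition cap (S : l2op) (B : set E) : \bar R :=
  ereal_inf [set cap_open S V | V in [set V | open V /\ B `<=` V]].

(* h is in L^1(E; w . m), h being defined and Borel up to an m-null set. *)
Definition inL1 (w : E -> R) (h : E -> \bar R) :=
  exists k : E -> R,
    [/\ borel_fun k, \forall x \ae m, h x = (k x)%:E &
        (\int[m]_x (w x * `|k x|)%:E < +oo)%E].

Definition quasi_integrable (S : l2op) (v : E -> \bar R) :=
  forall e : R, 0 < e -> exists F : set E,
    [/\ closed F, (cap S (~` F) <= e%:E)%E & inL1 (cst 1) (v \_ F)].

Definition loc_quasi_integrable (S : l2op) (v : E -> \bar R) :=
  forall K : set E, compact K -> quasi_integrable S (v \_ K).

Section conditions.
Variables (S : l2op) (rho vrho : E -> R) (f : E -> R -> R).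

Definition condCar :=
  (forall y, borel_fun (f ^~ y)) /\ (\forall x \ae m, continuous (f x)).

Definition condSig := forall y, \forall x \ae m, f x y * y <= 0.

(* The maximum with 0 only matters for the supremum over the empty set. *)
Definition sup_between (u1 u2 : E -> R) (x : E) : \bar R :=
  maxe 0%E (ereal_sup [set `|f x y|%:E | y in `[u1 x, u2 x]]).

Definition condInt := forall u1 u2 : E -> R,
  inL1 vrho (EFin \o u1) -> inL1 vrho (EFin \o u2) ->
  inL1 rho (fun x => (f x (u1 x))%:E) -> inL1 rho (fun x => (f x (u2 x))%:E) ->
  inL1 rho (sup_between u1 u2).

Definition sup_ball (M : R) (x : E) : \bar R :=
  ereal_sup [set `|f x y|%:E | y in [set y | `|y| <= M]].

Definition condqM := forall M : R, 0 < M -> loc_quasi_integrable S (sup_ball M).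

Definition condM := forall M : R, 0 < M -> inL1 rho (sup_ball M).

End conditions.

End L2.

Section hunt.
Context {R : realType} {E : pmetricType R}.

Record filtration d (Omega : measurableType d)
    (F : R -> set (set Omega)) : Prop := {
  filt_sigma : forall t, 0 <= t -> sigma_algebra [set: Omega] (F t);
  filt_sub : forall t, 0 <= t -> F t `<=` measurable;
  filt_mono : forall s t, 0 <= s -> s <= t -> F s `<=` F t;
  filt_right : forall t B, 0 <= t -> (forall s, t < s -> F s B) -> F t B
}.

Definition stopping_time d (Omega : measurableType d)
    (F : R -> set (set Omega)) (tau : Omega -> \bar R) :=
  (forall w, (0 <= tau w)%E) /\
  (forall t, 0 <= t -> F t [set w | (tau w <= t%:E)%E]).

Definition stopped_sigma d (Omega : measurableType d)
    (F : R -> set (set Omega)) (tau : Omega -> \bar R) : set (set Omega) :=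
  [set B | measurable B /\
     forall t, 0 <= t -> F t (B `&` [set w | (tau w <= t%:E)%E])].

(* X_r(w), with the convention that X_oo is the cemetery. *)
Definition eval_at (Omega : Type) (X : R -> Omega -> cem E) (r : \bar R)
    (w : Omega) : cem E :=
  if r is r'%:E then X r' w else None.

(* X_t is relevant for t >= 0 only. It is enough to state the strong Markov
   property and quasi-left-continuity under each P_x: pr is a kernel, so they
   carry over to every initial distribution by integration. *)
Record hunt_process := HuntProcess {
  disp : measure_display;
  Omega : measurableType disp;
  pr : R.-pker (Borel (cem E)) ~> Omega;
  X :> R -> Omega -> cem E;
  X_meas : forall t, 0 <= t ->
    measurable_fun [set: Omega] (X t : Omega -> Borel (cem E));
  X_normal : forall z, pr z [set w | X 0 w = z] = 1%E;
  X_trap : forall w s t, 0 <= s -> s <= t -> X s w = None -> X t w = None;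
  X_shift : exists theta : R -> Omega -> Omega,
    forall s t w, 0 <= s -> 0 <= t -> X s (theta t w) = X (s + t) w;
  X_right : forall w t, 0 <= t -> X s w @[s --> t^'+] --> X t w;
  X_left : forall w t, 0 < t -> cvg (X s w @[s --> t^'-]);
  X_filtration : exists F : R -> set (set Omega),
    [/\ filtration F,
        forall t (B : set (Borel (cem E))), 0 <= t -> measurable B ->
          F t (X t @^-1` B),
        (forall tau, stopping_time F tau ->
         forall z t (B : set (Borel (cem E))) L, 0 <= t -> measurable B ->
           stopped_sigma F tau L ->
           pr z (L `&` [set w | B (eval_at X (tau w + t%:E)%E w)]) =
           (\int[pr z]_(w in L) pr (eval_at X (tau w) w) (X t @^-1` B))%E) &
        (forall tau : nat -> Omega -> \bar R,
         (forall n, stopping_time F (tau n)) ->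
         (forall n w, (tau n w <= tau n.+1 w)%E) ->
         forall z, \forall w \ae pr z,
           (ereal_sup (range (tau ^~ w)) < +oo)%E ->
           eval_at X (tau n w) w @[n --> \oo] -->
             eval_at X (ereal_sup (range (tau ^~ w))) w)]
}.

Variable XX : hunt_process.

Definition Pt (t : R) (h : E -> \bar R) (x : E) : \bar R :=
  (\int[pr XX (Some x)]_w ext h (XX t w))%E.

Definition Rpot (h : E -> \bar R) (x : E) : \bar R :=
  (\int[pr XX (Some x)]_w
     \int[lebesgue_measure]_(s in `[0%R, +oo[) ext h (XX s w))%E.

Definition associated (m : {measure set (Borel E) -> \bar R})
    (T : R -> (E -> R) -> (E -> R)) :=
  forall t (h : E -> R), 0 <= t -> L2 m h -> (exists C, forall x, `|h x| <= C) ->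
    \forall x \ae m, (T t h x)%:E = Pt t (EFin \o h) x.

Definition excessive (h : E -> \bar R) :=
  [/\ borel_efun h, forall x, (0 <= h x)%E &
      forall x, ereal_sup [set Pt t h x | t in [set t | 0 < t]] = h x].

Definition is_green (m : {measure set (Borel E) -> \bar R})
    (G : E -> E -> \bar R) :=
  [/\ measurable_fun [set: Borel E * Borel E] (fun z => G z.1 z.2),
      forall x, excessive (G x),
      forall y, excessive (G ^~ y) &
      forall h x, borel_efun h -> (forall y, (0 <= h y)%E) ->
        Rpot h x = (\int[m]_y (G x y * h y))%E].

Definition Rpot_signed (k : E -> R) (x : E) : \bar R :=
  (Rpot (fun y => (EFin \o k)^\+ y) x - Rpot (fun y => (EFin \o k)^\- y) x)%E.

End hunt.
Arguments hunt_process {R} E.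

Section signed_measures.
Context {R : realType} {E : pmetricType R}.

(* The Jordan decomposition; both parts may be infinite. *)
Record signed_measure := SignedMeasure {
  mpos : {measure set (Borel E) -> \bar R};
  mneg : {measure set (Borel E) -> \bar R};
  mpos_mneg : exists H : set (Borel E),
    [/\ measurable H, mpos (~` H) = 0%E & mneg H = 0%E]
}.

HB.instance Definition _ := gen_eqMixin signed_measure.
HB.instance Definition _ := gen_choiceMixin signed_measure.

(* Library measures are functions on all sets; only their values on Borel sets
   are meaningful. *)
Definition sm_eq (mu nu : signed_measure) := forall B : set (Borel E),
  measurable B -> mpos mu B = mpos nu B /\ mneg mu B = mneg nu B.

(* nu <= mu, with the negative parts moved to the other side in order to avoid
   oo - oo; for measures which integrate a strictly positive function (hence
   are sigma-finite) this is the usual order. *)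
Definition sm_le (nu mu : signed_measure) := forall B : set (Borel E),
  measurable B -> (mpos nu B + mneg mu B <= mpos mu B + mneg nu B)%E.

Definition is_sum (lam mu nu : signed_measure) := forall B : set (Borel E),
  measurable B ->
  (mpos lam B + (mneg mu B + mneg nu B) =
   mneg lam B + (mpos mu B + mpos nu B))%E.

Lemma zero_singularr (mu : {measure set (Borel E) -> \bar R}) :
  exists H : set (Borel E),
    [/\ measurable H, mu (~` H) = 0%E & (mzero : set (Borel E) -> \bar R) H = 0%E].
Proof.
by exists setT; split=> //; rewrite setCT measure0.
Qed.

Lemma zero_singularl (mu : {measure set (Borel E) -> \bar R}) :
  exists H : set (Borel E),
    [/\ measurable H, (mzero : set (Borel E) -> \bar R) (~` H) = 0%E & mu H = 0%E].
Proof.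
by exists set0; split=> //; rewrite measure0.
Qed.

Definition sm_of_pos (mu : {measure set (Borel E) -> \bar R}) :=
  @SignedMeasure mu mzero (zero_singularr mu).
Definition sm_of_neg (mu : {measure set (Borel E) -> \bar R}) :=
  @SignedMeasure mzero mu (zero_singularl mu).

Definition sm_zero := sm_of_pos mzero.

Definition sm_add (mu nu : signed_measure) : signed_measure :=
  xget sm_zero [set lam | is_sum lam mu nu].

Definition positive_sm (mu : signed_measure) := mneg mu setT = 0%E.

Definition total_variation (mu : signed_measure) :=
  measure_add (mpos mu) (mneg mu).

Definition Mrho (rho : E -> R) : set signed_measure :=
  [set mu | (\int[total_variation mu]_x (rho x)%:E < +oo)%E].

Definition greatest (C : set signed_measure) : set signed_measure :=
  [set nu | C nu /\ forall nu', C nu' -> sm_le nu' nu].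

Definition least (C : set signed_measure) : set signed_measure :=
  [set nu | C nu /\ forall nu', C nu' -> sm_le nu nu'].

End signed_measures.
Arguments signed_measure {R} E.

Section reduced_measures.
Context {R : realType} {E : pmetricType R}.
Variables (m : {measure set (Borel E) -> \bar R}) (XX : hunt_process E).
Variables (G : E -> E -> \bar R) (rho : E -> R).

Definition Rmeas (mu : signed_measure E) (x : E) : \bar R :=
  (\int[mpos mu]_y G x y - \int[mneg mu]_y G x y)%E.

(* k is a Borel version of f(., u), which by condCar is Borel up to an m-null
   set; since u is finite m-a.e., fine u is a version of u. *)
Definition is_solution (f : E -> R -> R) (mu : signed_measure E)
    (u : E -> \bar R) :=
  [/\ borel_efun u,
      \forall x \ae m, u x \is a fin_num &
      exists k : E -> R,
        [/\ borel_fun k,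
            \forall x \ae m, f x (fine (u x)) = k x,
            (\int[m]_x (rho x * `|k x|)%:E < +oo)%E &
            \forall x \ae m, u x = (Rpot_signed XX k x + Rmeas mu x)%E]].

Definition good (f : E -> R -> R) : set (signed_measure E) :=
  [set mu | Mrho rho mu /\ exists u, is_solution f mu u].

Definition good_le f mu := [set nu | good f nu /\ sm_le nu mu].
Definition good_ge f mu := [set nu | good f nu /\ sm_le mu nu].

(* The default value is irrelevant where the greatest (least) element
   exists. *)
Definition upper_reduced f mu : signed_measure E :=
  xget sm_zero (greatest (good_le f mu)).
Definition lower_reduced f mu : signed_measure E :=
  xget sm_zero (least (good_ge f mu)).

Definition Pi f mu : signed_measure E :=
  sm_add (upper_reduced f (sm_of_pos (mpos mu)))
         (lower_reduced f (sm_of_neg (mneg mu))).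

End reduced_measures.

(* Main.v *)
Require Import Defs.
From HB Require Import structures.
From mathcomp Require Import all_boot all_order all_algebra.
From mathcomp Require Import all_classical all_reals all_analysis.
From mathcomp Require Import measurable_realfun ring lra.

(** The reduced measures of a nonlinearity [f] depend on [f] only through the set [good f] of measures
for which a solution exists, so it is enough to prove [good f = good g], and by symmetry one
inclusion, under the one-sided bound [|g| <= C |f|] for large arguments ([good_sub]).

Let [u = U_0 k0 + h0] be a solution for [f], where [U_0] is the potential operator, [k0 = f(., u)]
and [h0] is the potential of the measure. Where [|u|] is large, [|g(., u)|] is at most [C |k0|];
where it is bounded, [|g(., u)|] is at most the supremum of [|g|] over a ball. Both are integrable
against [rho], and the condition on suprema between two functions yields an [H] integrable against
[rho] which dominates [|g(x, y)|] for all [y] between 0 and [u(x)]. The function [u] need not be a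
barrier for the equation with [g], but comparison with it costs no more than [F = |k0| + H].

Indeed, let [v = U_0 k + h0], where [k] has the sign opposite to [v] and [|k| <= |g(., v)|]. Where
[u < v], either [0 < v] and [k <= 0], or [u < v <= 0] and [|k| <= H]; in both cases [k - k0 <= F].
A Kato inequality ([maximum_principle]) keeps only the part of [k - k0] on the set where
[v - u = U_0 (k - k0)] is positive, and gives [|v - u| <= U_0 F] ([apriori_dist]). Testing it against
supermedian functions [e] bounds the integral of [|k| e] by 5 times that of [F e]
([apriori_integral]). With suitable [e] this is uniform integrability of [k] on the sets where [v] is
large, so almost everywhere limits of such pairs are again such pairs ([admissible_limit]). The
problems with [g] truncated at multiples of a bounded integrable function have maximal solutions,
which are monotone in the two levels of truncation, and two monotone limits produce a solution for
[g] ([semilinear_solvable]).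

All of this uses only a symmetric resolvent which is strongly continuous in a weighted L1 space. For
the process, the resolvent comes from transition kernels that are jointly measurable by
right-continuity of the paths ([measurable_path_at]); the Markov property gives the resolvent equation
([resolvent_equation]), self-adjointness of the generator gives symmetry ([sg_symmetric]), and strong
continuity of the semigroup in L2 gives strong continuity of the resolvent ([l1_cvg_all]). The
potential of a measure integrating [rho] is finite almost everywhere because the potential of the
weight in the second variable of the Green function is at most [rho] at every point
([dual_potential_le]). *)

Set Implicit Arguments.
Unset Strict Implicit.
Unset Printing Implicit Defensive.
Import Order.TTheory GRing.Theory Num.Theory.
Import numFieldNormedType.Exports.
Local Open Scope classical_set_scope.
Local Open Scope ring_scope.

(** * Composition with continuous functions, and Lipschitz majorants *)

Section caratheodory.
Context d (T : measurableType d) (R : realType).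

Import HBSimple.

(** Approximate [v] by simple functions: on each of their level sets the composite is a section of
    [b], and continuity of [b x] passes to the limit. *)
Lemma caratheodory_measurable (b : T -> R -> R) (v : T -> R) :
  (forall y, measurable_fun setT (b ^~ y)) -> (forall x, continuous (b x)) ->
  measurable_fun setT v -> measurable_fun setT (fun x => b x (v x)).
Proof.
move=> mb cb mv.
have mve : measurable_fun setT (EFin \o v) by exact/measurable_EFinP.
have [g gv] := approximation_sfun measurableT mve.
apply: (@measurable_fun_cvg _ _ _ _ (fun n x => b x (g n x))); last first.
  move=> x _; apply: continuous_cvg; first exact: cb.
  by have /fine_cvgP[_] := gv x I.
move=> n; have -> : (fun x => b x (g n x)) =
    (fun x => \sum_(r \in range (g n)) (\1_(g n @^-1` [set r]) x * b x r)).
  apply/funext => x; rewrite (fsbigD1 (g n x)) //=; last exact: imageP.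
  rewrite indicE mem_set // mul1r fsbig1 ?addr0 // => r [_ /= /eqP rg].
  by rewrite indicE memNset ?mul0r // => /= gr; rewrite gr eqxx in rg.
under eq_fun do rewrite fsbig_finite //=.
by apply: measurable_sum => r; apply: measurable_funM.
Qed.

End caratheodory.

Section sup_convolution.
Context (R : realType).
Implicit Types b : R -> R.

(** Lipschitz majorants of a bounded continuous function, decreasing to it. The supremum runs over
    rational points, so that dependence on a parameter is that of a countable supremum. *)
Definition supconv b (n : nat) (y : R) : R :=
  sup (range (fun q : rat => b (ratr q) - n.+1%:R * `|y - ratr q|)).

Variables (b : R -> R) (F : R).
Hypothesis bF : forall y, 0 <= b y <= F.
Hypothesis cb : continuous b.

Let ub n y : ubound (range (fun q : rat => b (ratr q) - n.+1%:R * `|y - ratr q|)) F.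
Proof.
move=> _ [q _ <-]; have /andP[_ h] := bF (ratr q).
by rewrite lerBlDr (le_trans h) // lerDl mulr_ge0.
Qed.

Let ne n y : range (fun q : rat => b (ratr q) - n.+1%:R * `|y - ratr q|) !=set0.
Proof. by exists (b (ratr 0) - n.+1%:R * `|y - ratr 0|); exists 0. Qed.

Lemma supconv_term n y (q : rat) : b (ratr q) - n.+1%:R * `|y - ratr q| <= supconv b n y.
Proof. by apply: ub_le_sup; [exists F; exact: ub|exists q]. Qed.

Lemma supconv_le_bound n y : supconv b n y <= F.
Proof. by apply: ge_sup; [exact: ne|exact: ub]. Qed.

Lemma supconv_near y (e : R) : 0 < e -> exists2 dd : R, 0 < dd &
  forall z, `|z - y| < dd -> `|b z - b y| < e.
Proof.
move=> e0; have /cvgrPdist_lt /(_ _ e0) := @cb y.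
move=> /nbhs_ballP[dd /= dd0 h]; exists dd => // z zy.
by rewrite distrC; apply: h; rewrite /ball /= distrC.
Qed.

Lemma supconv_ge n y : b y <= supconv b n y.
Proof.
apply/ler_addgt0Pr => e e0.
have e20 : 0 < e / 2 by rewrite divr_gt0.
have [dd dd0 h] := supconv_near y e20.
pose t := Num.min dd (e / 2 / n.+1%:R).
have t0 : 0 < t by rewrite lt_min dd0 divr_gt0.
have [q] : exists q : rat, ratr q \in `](y - t), (y + t)[.
  by apply: rat_in_itvoo; rewrite ltrD2l gtrN.
rewrite in_itv /= => /andP[q1 q2].
have qy : `|ratr q - y| < t by rewrite ltr_norml; apply/andP; split; lra.
have /h : `|ratr q - y| < dd by apply: (lt_le_trans qy); rewrite ge_min lexx.
move=> /ltr_normlW hb.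
have h1 : n.+1%:R * `|y - ratr q| <= e / 2.
  rewrite -ler_pdivlMl // distrC mulrC; apply/ltW/(lt_le_trans qy).
  by rewrite ge_min lexx orbT.
have h2 := supconv_term n y q.
have : b y - b (ratr q) < e / 2.
  have : `|b (ratr q) - b y| < e / 2.
    by apply: h; apply: (lt_le_trans qy); rewrite ge_min lexx.
  by rewrite distrC => /ltr_normlW.
lra.
Qed.

Lemma supconv_ge0 n y : 0 <= supconv b n y.
Proof. by apply: le_trans (supconv_ge n y); have /andP[] := bF y. Qed.

Lemma supconv_lipschitz_le n y z : supconv b n y <= supconv b n z + n.+1%:R * `|y - z|.
Proof.
apply: ge_sup; first exact: ne.
move=> _ [q _ <-]; have h := supconv_term n z q.
have : `|z - ratr q| <= `|y - z| + `|y - ratr q|.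
  by rewrite -(distrC z y); apply: ler_distD.
move=> /(ler_wpM2l (ler0n R n.+1)); rewrite mulrDr; lra.
Qed.

Lemma supconv_lipschitz n y z :
  `|supconv b n y - supconv b n z| <= n.+1%:R * `|y - z|.
Proof.
rewrite ler_norml; apply/andP; split.
  by have := supconv_lipschitz_le n z y; rewrite distrC; lra.
by have := supconv_lipschitz_le n y z; lra.
Qed.

Lemma supconv_decr n k y : (n <= k)%N -> supconv b k y <= supconv b n y.
Proof.
move=> nk; apply: ge_sup; first exact: ne.
move=> _ [q _ <-]; apply: le_trans (supconv_term n y q).
by apply: lerB => //; apply: ler_wpM2r => //; rewrite ler_nat ltnS.
Qed.

(** Convergence along moving points: the solutions associated with the majorants move with [n]. *)
Lemma supconv_cvg (u : nat -> R) y : u n @[n --> \oo] --> y ->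
  supconv b n (u n) @[n --> \oo] --> b y.
Proof.
move=> uy; apply/cvgrPdist_le => /= e e0.
have e20 : 0 < e / 2 by rewrite divr_gt0.
have [dd dd0 h] := supconv_near y e20.
have F0 : 0 <= F by have /andP[h1 h2] := bF 0; exact: le_trans h2.
have dd20 : 0 < dd / 2 by rewrite divr_gt0.
have /cvgrPdist_lt /(_ _ dd20) near1 := uy.
near=> n.
have un : `|y - u n| < dd / 2 by near: n.
have nF : F <= n.+1%:R * (dd / 2).
  rewrite -ler_pdivrMr //; apply: (@le_trans _ _ n%:R); last by rewrite ler_nat.
  by near: n; exact: nbhs_infty_ger.
have un' : `|u n - y| < dd by rewrite distrC; lra.
have lower := supconv_ge n (u n).
have bu : `|b (u n) - b y| < e / 2 by exact: h.
have upper : supconv b n (u n) <= b y + e / 2.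
  apply: ge_sup; first exact: ne.
  move=> _ [q _ <-]; have := bF y; have := bF (ratr q) => /andP[q0 qF] /andP[y0 yF].
  have [qy|qy] := ltP `|ratr q - y| dd.
    have /ltr_normlW := h _ qy.
    have : 0 <= n.+1%:R * `|u n - ratr q| by rewrite mulr_ge0.
    lra.
  have : dd / 2 <= `|u n - ratr q|.
    have := ler_distD (u n) (ratr q) y.
    by rewrite (distrC (ratr q) (u n)) (distrC (u n) y); lra.
  move=> /(ler_wpM2l (ler0n R n.+1)); lra.
have := ler_norm (b y - b (u n)); rewrite distrC => h3.
by rewrite ler_norml; apply/andP; split; lra.
Unshelve. all: by end_near. Qed.

End sup_convolution.

Lemma measurable_supconv d (T : measurableType d) (R : realType) (b : T -> R -> R)
    (F : T -> R) n y :
  (forall y, measurable_fun setT (b ^~ y)) -> (forall x y, 0 <= b x y <= F x) ->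
  measurable_fun setT (fun x => supconv (b x) n y).
Proof.
move=> mb bF.
pose r (k : nat) : rat := odflt 0 (unpickle k).
pose h (k : nat) x := b x (ratr (r k)) - n.+1%:R * `|y - ratr (r k)|.
have -> : (fun x => supconv (b x) n y) = (fun x => sups (h ^~ x) 0).
  apply/funext => x; rewrite /supconv /sups /sdrop /=; congr sup.
  apply/seteqP; split => [_ [q _ <-]|_ [k _ <-]].
    by exists (pickle q) => //=; rewrite /h /r pickleK.
  by exists (r k).
apply: measurable_fun_sups.
  move=> x _; exists (F x) => _ [k _ <-]; have /andP[_ hh] := bF x (ratr (r k)).
  by rewrite /h lerBlDr (le_trans hh) // lerDl mulr_ge0.
by move=> k; apply: measurable_funB.
Qed.

(** * Nonnegative measurable functions *)

Section nonneg_measurable.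
Context d (T : measurableType d) (R : realType).
Implicit Types h k : T -> \bar R.
Local Open Scope ereal_scope.

(** The functions whose integrals and potentials are defined without integrability conditions. *)
Definition nnm h := measurable_fun setT h /\ forall x, 0 <= h x.

Lemma nnm_meas h : nnm h -> measurable_fun setT h. Proof. by case. Qed.
Lemma nnm_ge0 h x : nnm h -> 0 <= h x. Proof. by case. Qed.

Lemma nnmD h k : nnm h -> nnm k -> nnm (fun x => h x + k x).
Proof.
by move=> [mh h0] [mk k0]; split=> [|x]; [exact: emeasurable_funD|exact: adde_ge0].
Qed.

Lemma nnmM h k : nnm h -> nnm k -> nnm (fun x => h x * k x).
Proof.
by move=> [mh h0] [mk k0]; split=> [|x]; [exact: emeasurable_funM|exact: mule_ge0].
Qed.

Lemma nnmZ (c : R) h : (0 <= c)%R -> nnm h -> nnm (fun x => c%:E * h x).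
Proof.
move=> c0 [mh h0]; split=> [|x]; last exact: mule_ge0.
exact: emeasurable_funM.
Qed.

Lemma nnm_EFin (f : T -> R) :
  measurable_fun setT f -> (forall x, (0 <= f x)%R) -> nnm (fun x => (f x)%:E).
Proof. by move=> mf f0; split=> [|x]; [exact/measurable_EFinP|rewrite lee_fin]. Qed.

Lemma nnm_abs (f : T -> R) : measurable_fun setT f -> nnm (fun x => `|f x|%:E).
Proof.
by move=> mf; apply: nnm_EFin => // ; apply: measurableT_comp.
Qed.

Lemma nnm_abse h : measurable_fun setT h -> nnm (fun x => `|h x|).
Proof. by move=> mh; split=> //; apply: measurableT_comp. Qed.

Lemma nnm_min h k : nnm h -> nnm k -> nnm (fun x => mine (h x) (k x)).
Proof.
move=> [mh h0] [mk k0]; split=> [|x]; first exact: measurable_mine.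
by rewrite le_min h0 k0.
Qed.

Variable mu : {measure set T -> \bar R}.

Lemma nnm_integralD h k : nnm h -> nnm k ->
  \int[mu]_x (h x + k x) = \int[mu]_x h x + \int[mu]_x k x.
Proof. by move=> [mh h0] [mk k0]; rewrite ge0_integralD. Qed.

Lemma nnm_le_integral h k : nnm h -> nnm k -> (forall x, h x <= k x) ->
  \int[mu]_x h x <= \int[mu]_x k x.
Proof. by move=> [mh h0] [mk k0] hk; apply: ge0_le_integral. Qed.

Lemma nnm_ae_le_integral h k : nnm h -> nnm k -> {ae mu, forall x, h x <= k x} ->
  \int[mu]_x h x <= \int[mu]_x k x.
Proof.
move=> [mh h0] [mk k0] hk; apply: ae_ge0_le_integral => //.
by apply: filterS hk.
Qed.

Lemma nnm_integralZ (c : R) h : (0 <= c)%R -> nnm h ->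
  \int[mu]_x (c%:E * h x) = c%:E * \int[mu]_x h x.
Proof. by move=> c0 [mh h0]; rewrite ge0_integralZl_EFin. Qed.

Lemma nnm_integral_ge0 h : nnm h -> 0 <= \int[mu]_x h x.
Proof. by move=> [mh h0]; apply: integral_ge0. Qed.

End nonneg_measurable.

Section ge0_infinity.
Context (R : realType).
Implicit Types x : \bar R.
Local Open Scope ereal_scope.

Lemma ge0_addye x : 0 <= x -> +oo + x = +oo.
Proof. by case: x. Qed.

Lemma ge0_addey x : 0 <= x -> x + +oo = +oo.
Proof. by case: x. Qed.

Lemma abs_infty_sub (b r : R) : (0 < b)%R -> `|b%:E * +oo - r%:E| = +oo.
Proof. by move=> b0; rewrite gt0_muley ?lte_fin. Qed.

Lemma cvge0D (f g : nat -> \bar R) : f n @[n --> \oo] --> 0 ->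
  g n @[n --> \oo] --> 0 -> f n + g n @[n --> \oo] --> 0.
Proof. by move=> f0 g0; rewrite -[X in _ --> X]adde0; apply: cvgeD. Qed.

End ge0_infinity.

(** * Symmetric resolvents *)

Section resolvent.
Context d (E : measurableType d) (R : realType).
Variable m : {measure set E -> \bar R}.
Variable V : R -> E -> {measure set E -> \bar R}.
Local Open Scope ereal_scope.

Definition rpot a (h : E -> \bar R) x := \int[V a x]_y h y.

(** The resolvent equation, with index 0 included and in both orders of composition, is written
    without subtractions, so that infinite values are allowed. *)
Record sym_resolvent : Prop := {
  res_meas : forall a h, (0 <= a)%R -> nnm h -> measurable_fun setT (rpot a h);
  res_eq : forall a b h x, (0 <= a)%R -> (a < b)%R -> nnm h ->
    rpot a h x = rpot b h x + (b - a)%:E * rpot b (rpot a h) x;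
  res_eqC : forall a b h x, (0 <= a)%R -> (a < b)%R -> nnm h ->
    rpot a h x = rpot b h x + (b - a)%:E * rpot a (rpot b h) x;
  res_sym : forall a h k, (0 <= a)%R -> nnm h -> nnm k ->
    \int[m]_x (k x * rpot a h x) = \int[m]_x (h x * rpot a k x);
  res_cvg0 : forall h x, nnm h -> rpot n.+1%:R^-1 h x @[n --> \oo] --> rpot 0 h x
}.

Hypothesis HV : sym_resolvent.

Lemma rpot_ge0 a h x : (forall y, 0 <= h y) -> 0 <= rpot a h x.
Proof. by move=> h0; exact: integral_ge0. Qed.

Lemma nnm_rpot a h : (0 <= a)%R -> nnm h -> nnm (rpot a h).
Proof.
move=> a0 hh; split=> [|x]; first exact: (res_meas HV).
by apply: rpot_ge0 => y; apply: nnm_ge0.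
Qed.

Lemma rpotD a h k x : nnm h -> nnm k ->
  rpot a (fun y => h y + k y) x = rpot a h x + rpot a k x.
Proof. by move=> [mh h0] [mk k0]; rewrite /rpot ge0_integralD. Qed.

Lemma rpotZ a (c : R) h x : (0 <= c)%R -> nnm h ->
  rpot a (fun y => c%:E * h y) x = c%:E * rpot a h x.
Proof. by move=> c0 [mh h0]; rewrite /rpot ge0_integralZl_EFin. Qed.

Lemma le_rpot a h k x : nnm h -> nnm k -> (forall y, h y <= k y) ->
  rpot a h x <= rpot a k x.
Proof. by move=> [mh h0] [mk k0] hk; apply: ge0_le_integral. Qed.

Lemma eq_rpot a h k x : (forall y, h y = k y) -> rpot a h x = rpot a k x.
Proof. by move=> hk; apply: eq_integral. Qed.

(** Where [A] is infinite, [h] is compared with [k + t A], and [t] tends to 0: a set on which [A] is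
    infinite is not seen by the resolvent at a point where the potential of [A] is finite. *)
Lemma le_rpot_off a A h k x : nnm A -> nnm h -> nnm k ->
  (forall y, A y < +oo -> h y <= k y) -> rpot a A x < +oo ->
  rpot a h x <= rpot a k x.
Proof.
move=> hA hh hk hle Afin.
apply/lee_addgt0Pr => e e0.
have A0 : 0 <= rpot a A x by apply: rpot_ge0 => y; apply: nnm_ge0.
have AE : rpot a A x \is a fin_num by rewrite ge0_fin_numE.
pose t := (e / (fine (rpot a A x) + 1))%R.
have fA0 : (0 <= fine (rpot a A x))%R by exact: fine_ge0.
have t0 : (0 < t)%R by rewrite divr_gt0 // ltr_wpDl.
apply: (@le_trans _ _ (rpot a (fun y => k y + t%:E * A y) x)).
  apply: le_rpot => //; first by apply: nnmD => //; apply: nnmZ => //; exact: ltW.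
  move=> y; have := nnm_ge0 y hA; rewrite le_eqVlt => /orP[/eqP Ay|Ay].
    by rewrite -Ay mule0 adde0; apply: hle; rewrite -Ay ltry.
  have [Ayoo|] := ltP (A y) +oo.
    apply: (le_trans (hle _ Ayoo)); rewrite leeDl // mule_ge0 ?lee_fin ?ltW //.
  rewrite leye_eq => /eqP ->; rewrite gt0_muley ?lte_fin // addey ?leey //.
  by rewrite gt_eqF // (lt_le_trans _ (nnm_ge0 y hk)) // ltNyr.
rewrite rpotD //; last by apply: nnmZ => //; exact: ltW.
rewrite rpotZ //; last exact: ltW.
apply: leeD2l; rewrite -(fineK AE) -EFinM lee_fin /t.
by rewrite mulrAC ler_pdivrMr ?ltr_wpDl // ler_pM2l // lerDl.
Qed.

Lemma le_rpot_index a b h x : (0 <= a)%R -> (a < b)%R -> nnm h ->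
  rpot b h x <= rpot a h x.
Proof.
move=> a0 ab hh; rewrite (res_eq HV _ a0 ab) // leeDl // mule_ge0 //.
  by rewrite lee_fin subr_ge0 ltW.
by apply: rpot_ge0 => y; apply: rpot_ge0 => z; exact: nnm_ge0.
Qed.

Lemma le_rpot0 a h x : (0 < a)%R -> nnm h -> a%:E * rpot a (rpot 0 h) x <= rpot 0 h x.
Proof.
move=> a0 hh; rewrite [leRHS](res_eq HV _ (lexx 0) a0) // subr0 leeDr //.
by apply: rpot_ge0 => y; apply: nnm_ge0.
Qed.

Lemma rpot_rpot0_lty a h x : (0 < a)%R -> nnm h -> rpot 0 h x < +oo ->
  rpot a (rpot 0 h) x < +oo.
Proof.
move=> a0 hh hx.
have := le_lt_trans (le_rpot0 x a0 hh) hx.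
case E1 : (rpot a (rpot 0 h) x) => [r| |] //=; rewrite ?ltry // gt0_muley ?lte_fin //.
Qed.

(** By the resolvent equation [eps U_eps U_0 h] is [U_0 h - U_eps h]. *)
Lemma cvg_rpot0_small h x : nnm h -> rpot 0 h x < +oo ->
  n.+1%:R^-1%:E * rpot n.+1%:R^-1 (rpot 0 h) x @[n --> \oo] --> 0.
Proof.
move=> hh hx.
have h0 a : 0 <= rpot a h x by apply: rpot_ge0 => y; apply: nnm_ge0.
have fin0 : rpot 0 h x \is a fin_num by rewrite ge0_fin_numE.
have e0 n : (0 < n.+1%:R^-1 :> R)%R by rewrite invr_gt0 ltr0Sn.
have -> : (fun n => n.+1%:R^-1%:E * rpot n.+1%:R^-1 (rpot 0 h) x) =
          (fun n => rpot 0 h x - rpot n.+1%:R^-1 h x).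
  apply/funext => n; rewrite (res_eq HV _ (lexx 0) (e0 n)) // subr0.
  rewrite addeAC subee ?add0e // ge0_fin_numE //.
  by apply: le_lt_trans hx; apply: le_rpot_index.
rewrite -[X in _ --> X](subee fin0).
by apply: cvgeB; [exact: fin_num_adde_defr|exact: cvg_cst|exact: (res_cvg0 HV)].
Qed.

(** By the resolvent equation [dd <= b U_b dd] implies [dd <= e U_e dd] for all [e < b]; hence
    [dd <= e U_e U_0 a], which vanishes with [e]. This serves as a uniqueness principle for equations
    of the form [z = U_b (k + b z)]. *)
Lemma subinvariant_eq0 b dd a x : (0 < b)%R -> nnm dd -> nnm a ->
  (forall y, dd y <= rpot 0 a y) ->
  (forall y, rpot 0 a y < +oo -> dd y <= b%:E * rpot b dd y) ->
  rpot 0 a x < +oo -> dd x = 0.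
Proof.
move=> b0 hd ha dA dinv Ax.
apply/eqP; rewrite eq_le (nnm_ge0 x hd) andbT.
have hA : nnm (rpot 0 a) by apply: nnm_rpot.
suff step e : (0 < e)%R -> (e < b)%R -> dd x <= e%:E * rpot e (rpot 0 a) x.
  apply: (cvge_to_ge (cvg_rpot0_small ha Ax)).
  have : \forall n \near \oo, (n.+1%:R^-1 < b)%R.
    near=> n; rewrite invf_plt ?posrE ?ltr0Sn //.
    apply: (@lt_le_trans _ _ n%:R); last by rewrite ler_nat.
    by near: n; exact: nbhs_infty_gtr.
  by apply: filterS => n nb; apply: step => //; rewrite invr_gt0 ltr0Sn.
move=> e0 eb.
have Ub0 h y : nnm h -> forall c, 0 <= rpot c h y.
  by move=> hh c; apply: rpot_ge0 => z; apply: nnm_ge0.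
have eA : rpot e (rpot 0 a) x < +oo by exact: rpot_rpot0_lty.
have ed : rpot e dd x <= rpot e (rpot 0 a) x by exact: le_rpot.
have hbd : nnm (rpot b dd) by apply: nnm_rpot => //; exact: ltW.
have p1 : rpot e dd x <= b%:E * rpot e (rpot b dd) x.
  rewrite -rpotZ //; last exact: ltW.
  apply: (@le_rpot_off _ (rpot 0 a)) => //.
  by apply: nnmZ => //; exact: ltW.
have p2 := res_eqC HV x (ltW e0) eb hd.
have pfin : rpot e dd x \is a fin_num.
  by rewrite ge0_fin_numE ?Ub0 //; exact: le_lt_trans ed eA.
have qfin : rpot b dd x \is a fin_num.
  rewrite ge0_fin_numE ?Ub0 //; apply: le_lt_trans (le_lt_trans ed eA).
  by apply: le_rpot_index => //; exact: ltW.
have sfin : rpot e (rpot b dd) x \is a fin_num.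
  rewrite ge0_fin_numE; last exact: Ub0.
  have := pfin; rewrite [X in X \is a _]p2 fin_numD => /andP[_].
  move: (rpot e (rpot b dd) x) (Ub0 _ x hbd e) => s _.
  by case: s => [r| |] //=; rewrite ?ltry // gt0_muley ?lte_fin ?subr_gt0.
apply: (le_trans (dinv _ Ax)).
apply: (@le_trans _ _ (e%:E * rpot e dd x)); last first.
  by apply: lee_wpmul2l => //; rewrite lee_fin ltW.
move: p1 p2; rewrite -(fineK pfin) -(fineK qfin) -(fineK sfin).
set p := fine _; set q := fine _; set s := fine _.
rewrite -!EFinM -EFinD !lee_fin => p1 [p2]; nra.
Unshelve. all: by end_near. Qed.

Lemma fin_numEx (x : \bar R) : x \is a fin_num -> exists r, x = r%:E.
Proof. by case: x => [r| |] //; exists r. Qed.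

Lemma rpot_lty_le a h k x : nnm h -> nnm k -> (forall y, h y <= k y) ->
  rpot a k x < +oo -> exists2 r, (0 <= r)%R & rpot a h x = r%:E.
Proof.
move=> hh hk hle kx.
have h0 : 0 <= rpot a h x by apply: rpot_ge0 => y; apply: nnm_ge0.
have : rpot a h x \is a fin_num.
  by rewrite ge0_fin_numE //; apply: le_lt_trans kx; exact: le_rpot.
by move=> /fin_numEx[r E1]; exists r => //; rewrite -lee_fin -E1.
Qed.

Variables vr w : E -> R.
Hypothesis mvr : measurable_fun setT vr.
Hypothesis vr0 : forall x, (0 < vr x)%R.
Hypothesis wE : forall x, rpot 0 (fun y => (vr y)%:E) x = (w x)%:E.

Definition resdist a (f : E -> R) x : \bar R :=
  `|a%:E * rpot a (fun y => (f y)%:E) x - (f x)%:E|.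

Hypothesis res_cvg : forall f : E -> R, measurable_fun setT f ->
  (forall x, (0 <= f x)%R) -> \int[m]_x ((w x)%:E * (f x)%:E) < +oo ->
  \int[m]_x ((w x)%:E * resdist n.+1%:R f x) @[n --> \oo] --> 0.

Lemma nnm_resdist (a : R) (f : E -> R) : (0 <= a)%R -> measurable_fun setT f ->
  (forall x, (0 <= f x)%R) -> nnm (resdist a f).
Proof.
move=> a0 mf f0; have hf : nnm (fun y => (f y)%:E) by exact: nnm_EFin.
apply: nnm_abse; apply: emeasurable_funB; last exact/measurable_EFinP.
by apply: emeasurable_funM => //; apply: (res_meas HV).
Qed.

Lemma nnm_vr : nnm (fun x => (vr x)%:E).
Proof. by apply: nnm_EFin => // x; exact: ltW. Qed.

Lemma nnm_w : nnm (fun x => (w x)%:E).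
Proof.
have -> : (fun x => (w x)%:E) = rpot 0 (fun y => (vr y)%:E).
  by apply/funext => x; rewrite wE.
by apply: nnm_rpot => //; exact: nnm_vr.
Qed.

Lemma w_ge0 x : (0 <= w x)%R.
Proof. by rewrite -lee_fin; exact: (nnm_ge0 x nnm_w). Qed.

(** Symmetry moves the potential onto [vr]; this is why the L1 spaces carry the weight [w]. *)
Lemma int_vr_rpot0 h : nnm h ->
  \int[m]_x ((vr x)%:E * rpot 0 h x) = \int[m]_x ((w x)%:E * h x).
Proof.
move=> hh; rewrite (res_sym HV) //; last exact: nnm_vr.
by apply: eq_integral => x _; rewrite wE muleC.
Qed.

Lemma ae_lty_of_integral (f : E -> R) h : measurable_fun setT f ->
  (forall x, (0 < f x)%R) -> nnm h ->
  \int[m]_x ((f x)%:E * h x) < +oo -> {ae m, forall x, h x < +oo}.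
Proof.
move=> mf f0 hh hfin.
have hg : nnm (fun x => (f x)%:E * h x).
  by apply: nnmM => //; apply: nnm_EFin => // x; exact: ltW.
have : m.-integrable setT (fun x => (f x)%:E * h x).
  apply/integrableP; split; first exact: nnm_meas hg.
  by under eq_integral do rewrite gee0_abs ?(nnm_ge0 _ hg) //.
move=> /integrable_ae => /(_ measurableT); apply: filterS => x /(_ I).
have := nnm_ge0 x hh; case: (h x) => [r| |] //; rewrite ?ltry // => _.
by rewrite gt0_muley ?lte_fin.
Qed.

Lemma ae_rpot_lty h : nnm h -> \int[m]_x ((w x)%:E * h x) < +oo ->
  {ae m, forall x, rpot 0 h x < +oo}.
Proof.
move=> hh; rewrite -int_vr_rpot0 // => hfin.
by apply: ae_lty_of_integral hfin => //; exact: nnm_rpot.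
Qed.

Lemma ae_eq0_of_integral (f : E -> R) h : measurable_fun setT f ->
  (forall x, (0 < f x)%R) -> nnm h ->
  \int[m]_x ((f x)%:E * h x) <= 0 -> {ae m, forall x, h x = 0}.
Proof.
move=> mf f0 hh hle.
have hg : nnm (fun x => (f x)%:E * h x).
  by apply: nnmM => //; apply: nnm_EFin => // x; exact: ltW.
have /ae_eq_integral_abs : \int[m]_x `|(f x)%:E * h x| = 0.
  under eq_integral do rewrite gee0_abs ?(nnm_ge0 _ hg) //.
  apply/eqP; rewrite eq_le hle integral_ge0 // => x _; exact: nnm_ge0 hg.
move=> /(_ measurableT (nnm_meas hg)); apply: filterS => x /(_ I) /= /eqP.
by rewrite mule_eq0 => /orP[|/eqP //]; rewrite eqe gt_eqF.
Qed.

(** By [U_0 h = U_b h + U_0 (b U_b h)], the integral of [w h] is that of [vr U_b h] plus that of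
    [w b U_b h]; the assumption on [h] cancels the latter. *)
Lemma int_vr_rpot_le b h dl : (0 < b)%R -> nnm h -> nnm dl ->
  \int[m]_x ((w x)%:E * h x) < +oo ->
  (forall x, h x <= b%:E * rpot b h x + dl x) ->
  \int[m]_x ((vr x)%:E * rpot b h x) <= \int[m]_x ((w x)%:E * dl x).
Proof.
move=> b0 hh hd hfin hle; have b0' := ltW b0.
have hU : nnm (rpot b h) by exact: nnm_rpot.
have hvr' := nnm_vr; have hw' := nnm_w.
have hbU : nnm (fun x => b%:E * rpot b h x) by exact: nnmZ.
have hbU0 : nnm (rpot 0 (fun x => b%:E * rpot b h x)) by exact: nnm_rpot.
have e1 : \int[m]_x ((w x)%:E * h x) =
    \int[m]_x ((vr x)%:E * rpot b h x) + \int[m]_x ((w x)%:E * (b%:E * rpot b h x)).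
  rewrite -int_vr_rpot0 // -(int_vr_rpot0 hbU) -nnm_integralD; [|exact: nnmM..].
  apply: eq_integral => x _; rewrite (res_eqC HV x (lexx 0) b0 hh) subr0.
  by rewrite -(rpotZ 0 x b0' hU) ge0_muleDr ?(nnm_ge0 x hU) ?(nnm_ge0 x hbU0).
have e2 : \int[m]_x ((w x)%:E * h x) <=
    \int[m]_x ((w x)%:E * dl x) + \int[m]_x ((w x)%:E * (b%:E * rpot b h x)).
  rewrite -nnm_integralD; [|exact: nnmM..].
  apply: nnm_le_integral; [exact: nnmM|apply: nnmD; exact: nnmM|] => x.
  rewrite -ge0_muleDr ?(nnm_ge0 x hd) ?(nnm_ge0 x hbU) //.
  by apply: lee_wpmul2l; [exact: (nnm_ge0 x hw')|rewrite addeC].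
move: e1 e2 hfin.
have i1 := nnm_integral_ge0 m (nnmM hvr' hU).
have i2 := nnm_integral_ge0 m (nnmM hw' hbU).
move=> -> + lt; rewrite leeD2rE // ge0_fin_numE //; apply: le_lt_trans lt; exact: leeDr.
Qed.

(** * A Kato inequality *)

Section maximum_principle.
Variables ap an : E -> R.
Hypotheses (map : measurable_fun setT ap) (man : measurable_fun setT an).
Hypotheses (ap0 : forall x, (0 <= ap x)%R) (an0 : forall x, (0 <= an x)%R).

Let P : E -> \bar R := fun x => (ap x)%:E.
Let N : E -> \bar R := fun x => (an x)%:E.
Let A : E -> \bar R := rpot 0 (fun x => P x + N x).
Let hP : nnm P. Proof. exact: nnm_EFin. Qed.
Let hN : nnm N. Proof. exact: nnm_EFin. Qed.
Let hPN : nnm (fun x => P x + N x). Proof. exact: nnmD. Qed.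
Let hA : nnm A. Proof. exact: nnm_rpot. Qed.

Definition dpot a x : R := (fine (rpot a P x) - fine (rpot a N x))%R.

Lemma measurable_dpot a : (0 <= a)%R -> measurable_fun setT (dpot a).
Proof.
move=> a0; apply: measurable_funB; apply: measurableT_comp => //;
  exact: (res_meas HV).
Qed.

Let q b x : R := if (0 < dpot 0 x)%R then dpot b x else 0%R.
Let qp b x : \bar R := (Num.max (q b x) 0)%:E.
Let qn b x : \bar R := (Num.max (- q b x) 0)%:E.
Let c x : \bar R := (Num.max (dpot 0 x) 0)%:E.

Let mq b : (0 <= b)%R -> measurable_fun setT (q b).
Proof.
move=> b0; apply: measurable_fun_ifT => //; last exact: measurable_dpot.
by apply: measurable_fun_ltr => //; exact: measurable_dpot.
Qed.

Let hqp b : (0 <= b)%R -> nnm (qp b).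
Proof.
move=> b0; apply: nnm_EFin; last by move=> x; rewrite le_max lexx orbT.
by apply: measurable_maxr => //; exact: mq.
Qed.

Let hqn b : (0 <= b)%R -> nnm (qn b).
Proof.
move=> b0; apply: nnm_EFin; last by move=> x; rewrite le_max lexx orbT.
by apply: measurable_maxr => //; apply: measurableT_comp => //; exact: mq.
Qed.

Let hc : nnm c.
Proof.
apply: nnm_EFin; last by move=> x; rewrite le_max lexx orbT.
by apply: measurable_maxr => //; exact: measurable_dpot.
Qed.

Let U0P a x : 0 <= rpot a P x. Proof. by apply: rpot_ge0 => y; apply: nnm_ge0. Qed.
Let U0N a x : 0 <= rpot a N x. Proof. by apply: rpot_ge0 => y; apply: nnm_ge0. Qed.

Let qp_le b x : qp b x <= rpot b P x.
Proof.
rewrite /qp /q /dpot; have := U0P b x; have := U0N b x.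
case: ifPn => _; last by rewrite maxxx.
case: (rpot b P x) => [r| |] //; case: (rpot b N x) => [s| |] //=;
  rewrite ?lee_fin ?leey // => s0 r0; rewrite ge_max; apply/andP; split => //; lra.
Qed.

Let qn_le b x : qn b x <= rpot b N x.
Proof.
rewrite /qn /q /dpot; have := U0P b x; have := U0N b x.
case: ifPn => _; last by rewrite oppr0 maxxx.
case: (rpot b P x) => [r| |] //; case: (rpot b N x) => [s| |] //=;
  rewrite ?lee_fin ?leey // => s0 r0; rewrite ge_max; apply/andP; split => //; lra.
Qed.

Let finP b x : A x < +oo -> (0 <= b)%R -> exists2 r, (0 <= r)%R & rpot b P x = r%:E.
Proof.
move=> Ax; rewrite le_eqVlt => /orP[/eqP <-|b0].
  by apply: rpot_lty_le Ax => // y; rewrite leeDl // nnm_ge0.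
apply: (@rpot_lty_le _ _ (fun x => P x + N x)) => //.
  by move=> y; rewrite leeDl // nnm_ge0.
by apply: le_lt_trans Ax; exact: le_rpot_index.
Qed.

Let finN b x : A x < +oo -> (0 <= b)%R -> exists2 r, (0 <= r)%R & rpot b N x = r%:E.
Proof.
move=> Ax; rewrite le_eqVlt => /orP[/eqP <-|b0].
  by apply: rpot_lty_le Ax => // y; rewrite leeDr // nnm_ge0.
apply: (@rpot_lty_le _ _ (fun x => P x + N x)) => //.
  by move=> y; rewrite leeDr // nnm_ge0.
by apply: le_lt_trans Ax; exact: le_rpot_index.
Qed.

Let c_le x : A x < +oo -> rpot 0 P x <= c x + rpot 0 N x.
Proof.
move=> Ax; have [r r0 Er] := finP Ax (lexx 0).
have [s s0 Es] := finN Ax (lexx 0).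
rewrite /c /dpot Er Es -EFinD lee_fin /= -lerBlDr le_max lexx //.
Qed.

Let step1 b x : (0 < b)%R -> A x < +oo ->
  c x + qn b x <= qp b x + b%:E * rpot b c x.
Proof.
move=> b0 Ax.
have [r r0 Er] := finP Ax (lexx 0).
have [s s0 Es] := finN Ax (lexx 0).
have [r' r'0 Er'] := finP Ax (ltW b0).
have [s' s'0 Es'] := finN Ax (ltW b0).
have hU h : nnm h -> nnm (rpot 0 h) by move=> hh; exact: nnm_rpot.
have UA := rpot_rpot0_lty b0 hPN Ax.
have [t t0 Et] : exists2 t, (0 <= t)%R & rpot b (rpot 0 P) x = t%:E.
  apply: (@rpot_lty_le _ _ A) => //; first exact: hU.
  by move=> y; apply: le_rpot => // z; rewrite leeDl // nnm_ge0.
have [u u0 Eu] : exists2 u, (0 <= u)%R & rpot b (rpot 0 N) x = u%:E.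
  apply: (@rpot_lty_le _ _ A) => //; first exact: hU.
  by move=> y; apply: le_rpot => // z; rewrite leeDr // nnm_ge0.
have cP y : c y <= A y.
  have [|] := ltP (A y) +oo; last by rewrite leye_eq => /eqP ->; rewrite leey.
  move=> Ay; have [r1 r10 Er1] := finP Ay (lexx 0).
  have [s1 s10 Es1] := finN Ay (lexx 0).
  rewrite /A rpotD // /c /dpot Er1 Es1 -EFinD lee_fin /= ge_max.
  by apply/andP; split; lra.
have [v v0 Ev] : exists2 v, (0 <= v)%R & rpot b c x = v%:E by apply: (@rpot_lty_le _ _ A).
have : rpot b (rpot 0 P) x <= rpot b c x + rpot b (rpot 0 N) x.
  rewrite -rpotD //; last exact: hU.
  apply: (@le_rpot_off _ A) => //; first exact: hU.
  by apply: nnmD => //; exact: hU.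
have := res_eq HV x (lexx 0) b0 hP; have := res_eq HV x (lexx 0) b0 hN.
rewrite /qn /qp /q /c /dpot Er Es Er' Es' Et Eu Ev subr0 -?EFinM -?EFinD lee_fin /=.
move=> [e1] [e2] e3; rewrite lee_fin.
case: ifPn => z0.
  rewrite (max_l (ltW z0)).
  have [] := lerP 0%R (r' - s') => h; rewrite ?(max_l h) ?(max_r (ltW h)).
    rewrite max_r; [nra|lra].
  rewrite max_l; [nra|lra].
by move: z0; rewrite -leNgt => z0; rewrite oppr0 !maxxx (max_r z0) !add0r mulr_ge0 // ltW.
Qed.

Let hbZ b h : (0 < b)%R -> nnm h -> nnm (fun x => b%:E * rpot 0 h x).
Proof. by move=> b0 hh; apply: nnmZ; [exact: ltW|exact: nnm_rpot]. Qed.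

Let rpot0_shift b h x : (0 < b)%R -> nnm h ->
  rpot 0 h x = rpot b (fun y => h y + b%:E * rpot 0 h y) x.
Proof.
move=> b0 hh; rewrite rpotD //; last exact: hbZ.
rewrite rpotZ; [|exact: ltW|exact: nnm_rpot].
by rewrite -{2}(subr0 b) -(res_eq HV).
Qed.

Let bound_shift b h k x : (0 < b)%R -> nnm h -> nnm k ->
  (forall y, h y <= rpot b k y) -> h x + b%:E * rpot 0 h x <= rpot 0 k x.
Proof.
move=> b0 hh hk hle; rewrite (res_eqC HV x (lexx 0) b0 hk) subr0 leeD //.
apply: lee_wpmul2l; first by rewrite lee_fin ltW.
by apply: le_rpot => //; apply: nnm_rpot => //; exact: ltW.
Qed.

Let step2 b x : (0 < b)%R -> A x < +oo ->
  c x + (qn b x + b%:E * rpot 0 (qn b) x) <= qp b x + b%:E * rpot 0 (qp b) x.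
Proof.
move=> b0 Ax; have b0' := ltW b0.
pose Yp y := qp b y + b%:E * rpot 0 (qp b) y.
pose Yn y := qn b y + b%:E * rpot 0 (qn b) y.
have hYp : nnm Yp by apply: nnmD; [exact: hqp|apply: hbZ => //; exact: hqp].
have hYn : nnm Yn by apply: nnmD; [exact: hqn|apply: hbZ => //; exact: hqn].
have YpP y : Yp y <= rpot 0 P y by apply: bound_shift => //; exact: hqp.
have YnN y : Yn y <= rpot 0 N y by apply: bound_shift => //; exact: hqn.
have finY y : A y < +oo -> exists2 r, Yp y = r%:E & exists2 s, Yn y = s%:E &
    (0 <= r)%R /\ (0 <= s)%R.
  move=> Ay; have [r r0 Er] := finP Ay (lexx 0); have [s s0 Es] := finN Ay (lexx 0).
  have := nnm_ge0 y hYp; have := nnm_ge0 y hYn; have := YpP y; have := YnN y.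
  rewrite Er Es; case: (Yp y) => [r1| |] //; case: (Yn y) => [s1| |] // _ _.
  by move=> ? ?; exists r1 => //; exists s1.
(* The excess of the left-hand side over the right-hand side is subinvariant, hence 0. *)
pose D y : \bar R := (Num.max (fine (c y) + fine (Yn y) - fine (Yp y)) 0)%:E.
have hD : nnm D.
  apply: nnm_EFin; last by move=> y; rewrite le_max lexx orbT.
  apply: measurable_maxr => //; apply: measurable_funB; first apply: measurable_funD.
  - by apply: measurableT_comp => //; exact: nnm_meas hc.
  - by apply: measurableT_comp => //; exact: nnm_meas hYn.
  - by apply: measurableT_comp => //; exact: nnm_meas hYp.
have DA y : D y <= A y.
  have [|] := ltP (A y) +oo; last by rewrite leye_eq => /eqP ->; rewrite leey.
  move=> Ay; have [r r0 Er] := finP Ay (lexx 0); have [s s0 Es] := finN Ay (lexx 0).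
  have [r1 Er1 [s1 Es1 [r10 s10]]] := finY _ Ay.
  have := YpP y; have := YnN y.
  rewrite /A rpotD // /D /c /dpot Er Es Er1 Es1 -EFinD !lee_fin /= => ss rr.
  rewrite ge_max; apply/andP; split; last lra.
  suff : (Num.max (r - s) 0 <= r)%R by lra.
  by rewrite ge_max; apply/andP; split; lra.
have Dinv y : A y < +oo -> D y <= b%:E * rpot b D y.
  move=> Ay; have UA := rpot_rpot0_lty b0 hPN Ay.
  have lec : rpot b (fun z => c z + Yn z) y <= rpot b (fun z => D z + Yp z) y.
    apply: (@le_rpot_off _ A) => //; [exact: nnmD|exact: nnmD|].
    move=> z Az; have [r1 Er1 [s1 Es1 _]] := finY _ Az.
    rewrite /D Er1 Es1 /c -!EFinD lee_fin /= -lerBlDr le_max lexx //.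
  rewrite rpotD // rpotD // in lec.
  have e1 : rpot b Yp y = rpot 0 (qp b) y.
    by rewrite -rpot0_shift //; exact: hqp.
  have e2 : rpot b Yn y = rpot 0 (qn b) y.
    by rewrite -rpot0_shift //; exact: hqn.
  have := step1 b0 Ay.
  have [r1 Er1 [s1 Es1 _]] := finY _ Ay.
  have [u u0 Eu] : exists2 u, (0 <= u)%R & rpot b D y = u%:E by apply: (@rpot_lty_le _ _ A).
  move: lec (Er1) (Es1); rewrite e1 e2 Eu /Yp /Yn.
  have := rpot_ge0 b y (fun z => nnm_ge0 z hc).
  have := rpot_ge0 0 y (fun z => nnm_ge0 z (hqp b0')).
  have := rpot_ge0 0 y (fun z => nnm_ge0 z (hqn b0')).
  case: (rpot 0 (qn b) y) => [v| |] // v0; last first.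
    by move=> _ _ _ _; rewrite gt0_muley ?lte_fin // addey.
  case: (rpot 0 (qp b) y) => [v'| |] // v'0; last first.
    by move=> _ _; rewrite gt0_muley ?lte_fin // addey.
  case: (rpot b c y) => [v2| |] // v20.
  rewrite /D Er1 Es1 /c /qp /qn -?EFinM -?EFinD !lee_fin /= => i1.
  move=> [i2] [i3] i4; rewrite ge_max.
  by apply/andP; split; [nra|rewrite mulr_ge0 // ltW].
have := subinvariant_eq0 b0 hD hPN DA Dinv Ax.
have [r1 Er1 [s1 Es1 _]] := finY _ Ax.
rewrite -/(Yp x) -/(Yn x) /D /c Er1 Es1 /= => -[].
set t := (_ - _)%R => h; rewrite lee_fin.
have : (t <= Num.max t 0)%R by rewrite le_max lexx.
by rewrite h /t subr_le0.
Qed.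

Let SP x : R := if (0 < dpot 0 x)%R then ap x else 0%R.
Let SN x : R := if (0 < dpot 0 x)%R then an x else 0%R.

Let hSP : nnm (fun x => (SP x)%:E).
Proof.
apply: nnm_EFin; last by move=> x; rewrite /SP; case: ifP.
apply: measurable_fun_ifT => //.
by apply: measurable_fun_ltr => //; exact: measurable_dpot.
Qed.

Let hSN : nnm (fun x => (SN x)%:E).
Proof.
apply: nnm_EFin; last by move=> x; rewrite /SN; case: ifP.
apply: measurable_fun_ifT => //.
by apply: measurable_fun_ltr => //; exact: measurable_dpot.
Qed.

Let dl b x := resdist b ap x + resdist b an x.
Let hdl b : (0 <= b)%R -> nnm (dl b).
Proof. by move=> b0; apply: nnmD; apply: nnm_resdist. Qed.

Let step3 b x : (0 < b)%R ->
  b%:E * qp b x + (SN x)%:E <= b%:E * qn b x + (SP x)%:E + dl b x.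
Proof.
move=> b0; rewrite /qp /qn /q /SN /SP /dl /resdist /dpot.
case: ifPn => _; last first.
  by rewrite oppr0 maxxx mule0 !add0e adde_ge0.
have := U0P b x; have := U0N b x; rewrite -/P -/N.
case: (rpot b P x) => [r| |] // ; last first.
  by move=> _ _; rewrite abs_infty_sub // ge0_addye ?abse_ge0 // ge0_addey ?leey // -EFinM -EFinD lee_fin addr_ge0 // mulr_ge0 ?(ltW b0) // le_max lexx orbT.
case: (rpot b N x) => [s| |] // s0 r0; last first.
  by rewrite abs_infty_sub // ge0_addey ?leey // -EFinM -EFinD lee_fin addr_ge0 // mulr_ge0 ?(ltW b0) // le_max lexx orbT.
rewrite -?EFinM -?EFinB ?abse_EFin -?EFinM -?EFinD !lee_fin /=.
have h1 := ler_norm (b * r - ap x)%R; have h2 := ler_norm (- (b * s - an x))%R.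
have h4 := ler_norm (- (b * r - ap x))%R; have h5 := ler_norm (b * s - an x)%R.
rewrite !normrN in h2 h4.
by case: (leP (r - s)%R 0%R) => ?; case: (leP (- (r - s))%R 0%R) => ?; nra.
Qed.

Let step4 b x : (0 < b)%R -> A x < +oo ->
  c x + rpot 0 (fun y => (SN y)%:E) x <=
  rpot 0 (fun y => (SP y)%:E) x + (rpot b (fun y => P y + N y) x + rpot 0 (dl b) x).
Proof.
move=> b0 Ax; have b0' := ltW b0.
have := step2 b0 Ax.
have : rpot 0 (fun y => b%:E * qp b y + (SN y)%:E) x <=
       rpot 0 (fun y => b%:E * qn b y + (SP y)%:E + dl b y) x.
  apply: le_rpot; [| |by move=> y; exact: step3].
    by apply: nnmD => //; apply: nnmZ => //; exact: hqp.
  by apply: nnmD; [apply: nnmD => //; apply: nnmZ => //; exact: hqn|exact: hdl].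
have hqpZ : nnm (fun y => b%:E * qp b y) by apply: nnmZ => //; exact: hqp.
have hqnZ : nnm (fun y => b%:E * qn b y) by apply: nnmZ => //; exact: hqn.
rewrite (rpotD _ _ hqpZ hSN) (rpotD _ _ (nnmD hqnZ hSP) (hdl b0')) (rpotD _ _ hqnZ hSP).
rewrite (rpotZ _ _ b0' (hqp b0')) (rpotZ _ _ b0' (hqn b0')).
have [r r0 Er] := finP Ax (lexx 0); have [s s0 Es] := finN Ax (lexx 0).
have [r' r'0 Er'] := finP Ax b0'; have [s' s'0 Es'] := finN Ax b0'.
have e1 : b%:E * rpot 0 (qn b) x <= s%:E.
  rewrite -Es; apply: le_trans (bound_shift x b0 (hqn b0') hN (qn_le b)).
  by rewrite leeDr //; apply: nnm_ge0 (hqn b0').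
have e2 : b%:E * rpot 0 (qp b) x <= r%:E.
  rewrite -Er; apply: le_trans (bound_shift x b0 (hqp b0') hP (qp_le b)).
  by rewrite leeDr //; apply: nnm_ge0 (hqp b0').
have q1 := qp_le b x; rewrite Er' /qp in q1.
have n1 : 0 <= b%:E * rpot 0 (qn b) x.
  by apply: mule_ge0 => //; apply: rpot_ge0 => y; apply: nnm_ge0; exact: hqn.
have n2 : 0 <= b%:E * rpot 0 (qp b) x.
  by apply: mule_ge0 => //; apply: rpot_ge0 => y; apply: nnm_ge0; exact: hqp.
have n3 : 0 <= rpot 0 (dl b) x.
  by apply: rpot_ge0 => y; apply: nnm_ge0; exact: hdl.
have n4 : 0 <= qn b x by apply: nnm_ge0; exact: hqn.
have n5 : 0 <= rpot 0 (fun y => (SN y)%:E) x by apply: rpot_ge0 => y; exact: (nnm_ge0 y hSN).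
have n6 : 0 <= rpot 0 (fun y => (SP y)%:E) x by apply: rpot_ge0 => y; exact: (nnm_ge0 y hSP).
rewrite rpotD // Er' Es'.
move: q1 e1 e2 n1 n2 n3 n4 n5 n6; rewrite /c /qp /qn.
set mm := Num.max (- q b x)%R _; set pp := Num.max (q b x) _; set cc := Num.max _ _.
case: (b%:E * _) => [t| |] //; case: (b%:E * _) => [t'| |] //.
case: (rpot 0 (dl b) x) => [t1| |] //; last first.
  by move=> _ _ _ _ _ _ _ _ X0 _ _; rewrite (ge0_addey X0) leey.
case: (rpot 0 (fun y => (SP y)%:E) x) => [t2| |] //; last first.
  by move=> *; exact: leey.
case: (rpot 0 (fun y => (SN y)%:E) x) => [t3| |] //.
rewrite -?EFinD ?lee_fin; lra.
Qed.

(** A Kato inequality. Let [z] and [z_b] be the images of [ap - an] by [U_0] and [U_b], let [S] be the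
    set where [z] is positive, and let [q] be [z_b] on [S] and 0 elsewhere. From [z = z_b + b U_b z]
    one gets [z^+ + q^- <= q^+ + b U_b z^+]; eliminating [z^+] from the right-hand side gives
    [z^+ + q^- + b U_0 q^- <= q^+ + b U_0 q^+]. As [b] grows, [b q] tends to [1_S (ap - an)] in the
    weighted L1 space. Nonnegative terms stay on either side of the inequalities because the
    potentials may be infinite on a null set. *)
Lemma maximum_principle :
  \int[m]_x ((w x)%:E * (ap x)%:E) < +oo ->
  \int[m]_x ((w x)%:E * (an x)%:E) < +oo ->
  {ae m, forall x,
    (Num.max (dpot 0 x) 0)%:E +
      rpot 0 (fun y => (if (0 < dpot 0 y)%R then an y else 0%R)%:E) x <=
    rpot 0 (fun y => (if (0 < dpot 0 y)%R then ap y else 0%R)%:E) x}.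
Proof.
move=> Pfin Nfin.
have PNfin : \int[m]_x ((w x)%:E * (P x + N x)) < +oo.
  under eq_integral do rewrite ge0_muleDr ?lee_fin //.
  rewrite nnm_integralD; [exact: lte_add_pinfty|apply: nnmM => //; exact: nnm_w..].
have Aae : {ae m, forall x, A x < +oo} by exact: ae_rpot_lty.
(* The excess of the left-hand side over the right-hand side at index 0. *)
pose G x : \bar R := (Num.max (fine (c x) + fine (rpot 0 (fun y => (SN y)%:E) x)
   - fine (rpot 0 (fun y => (SP y)%:E) x)) 0)%:E.
have hG : nnm G.
  apply: nnm_EFin; last by move=> y; rewrite le_max lexx orbT.
  apply: measurable_maxr => //; apply: measurable_funB; first apply: measurable_funD.
  - by apply: measurableT_comp => //; exact: nnm_meas hc.
  - by apply: measurableT_comp => //; exact: nnm_meas (nnm_rpot (lexx 0) hSN).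
  - by apply: measurableT_comp => //; exact: nnm_meas (nnm_rpot (lexx 0) hSP).
have finS x : A x < +oo -> exists r s, rpot 0 (fun y => (SP y)%:E) x = r%:E /\
    rpot 0 (fun y => (SN y)%:E) x = s%:E.
  move=> Ax.
  have [|r _ Er] := @rpot_lty_le 0 (fun y => (SP y)%:E) _ x hSP hPN _ Ax.
    by move=> y; rewrite /SP -EFinD lee_fin; case: ifP; rewrite ?lerDl // addr_ge0.
  have [|s _ Es] := @rpot_lty_le 0 (fun y => (SN y)%:E) _ x hSN hPN _ Ax.
    by move=> y; rewrite /SN -EFinD lee_fin; case: ifP; rewrite ?lerDr // addr_ge0.
  by exists r, s.
have G_le n x : A x < +oo ->
    G x <= rpot n.+1%:R (fun y => P y + N y) x + rpot 0 (dl n.+1%:R) x.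
  move=> Ax; have [r [s [Er Es]]] := finS _ Ax.
  have := step4 (ltr0Sn R n) Ax; rewrite /G Er Es /c /=.
  have := rpot_ge0 n.+1%:R x (fun y => nnm_ge0 y hPN).
  have := rpot_ge0 0 x (fun y => nnm_ge0 y (hdl (ler0n R n.+1))).
  case: (_ + rpot 0 _ x) (@adde_ge0 R (rpot n.+1%:R (P \+ N) x) (rpot 0 (dl n.+1%:R) x)) => [t| |].
  - move=> h h1 h2; have := h h2 h1; rewrite -?EFinD !lee_fin => t0.
    by move=> i1; rewrite ge_max t0 andbT lerBlDl.
  - by move=> *; exact: leey.
  - by move=> h h1 h2; have := h h2 h1.
have hvr' : nnm (fun x => (vr x)%:E) by exact: nnm_vr.
have hw' : nnm (fun x => (w x)%:E) by exact: nnm_w.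
have iG n : \int[m]_x ((vr x)%:E * G x) <=
    \int[m]_x ((w x)%:E * dl n.+1%:R x) + \int[m]_x ((w x)%:E * dl n.+1%:R x).
  have hd := hdl (ler0n R n.+1).
  have hn0 : (0 <= n.+1%:R :> R)%R by [].
  have hn1 : (0 < n.+1%:R :> R)%R by [].
  have hr1 : nnm (rpot n.+1%:R (fun y => P y + N y)) by exact: nnm_rpot.
  have hr2 : nnm (rpot 0 (dl n.+1%:R)) by exact: nnm_rpot.
  apply: (@le_trans _ _ (\int[m]_x ((vr x)%:E * (rpot n.+1%:R (fun y => P y + N y) x) +
     (vr x)%:E * rpot 0 (dl n.+1%:R) x))).
    apply: nnm_ae_le_integral; [exact: nnmM|apply: nnmD; exact: nnmM|].
    apply: filterS Aae => x Ax; rewrite -ge0_muleDr ?(nnm_ge0 x hr1) ?(nnm_ge0 x hr2) //.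
    by apply: lee_wpmul2l; [exact: (nnm_ge0 x hvr')|exact: G_le].
  rewrite nnm_integralD; [|exact: nnmM..].
  apply: leeD; last by rewrite int_vr_rpot0.
  apply: int_vr_rpot_le => // x.
  rewrite rpotD // /dl /resdist -/P -/N.
  have := U0P n.+1%:R x; have := U0N n.+1%:R x.
  case: (rpot _ P x) => [r| |] // ; last first.
    move=> s0 _; rewrite abs_infty_sub // (ge0_addye (abse_ge0 _)) ge0_addey ?leey //.
    by rewrite mule_ge0 // adde_ge0.
  case: (rpot _ N x) => [s| |] // s0 r0; last first.
    rewrite abs_infty_sub // (ge0_addey (abse_ge0 _)) ge0_addey ?leey //.
    by rewrite mule_ge0 // adde_ge0.
  rewrite /P /N.
  rewrite -?EFinD -?EFinM -?EFinD -?EFinB ?abse_EFin -?EFinD lee_fin.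
  have h1 := ler_norm (- (n.+1%:R * r - ap x))%R.
  have h2 := ler_norm (- (n.+1%:R * s - an x))%R.
  by rewrite !normrN in h1 h2; lra.
have dl0 : \int[m]_x ((w x)%:E * dl n.+1%:R x) @[n --> \oo] --> 0.
  apply: cvg_trans (cvge0D (res_cvg map ap0 Pfin) (res_cvg man an0 Nfin)).
  apply: near_eq_cvg; apply: nearW => n.
  have h1 : nnm (resdist n.+1%:R ap) by exact: nnm_resdist.
  have h2 : nnm (resdist n.+1%:R an) by exact: nnm_resdist.
  rewrite -nnm_integralD; [|exact: nnmM..].
  by apply: eq_integral => x _; rewrite ge0_muleDr ?(nnm_ge0 x h1) ?(nnm_ge0 x h2).
have : \int[m]_x ((vr x)%:E * G x) <= 0.
  apply: (cvge_to_ge (cvge0D dl0 dl0)).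
  by apply: nearW => n; exact: iG.
move=> /(ae_eq0_of_integral mvr vr0 hG); apply: filterS2 Aae => x Ax.
have [r [s [Er Es]]] := finS _ Ax.
rewrite /G -/(SP) -/(SN) -[X in _ + rpot 0 X x <= _]/(fun y => (SN y)%:E).
rewrite -[X in _ <= rpot 0 X x]/(fun y => (SP y)%:E) Er Es /c /= => -[].
set t := (_ - _)%R => h; rewrite lee_fin.
have : (t <= Num.max t 0)%R by rewrite le_max lexx.
by rewrite h /t subr_le0.
Qed.

End maximum_principle.

(** * Testing against supermedian functions *)

Lemma resdist_ge b (f : E -> R) x : (0 < b)%R -> measurable_fun setT f ->
  (forall x, (0 <= f x)%R) ->
  b%:E * rpot b (fun y => (f y)%:E) x <= (f x)%:E + resdist b f x /\
  (f x)%:E <= b%:E * rpot b (fun y => (f y)%:E) x + resdist b f x.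
Proof.
move=> b0 mf f0; rewrite /resdist.
have : 0 <= rpot b (fun y => (f y)%:E) x by apply: rpot_ge0 => y; rewrite lee_fin.
case: (rpot _ _ _) => [r| |] // r0; last first.
  rewrite abs_infty_sub // (ge0_addey (mule_ge0 _ _)) ?lee_fin ?(ltW b0) //.
  by rewrite ge0_addey ?lee_fin // !leey.
rewrite -EFinM -EFinB abse_EFin -!EFinD !lee_fin.
have h1 := ler_norm (b * r - f x)%R; have h2 := ler_norm (- (b * r - f x))%R.
by rewrite normrN in h2; split; lra.
Qed.

Definition supermedian (e : E -> \bar R) :=
  nnm e /\ forall a x, (0 < a)%R -> a%:E * rpot a e x <= e x.

Lemma rpot_e_fin a (j : R) e x : (0 < a)%R -> (0 <= j)%R -> nnm e ->
  (forall y, e y <= j%:E * (w y)%:E) ->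
  exists2 r, (0 <= r)%R & rpot a e x = r%:E.
Proof.
move=> a0 j0 he ej.
have hjw : nnm (fun y => j%:E * (w y)%:E) by apply: nnmZ => //; exact: nnm_w.
have : rpot a (fun y => j%:E * (w y)%:E) x < +oo.
  rewrite rpotZ //; last exact: nnm_w.
  apply: lte_mul_pinfty => //.
  rewrite (eq_rpot _ _ (fun y => esym (wE y))).
  by apply: rpot_rpot0_lty => //; [exact: nnm_vr|rewrite wE ltry].
exact: rpot_lty_le.
Qed.

(** The density is [psi = b (e - b U_b e)]: the resolvent equation gives
    [U_eps psi = (b^2 U_b e - b eps U_eps e) / (b - eps)], and [eps U_eps e] vanishes with [eps]
    because [e] is at most a multiple of the potential [w]. *)
Lemma supermedian_potential b (j : R) e : (0 < b)%R -> (0 <= j)%R ->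
  supermedian e -> (forall y, e y <= j%:E * (w y)%:E) ->
  exists2 psi, nnm psi & forall x, rpot 0 psi x = b%:E * rpot b e x.
Proof.
move=> b0 j0 [he supe] ej; have b0' := ltW b0.
have efin y : exists2 r, (0 <= r)%R & e y = r%:E.
  have := ej y; have := nnm_ge0 y he; case: (e y) => [r| |] // r0 _.
  by exists r.
have Ufin a z : (0 < a)%R -> exists2 r, (0 <= r)%R & rpot a e z = r%:E.
  by move=> a0; exact: (rpot_e_fin _ a0 j0 he ej).
have hUb : nnm (rpot b e) by exact: nnm_rpot.
pose psi y : \bar R := (b * (fine (e y) - b * fine (rpot b e y)))%:E.
have hpsi : nnm psi.
  apply: nnm_EFin => [|y].
    apply: measurable_funM => //; apply: measurable_funB.
      by apply: measurableT_comp => //; exact: nnm_meas he.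
    apply: measurable_funM => //.
    by apply: measurableT_comp => //; exact: nnm_meas hUb.
  apply: mulr_ge0 => //; rewrite subr_ge0.
  have := supe b y b0; have [r r0 ->] := efin y.
  by have [s s0 ->] := Ufin b y b0; rewrite -EFinM lee_fin.
exists psi => // x.
have hbb : nnm (fun y => b%:E * (b%:E * rpot b e y)) by apply: nnmZ => //; exact: nnmZ.
have psiE y : psi y + b%:E * (b%:E * rpot b e y) = b%:E * e y.
  rewrite /psi; have [r r0 ->] := efin y; have [s s0 ->] := Ufin b y b0.
  by rewrite -!EFinM -EFinD /=; congr EFin; ring.
have [t t0 Et] := Ufin b x b0.
pose eps (n : nat) : R := (n.+1%:R^-1)%R.
have eps0 n : (0 < eps n)%R by rewrite invr_gt0 ltr0Sn.
have epsb : \forall n \near \oo, (eps n < b)%R.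
  near=> n; rewrite /eps invf_plt ?posrE ?ltr0Sn //.
  apply: (@lt_le_trans _ _ n%:R); last by rewrite ler_nat.
  by near: n; exact: nbhs_infty_gtr.
pose s n := fine (rpot (eps n) e x).
have sE n : rpot (eps n) e x = (s n)%:E.
  by rewrite /s; have [r r0 ->] := Ufin (eps n) x (eps0 n).
have psin n : (eps n < b)%R ->
    rpot (eps n) psi x = ((b ^+ 2 * t - b * (eps n * s n)) / (b - eps n))%:E.
  move=> nb.
  have : rpot (eps n) (fun y => psi y + b%:E * (b%:E * rpot b e y)) x =
         rpot (eps n) (fun y => b%:E * e y) x by exact: eq_rpot.
  rewrite rpotD // !rpotZ //; last exact: nnmZ.
  have := res_eqC HV x (ltW (eps0 n)) nb he.
  rewrite sE Et; have bn0 : (0 < b - eps n)%R by rewrite subr_gt0.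
  have := rpot_ge0 (eps n) x (fun y => nnm_ge0 y hUb).
  have := rpot_ge0 (eps n) x (fun y => nnm_ge0 y hpsi).
  case: (rpot _ (rpot b e) x) => [u| |] //; last first.
    by move=> _ _; rewrite gt0_muley ?lte_fin.
  case: (rpot _ psi x) => [v| |] // _ _; rewrite -!EFinM -!EFinD => -[e1].
  move=> [e2]; congr EFin; apply: (mulIf (lt0r_neq0 bn0)).
  rewrite divfK ?lt0r_neq0 //.
  have -> : v = (b * s n - b * (b * u))%R by rewrite -e2; ring.
  by rewrite e1; ring.
have epss : (eps n * s n)%R @[n --> \oo] --> (0%R : R).
  have wx : rpot 0 (fun y => (vr y)%:E) x < +oo by rewrite wE ltry.
  have := cvg_rpot0_small nnm_vr wx => c0.
  have : (eps n)%:E * rpot (eps n) e x @[n --> \oo] --> 0.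
    apply: (@squeeze_cvge _ _ _ _ (cst 0) _
      (fun n => j%:E * ((eps n)%:E * rpot (eps n) (rpot 0 (fun y => (vr y)%:E)) x))).
    - apply: nearW => n; apply/andP; split.
        rewrite mule_ge0 ?lee_fin ?(ltW (eps0 n)) //.
        by apply: rpot_ge0 => y; exact: nnm_ge0 he.
      rewrite muleCA; apply: lee_wpmul2l; first by rewrite lee_fin (ltW (eps0 n)).
      rewrite -rpotZ //; last by apply: nnm_rpot => //; exact: nnm_vr.
      apply: le_rpot => //; last by move=> y; rewrite wE.
      by apply: nnmZ => //; apply: nnm_rpot => //; exact: nnm_vr.
    - exact: cvg_cst.
    - by rewrite -(mule0 j%:E); apply: cvgeZl.
  have -> : (fun n => (eps n)%:E * rpot (eps n) e x) = (fun n => (eps n * s n)%:E).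
    by apply/funext => n; rewrite sE EFinM.
  by move=> /fine_cvgP[_].
have epsc : eps n @[n --> \oo] --> (0%R : R) by exact: cvg_harmonic.
have lim1 : ((b ^+ 2 * t - b * (eps n * s n)) / (b - eps n))%R @[n --> \oo] --> (b * t)%R.
  have -> : (b * t = (b ^+ 2 * t - b * 0) / (b - 0))%R.
    by field; rewrite lt0r_neq0.
  apply: cvgM; first by apply: cvgB; [exact: cvg_cst|apply: cvgMr].
  apply: cvgV; first by rewrite subr0 lt0r_neq0.
  by apply: cvgB => //; exact: cvg_cst.
have lim2 : rpot (eps n) psi x @[n --> \oo] --> (b * t)%:E.
  have : ((b ^+ 2 * t - b * (eps n * s n)) / (b - eps n))%:E @[n --> \oo] --> (b * t)%:E.
    by apply/fine_cvgP; split; [exact: nearW|exact: lim1].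
  apply: cvg_trans; apply: near_eq_cvg; apply: filterS epsb => n nb.
  by rewrite psin.
rewrite Et -EFinM -(cvg_lim _ (res_cvg0 HV hpsi (x := x))) //; exact: cvg_lim.
Unshelve. all: by end_near. Qed.

(** As [b U_b e] is a potential [U_0 psi], symmetry turns the integrals of [bn] and [bp] against it into
    integrals of [psi] against their potentials, which are ordered. Then [b] tends to infinity, the
    errors being controlled by [e <= j w]. *)
Lemma supermedian_test (bp bn : E -> R) (j : R) e :
  measurable_fun setT bp -> measurable_fun setT bn ->
  (forall x, (0 <= bp x)%R) -> (forall x, (0 <= bn x)%R) ->
  \int[m]_x ((w x)%:E * (bp x)%:E) < +oo ->
  \int[m]_x ((w x)%:E * (bn x)%:E) < +oo ->
  {ae m, forall x, rpot 0 (fun y => (bn y)%:E) x <= rpot 0 (fun y => (bp y)%:E) x} ->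
  (0 <= j)%R -> supermedian e -> (forall y, e y <= j%:E * (w y)%:E) ->
  \int[m]_x ((bn x)%:E * e x) <= \int[m]_x ((bp x)%:E * e x).
Proof.
move=> mbp mbn bp0 bn0 ip im ple j0 supe ej.
have he := supe.1.
have hp : nnm (fun x => (bp x)%:E) by exact: nnm_EFin.
have hn : nnm (fun x => (bn x)%:E) by exact: nnm_EFin.
have hw' := nnm_w.
pose dp n x := resdist n.+1%:R bp x; pose dn n x := resdist n.+1%:R bn x.
have hdp n : nnm (dp n) by exact: nnm_resdist.
have hdn n : nnm (dn n) by exact: nnm_resdist.
have edelta f : nnm f -> \int[m]_x (f x * e x) <= j%:E * \int[m]_x ((w x)%:E * f x).
  move=> hf; rewrite -nnm_integralZ //; last exact: nnmM.
  apply: nnm_le_integral; [exact: nnmM|by apply: nnmZ => //; exact: nnmM|] => x.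
  by rewrite muleA muleC; apply: lee_wpmul2r; [exact: nnm_ge0 hf|].
have step n : \int[m]_x ((bn x)%:E * e x) <= \int[m]_x ((bp x)%:E * e x) +
    (j%:E * \int[m]_x ((w x)%:E * dp n x) + j%:E * \int[m]_x ((w x)%:E * dn n x)).
  have n0 : (0 < n.+1%:R :> R)%R by [].
  have n0' : (0 <= n.+1%:R :> R)%R by [].
  have [psi hpsi psiE] := supermedian_potential n0 j0 supe ej.
  have hU f : nnm f -> nnm (rpot n.+1%:R f) by move=> hf; exact: nnm_rpot.
  have hU0 f : nnm f -> nnm (rpot 0 f) by move=> hf; exact: nnm_rpot.
  have swap (f : E -> \bar R) : nnm f ->
      \int[m]_x (f x * (n.+1%:R%:E * rpot n.+1%:R e x)) =
      \int[m]_x ((n.+1%:R%:E * rpot n.+1%:R f x) * e x).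
    move=> hf; under eq_integral do rewrite muleCA.
    rewrite nnm_integralZ //; last by apply: nnmM => //; exact: hU.
    rewrite (res_sym HV) //.
    rewrite -nnm_integralZ //; last by apply: nnmM => //; exact: hU.
    by apply: eq_integral => x _; rewrite muleCA muleC.
  have s1 : \int[m]_x ((bn x)%:E * (n.+1%:R%:E * rpot n.+1%:R e x)) <=
            \int[m]_x ((bp x)%:E * (n.+1%:R%:E * rpot n.+1%:R e x)).
    under eq_integral do rewrite -psiE.
    under [leRHS]eq_integral do rewrite -psiE.
    rewrite (res_sym HV (lexx 0%R) hpsi hn) (res_sym HV (lexx 0%R) hpsi hp).
    apply: nnm_ae_le_integral; [by apply: nnmM => //; exact: hU0|
      by apply: nnmM => //; exact: hU0|].
    by apply: filterS ple => x; apply: lee_wpmul2l; exact: nnm_ge0 hpsi.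
  have s2 : \int[m]_x ((bp x)%:E * (n.+1%:R%:E * rpot n.+1%:R e x)) <=
      \int[m]_x ((bp x)%:E * e x) + j%:E * \int[m]_x ((w x)%:E * dp n x).
    rewrite swap //; apply: (@le_trans _ _ (\int[m]_x ((bp x)%:E * e x + dp n x * e x))).
      apply: nnm_le_integral; [by apply: nnmM => //; apply: nnmZ => //; exact: hU|
        by apply: nnmD; exact: nnmM|] => x.
      rewrite -ge0_muleDl ?(nnm_ge0 x hp) ?(nnm_ge0 x (hdp n)) //.
      apply: lee_wpmul2r; first exact: nnm_ge0 he.
      by have [] := resdist_ge x n0 mbp bp0.
    by rewrite nnm_integralD; [apply: leeD => //; exact: edelta|exact: nnmM..].
  have s3 : \int[m]_x ((bn x)%:E * e x) <=
      \int[m]_x ((bn x)%:E * (n.+1%:R%:E * rpot n.+1%:R e x)) +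
      j%:E * \int[m]_x ((w x)%:E * dn n x).
    rewrite swap //; apply: (@le_trans _ _ (\int[m]_x
        ((n.+1%:R%:E * rpot n.+1%:R (fun y => (bn y)%:E) x) * e x + dn n x * e x))).
      apply: nnm_le_integral; [exact: nnmM|
        by apply: nnmD; apply: nnmM => //; apply: nnmZ => //; exact: hU|] => x.
      rewrite -ge0_muleDl ?(nnm_ge0 x (hdn n)) ?(nnm_ge0 x (nnmZ n0' (hU _ hn))) //.
      apply: lee_wpmul2r; first exact: nnm_ge0 he.
      by have [] := resdist_ge x n0 mbn bn0.
    rewrite nnm_integralD; [apply: leeD => //; exact: edelta|
      by apply: nnmM => //; apply: nnmZ => //; exact: hU|exact: nnmM].
  apply: (le_trans s3); rewrite addeA; apply: leeD; last exact: lexx.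
  exact: le_trans s1 s2.
have lim0 : \int[m]_x ((bp x)%:E * e x) +
    (j%:E * \int[m]_x ((w x)%:E * dp n x) + j%:E * \int[m]_x ((w x)%:E * dn n x))
    @[n --> \oo] --> \int[m]_x ((bp x)%:E * e x).
  rewrite -[X in _ --> X]adde0; apply: cvgeD; [exact: fin_num_adde_defl|exact: cvg_cst|].
  by apply: cvge0D; rewrite -(mule0 j%:E); apply: cvgeZl => //; exact: res_cvg.
apply: (cvge_to_ge lim0); apply: nearW => n; exact: step.
Qed.

(** * Maximal solutions for a nonnegative right-hand side *)

Lemma rpot_dominated a (k : nat -> E -> \bar R) k' F x :
  (forall n, nnm (k n)) -> nnm F -> (forall n y, k n y <= F y) ->
  (forall y, F y < +oo) -> (forall y, k n y @[n --> \oo] --> k' y) ->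
  rpot a F x < +oo -> rpot a (k n) x @[n --> \oo] --> rpot a k' x.
Proof.
move=> hk hF kF Ffin kk' Fx; rewrite /rpot.
apply: (dominated_cvg measurableT (g := F)) => //.
- by move=> n; exact: nnm_meas (hk n).
- by move=> y _; rewrite ge0_fin_numE ?(nnm_ge0 y hF).
- apply/integrableP; split; first exact: nnm_meas hF.
  by under eq_integral do rewrite gee0_abs ?(nnm_ge0 _ hF) //.
- by move=> n y _; rewrite gee0_abs // (nnm_ge0 y (hk n)).
Qed.

Section max_solution.
Variables (B : E -> R -> R) (F : E -> R).
Hypotheses (mB : forall y, measurable_fun setT (B ^~ y)).
Hypothesis mF : measurable_fun setT F.
Hypothesis BF : forall x y, (0 <= B x y <= F x)%R.
Hypothesis Ffin : forall x, rpot 0 (fun y => (F y)%:E) x < +oo.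

(** The solution is compared with potentials of differences, a class that contains the subsolutions of
    signed problems shifted so as to have a nonnegative right-hand side. *)
Definition is_max_solution (zeta : E -> R) :=
  [/\ measurable_fun setT zeta, forall x, (0 <= zeta x)%R,
    forall x, (zeta x)%:E = rpot 0 (fun y => (B y (zeta y))%:E) x &
    forall pp pn : E -> R, measurable_fun setT pp -> measurable_fun setT pn ->
      (forall x, (0 <= pp x <= F x)%R) -> (forall x, (0 <= pn x)%R) ->
      (forall x, rpot 0 (fun y => (pn y)%:E) x < +oo) ->
      (forall x, (pp x <= pn x + B x (dpot pp pn 0 x))%R) ->
      forall x, (dpot pp pn 0 x <= zeta x)%R].

Let F0 x : (0 <= F x)%R.
Proof. by have /andP[h1 h2] := BF x 0; exact: le_trans h2. Qed.

Let Z x := fine (rpot 0 (fun y => (F y)%:E) x).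
Let hF : nnm (fun y => (F y)%:E). Proof. exact: nnm_EFin. Qed.
Let ZE x : rpot 0 (fun y => (F y)%:E) x = (Z x)%:E.
Proof.
rewrite fineK // ge0_fin_numE //; exact: (nnm_ge0 x (nnm_rpot (lexx 0%R) hF)).
Qed.
Let mZ : measurable_fun setT Z.
Proof. by apply: measurableT_comp => //; exact: nnm_meas (nnm_rpot (lexx 0%R) hF). Qed.
Let Z0 x : (0 <= Z x)%R.
Proof. by apply: fine_ge0; exact: (nnm_ge0 x (nnm_rpot (lexx 0%R) hF)). Qed.

(** The equation is equivalent to [zeta = U_L (B(., zeta) + L zeta)], whose right-hand side is
    nondecreasing in [zeta]. Iterating it from the largest candidate [Z = U_0 F] gives a decreasing
    sequence that stays above every subsolution. [subinvariant_eq0] brings the equation back from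
    index [L] to index 0. *)
Lemma lipschitz_max_solution (L : R) : (0 < L)%R ->
  (forall x y z, (`|B x y - B x z| <= L * `|y - z|)%R) ->
  exists zeta, is_max_solution zeta.
Proof.
move=> L0 lipB; have L0' := ltW L0.
have cB x : continuous (B x).
  move=> y; apply/cvgrPdist_le => /= e e0.
  near=> z; apply: (le_trans (lipB _ _ _)).
  rewrite -ler_pdivlMl // mulrC; near: z.
  apply: (@cvgr_dist_le _ _ _ _ _ id) => //; exact: divr_gt0.
have msup (v : E -> R) : measurable_fun setT v -> measurable_fun setT (fun x => B x (v x)).
  by move=> mv; exact: caratheodory_measurable.
pose rhs (z : E -> R) x := (B x (z x) + L * z x)%R.
have monoB x y z : (y <= z)%R -> (B x y + L * y <= B x z + L * z)%R.
  move=> yz; have := lipB x y z; rewrite [X in (_ <= L * X)%R]distrC.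
  rewrite [X in (_ <= L * X)%R]ger0_norm ?subr_ge0 // => h.
  have := ler_norm (B x y - B x z)%R; lra.
have mrhs (z : E -> R) : measurable_fun setT z -> measurable_fun setT (rhs z).
  by move=> mz; apply: measurable_funD; [exact: msup|exact: measurable_funM].
have hrhs (z : E -> R) : measurable_fun setT z -> (forall x, (0 <= z x)%R) ->
    nnm (fun x => (rhs z x)%:E).
  move=> mz z0; apply: nnm_EFin; first exact: mrhs.
  by move=> x; rewrite addr_ge0 ?mulr_ge0 //; have /andP[] := BF x (z x).
have hFZ : nnm (fun x => (F x)%:E + L%:E * (Z x)%:E).
  by apply: nnmD => //; apply: nnmZ => //; exact: nnm_EFin.
have UFZ x : rpot L (fun x => (F x)%:E + L%:E * (Z x)%:E) x = (Z x)%:E.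
  rewrite rpotD //; last by apply: nnmZ => //; exact: nnm_EFin.
  rewrite rpotZ //; last exact: nnm_EFin.
  rewrite -{1}(eq_rpot _ _ ZE) -[RHS]ZE [RHS](res_eq HV x (lexx 0%R) L0 hF) subr0 //.
pose Phi (z : E -> R) x := fine (rpot L (fun y => (rhs z y)%:E) x).
pose good (z : E -> R) := measurable_fun setT z /\ forall x, (0 <= z x <= Z x)%R.
have rhs_le z y : good z -> (rhs z y)%:E <= (F y)%:E + L%:E * (Z y)%:E.
  move=> [mz z0]; rewrite -EFinM -EFinD lee_fin lerD //.
    by have /andP[] := BF y (z y).
  by apply: ler_wpM2l => //; have /andP[] := z0 y.
have hrhsg z : good z -> nnm (fun x => (rhs z x)%:E).
  by move=> [mz z0]; apply: hrhs => // x; have /andP[] := z0 x.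
have PhiE z x : good z -> rpot L (fun y => (rhs z y)%:E) x = (Phi z x)%:E /\
    (0 <= Phi z x <= Z x)%R.
  move=> gz; have fin1 : rpot L (fun y => (F y)%:E + L%:E * (Z y)%:E) x < +oo by rewrite UFZ ltry.
  have [r r0 E1] := rpot_lty_le (hrhsg _ gz) hFZ (fun y => rhs_le z y gz) fin1.
  rewrite /Phi E1 /= r0 /= -lee_fin -E1 -UFZ.
  by split=> //; apply: le_rpot => //; [exact: hrhsg|move=> y; exact: rhs_le].
have goodPhi z : good z -> good (Phi z).
  move=> gz; split=> [|x]; last by have [] := PhiE z x gz.
  apply: measurableT_comp => //; apply: nnm_meas; apply: nnm_rpot => //; exact: hrhsg.
pose zs n := iter n Phi Z.
have gzs n : good (zs n).
  elim: n => [|n ih]; last exact: goodPhi.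
  by split => // x; rewrite Z0 lexx.
have Phi_mono z z' x : good z -> good z' -> (forall y, (z y <= z' y)%R) ->
    (Phi z x <= Phi z' x)%R.
  move=> gz gz' le1; rewrite -lee_fin -(PhiE z x gz).1 -(PhiE z' x gz').1.
  apply: le_rpot; [exact: hrhsg|exact: hrhsg|].
  by move=> y; rewrite lee_fin; exact: monoB.
have zs_decr n x : (zs n.+1 x <= zs n x)%R.
  elim: n x => [|n ih] x; last exact: (Phi_mono _ _ x (gzs n.+1) (gzs n) ih).
  by have [_ /andP[]] := PhiE _ x (gzs 0%N).
have zs_cvg x : zs n x @[n --> \oo] --> limn (fun n => zs n x).
  apply: nonincreasing_is_cvgn; first by apply/nonincreasing_seqP => n; exact: zs_decr.
  by exists 0%R => _ [n _ <-]; have [_ /(_ x) /andP[]] := gzs n.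
pose zeta x := limn (fun n => zs n x).
have gzeta : good zeta.
  split; first by apply: (@measurable_fun_cvg _ _ _ _ zs) => [n|x _]; [exact: (gzs n).1|exact: zs_cvg].
  move=> x; apply/andP; split.
    apply: limr_ge; first exact: zs_cvg.
    by apply: nearW => n; have [_ /(_ x) /andP[]] := gzs n.
  apply: limr_le; first exact: zs_cvg.
  by apply: nearW => n; have [_ /(_ x) /andP[]] := gzs n.
have zetaPhi x : zeta x = Phi zeta x.
  have c1 : (zs n.+1 x)%:E @[n --> \oo] --> rpot L (fun y => (rhs zeta y)%:E) x.
    have -> : (fun n => (zs n.+1 x)%:E) = (fun n => rpot L (fun y => (rhs (zs n) y)%:E) x).
      by apply/funext => n; rewrite (PhiE _ x (gzs n)).1.
    apply: (@rpot_dominated L _ _ (fun x => (F x)%:E + L%:E * (Z x)%:E)) => //.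
    - by move=> n; exact: hrhsg.
    - by move=> n y; exact: rhs_le.
    - by move=> y; rewrite -EFinM -EFinD ltry.
    - move=> y; apply/fine_cvgP; split; first exact: nearW.
      apply: cvgD; first by apply: continuous_cvg; [exact: cB|exact: zs_cvg].
      by apply: cvgMr; exact: zs_cvg.
    - by rewrite UFZ ltry.
  have c2 : (zs n.+1 x)%:E @[n --> \oo] --> (zeta x)%:E.
    apply/fine_cvgP; split; first exact: nearW.
    by have := zs_cvg x; rewrite -(@cvg_shiftS _ (fun n => zs n x)).
  have : (zeta x)%:E = rpot L (fun y => (rhs zeta y)%:E) x.
    by rewrite -(cvg_lim _ c1) // -(cvg_lim _ c2).
  by rewrite (PhiE _ x gzeta).1 => -[].
have zeta0 x : (0 <= zeta x)%R by have [_ /(_ x) /andP[]] := gzeta.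
have zetaZ x : (zeta x <= Z x)%R by have [_ /(_ x) /andP[]] := gzeta.
have [mzeta _] := gzeta.
pose k x := B x (zeta x).
have hk : nnm (fun y => (k y)%:E).
  by apply: nnm_EFin; [exact: msup|move=> x; have /andP[] := BF x (zeta x)].
have k_le y : (k y)%:E <= (F y)%:E.
  by rewrite lee_fin; have /andP[] := BF y (zeta y).
pose y0 x := fine (rpot 0 (fun y => (k y)%:E) x).
have y0E x : rpot 0 (fun y => (k y)%:E) x = (y0 x)%:E /\ (0 <= y0 x <= Z x)%R.
  have [r r0 E1] := rpot_lty_le hk hF k_le (Ffin x).
  rewrite /y0 E1 /= r0 /= -lee_fin -E1 -ZE; split=> //.
  by apply: le_rpot.
have my0 : measurable_fun setT y0.
  by apply: measurableT_comp => //; exact: nnm_meas (nnm_rpot (lexx 0%R) hk).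
have hy0 : nnm (fun x => (y0 x)%:E) by apply: nnm_EFin => // x; have [_ /andP[]] := y0E x.
have hzeta : nnm (fun x => (zeta x)%:E) by apply: nnm_EFin.
pose D x := `|zeta x - y0 x|%:E.
have hD : nnm D by apply: nnm_abs; exact: measurable_funB.
have zeta_eq x : (zeta x)%:E = rpot L (fun y => (k y)%:E) x + L%:E * rpot L (fun y => (zeta y)%:E) x.
  rewrite -rpotZ // -rpotD //; last exact: nnmZ.
  by rewrite zetaPhi -(PhiE _ x gzeta).1; apply: eq_rpot => y; rewrite /rhs EFinD EFinM.
have y0_eq x : (y0 x)%:E = rpot L (fun y => (k y)%:E) x + L%:E * rpot L (fun y => (y0 y)%:E) x.
  rewrite -(y0E x).1 (res_eq HV x (lexx 0%R) L0 hk) subr0; congr (_ + _ * _).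
  by apply: eq_rpot => y; exact: (y0E y).1.
have D0 x : D x = 0.
  apply: (subinvariant_eq0 L0 hD hF) => //.
  - move=> y; rewrite ZE lee_fin; have [_ /andP[i1 i2]] := y0E y.
    by rewrite ler_norml; apply/andP; split; have := zeta0 y; have := zetaZ y; lra.
  - move=> y _.
    have fin1 (v : E -> R) : nnm (fun x => (v x)%:E) -> (forall x, (v x <= Z x)%R) ->
        exists2 r, (0 <= r)%R & rpot L (fun x => (v x)%:E) y = r%:E.
      move=> hv vZ; apply: (@rpot_lty_le _ _ (rpot 0 (fun y => (F y)%:E))) => //.
      + exact: nnm_rpot.
      + by move=> z; rewrite ZE lee_fin.
      + exact: rpot_rpot0_lty.
    have [r1 r10 E1] := fin1 _ hzeta zetaZ.
    have [r2 r20 E2] : exists2 r, (0 <= r)%R & rpot L (fun x => (y0 x)%:E) y = r%:E.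
      by apply: fin1 => // z; have [_ /andP[]] := y0E z.
    have [r3 r30 E3] : exists2 r, (0 <= r)%R & rpot L D y = r%:E.
      apply: fin1 => // z; have [_ /andP[i1 i2]] := y0E z.
      by rewrite ler_norml; apply/andP; split; have := zeta0 z; have := zetaZ z; lra.
    have l1 : rpot L (fun y => (zeta y)%:E) y <= rpot L (fun y => (y0 y)%:E) y + rpot L D y.
      rewrite -rpotD //; apply: le_rpot => //; first exact: nnmD.
      by move=> z; rewrite -EFinD lee_fin; have := ler_norm (zeta z - y0 z)%R; lra.
    have l2 : rpot L (fun y => (y0 y)%:E) y <= rpot L (fun y => (zeta y)%:E) y + rpot L D y.
      rewrite -rpotD //; apply: le_rpot => //; first exact: nnmD.
      move=> z; rewrite -EFinD lee_fin; have := ler_norm (y0 z - zeta z)%R.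
      by rewrite distrC; lra.
    have := zeta_eq y; have := y0_eq y; move: l1 l2; rewrite E1 E2 E3 /D.
    case: (rpot L (fun y => (k y)%:E) y) => [u| |] //.
    rewrite -?EFinM -?EFinD !lee_fin => l1 l2 [-> ] [->].
    by rewrite ler_norml; apply/andP; split; nra.
have zeta_y0 x : zeta x = y0 x.
  by have := D0 x => -[] /eqP; rewrite normr_eq0 subr_eq0 => /eqP.
exists zeta; split => //.
- by move=> x; rewrite zeta_y0 -(y0E x).1.
- move=> pp pn mpp mpn ppF pn0 pnfin ppB.
have hpp : nnm (fun y => (pp y)%:E) by apply: nnm_EFin => // x; have /andP[] := ppF x.
have hpn : nnm (fun y => (pn y)%:E) by exact: nnm_EFin.
pose y1 := dpot pp pn 0.
pose a x := fine (rpot 0 (fun y => (pp y)%:E) x).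
pose b x := fine (rpot 0 (fun y => (pn y)%:E) x).
have pp_le y : (pp y)%:E <= (F y)%:E by rewrite lee_fin; have /andP[] := ppF y.
have aE x : rpot 0 (fun y => (pp y)%:E) x = (a x)%:E.
  by rewrite /a; have [r r0 ->] := rpot_lty_le hpp hF pp_le (Ffin x).
have bE x : rpot 0 (fun y => (pn y)%:E) x = (b x)%:E.
  by rewrite /b; have [r r0 ->] := rpot_lty_le hpn hpn (fun y => lexx _) (pnfin x).
have y1E x : y1 x = (a x - b x)%R by [].
have shift h x : nnm h ->
    rpot 0 h x = rpot L (fun y => h y + L%:E * rpot 0 h y) x.
  move=> hh; rewrite rpotD //; last by apply: nnmZ => //; exact: nnm_rpot.
  by rewrite rpotZ //; [rewrite -{2}(subr0 L) -(res_eq HV)|exact: nnm_rpot].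
suff key n x : (y1 x <= zs n x)%R.
  move=> x; apply: limr_ge; first exact: zs_cvg.
  by apply: nearW => n; exact: key.
elim: n x => [|n ih] x.
  rewrite y1E /=; apply: (@le_trans _ _ (a x)).
    by rewrite gerBl -lee_fin -bE; exact: (nnm_ge0 x (nnm_rpot (lexx 0%R) hpn)).
  by rewrite -lee_fin -aE -ZE; exact: le_rpot.
rewrite y1E lerBlDl -lee_fin EFinD -(PhiE _ x (gzs n)).1 -aE -bE shift // [in leRHS]shift //.
rewrite -rpotD; [|by apply: nnmD => //; apply: nnmZ => //; exact: nnm_rpot|exact: hrhsg].
apply: le_rpot.
- by apply: nnmD => //; apply: nnmZ => //; exact: nnm_rpot.
- by apply: nnmD; [apply: nnmD => //; apply: nnmZ => //; exact: nnm_rpot|exact: hrhsg].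
- move=> y; rewrite aE bE -!EFinM -!EFinD lee_fin /rhs.
  have := ppB y; have := monoB y _ _ (ih y); rewrite -/(y1 y) y1E; lra.
Unshelve. all: by end_near. Qed.

End max_solution.

(** The maximal solutions for the Lipschitz majorants decrease to a solution, and they stay above the
    subsolutions for [B] because the majorants lie above [B]. *)
Lemma continuous_max_solution (B : E -> R -> R) (F : E -> R) :
  (forall y, measurable_fun setT (B ^~ y)) -> measurable_fun setT F ->
  (forall x, continuous (B x)) -> (forall x y, (0 <= B x y <= F x)%R) ->
  (forall x, rpot 0 (fun y => (F y)%:E) x < +oo) ->
  exists zeta, is_max_solution B F zeta.
Proof.
move=> mB mF cB BF Ffin.
have F0 x : (0 <= F x)%R by have /andP[h1 h2] := BF x 0%R; exact: le_trans h2.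
have hF : nnm (fun y => (F y)%:E) by exact: nnm_EFin.
pose Bn n x y := supconv (B x) n y.
have mBn n y : measurable_fun setT ((Bn n) ^~ y) by exact: measurable_supconv.
have BnF n x y : (0 <= Bn n x y <= F x)%R.
  apply/andP; split; first by apply: (@supconv_ge0 _ _ (F x)).
  exact: (@supconv_le_bound _ _ (F x)).
have exn n : exists zeta, is_max_solution (Bn n) F zeta.
  apply: (@lipschitz_max_solution _ _ (mBn n) mF (BnF n) Ffin n.+1%:R) => // x y z.
  exact: (@supconv_lipschitz _ _ (F x)).
have [zs zsP] := choice exn.
have mzs n : measurable_fun setT (zs n) by have [] := zsP n.
have zs0 n x : (0 <= zs n x)%R by have [] := zsP n.
have zsE n x : (zs n x)%:E = rpot 0 (fun y => (Bn n y (zs n y))%:E) x by have [] := zsP n.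
have cBn n x : continuous (Bn n x).
  move=> y; apply/cvgrPdist_le => /= e e0.
  near=> z; apply: (le_trans (supconv_lipschitz (BF x) _ _ _)).
  rewrite -ler_pdivlMl // mulrC; near: z.
  by apply: (@cvgr_dist_le _ _ _ _ _ id) => //; exact: divr_gt0.
have msup n : measurable_fun setT (fun x => Bn n x (zs n x)).
  exact: caratheodory_measurable.
have hk n : nnm (fun x => (Bn n x (zs n x))%:E).
  by apply: nnm_EFin => // x; have /andP[] := BnF n x (zs n x).
have pot0 : forall x, rpot 0 (fun _ : E => 0%R%:E) x = 0 by move=> x; rewrite /rpot integral0.
have zs_decr n x : (zs n.+1 x <= zs n x)%R.
  have [_ _ _ mx] := zsP n.
  have E1 y : dpot (fun x => Bn n.+1 x (zs n.+1 x)) (fun=> 0%R) 0 y = zs n.+1 y.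
    by rewrite /dpot -zsE pot0 subr0.
  rewrite -E1; apply: mx => //.
  - by move=> y; rewrite pot0 ltry.
  - by move=> y; rewrite E1 add0r; apply: (supconv_decr (BF y)).
have zs_cvg x : zs n x @[n --> \oo] --> limn (fun n => zs n x).
  apply: nonincreasing_is_cvgn; first by apply/nonincreasing_seqP => n; exact: zs_decr.
  by exists 0%R => _ [n _ <-].
pose zeta x := limn (fun n => zs n x).
exists zeta; split.
- by apply: (@measurable_fun_cvg _ _ _ _ zs) => // x _; exact: zs_cvg.
- by move=> x; apply: limr_ge; [exact: zs_cvg|exact: nearW].
- move=> x; have c1 : rpot 0 (fun y => (Bn n y (zs n y))%:E) x @[n --> \oo] -->
      rpot 0 (fun y => (B y (zeta y))%:E) x.
    apply: (@rpot_dominated 0%R _ _ (fun x => (F x)%:E)) => //.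
    + by move=> n y; rewrite lee_fin; have /andP[] := BnF n y (zs n y).
    + by move=> y; rewrite ltry.
    + move=> y; apply/fine_cvgP; split; first exact: nearW.
      exact: (supconv_cvg (BF y) (cB y) (zs_cvg y)).
  have c2 : rpot 0 (fun y => (Bn n y (zs n y))%:E) x @[n --> \oo] --> (zeta x)%:E.
    under eq_cvg do rewrite -zsE.
    by apply/fine_cvgP; split; [exact: nearW|exact: zs_cvg].
  by rewrite -(cvg_lim _ c1) // -(cvg_lim _ c2).
- move=> pp pn mpp mpn ppF pn0 pnfin ppB x.
  apply: limr_ge; first exact: zs_cvg.
  apply: nearW => n; have [_ _ _ mx] := zsP n; apply: mx => // y.
  by apply: (le_trans (ppB y)); rewrite lerD2l; apply: (supconv_ge (BF y)).
Unshelve. all: by end_near. Qed.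

(** * Almost everywhere inequalities and signed potentials *)

(** By symmetry the integral against [vr] of the potential of a null function is 0. *)
Lemma ae_le_rpot h k : nnm h -> nnm k -> {ae m, forall x, h x <= k x} ->
  {ae m, forall x, rpot 0 h x <= rpot 0 k x}.
Proof.
move=> hh hk hle.
pose D x := if h x <= k x then 0 else h x.
have hD : nnm D.
  split; last by move=> x; rewrite /D; case: ifP => // _; exact: nnm_ge0 hh.
  apply: measurable_fun_ifT => //; last exact: nnm_meas hh.
  by apply: measurable_fun_lee; [exact: nnm_meas hh|exact: nnm_meas hk].
have D0 : \int[m]_x ((vr x)%:E * rpot 0 D x) <= 0.
  rewrite int_vr_rpot0 // -[leRHS](@integral0 _ _ _ m setT).
  apply: nnm_ae_le_integral; [apply: nnmM => //; exact: nnm_w|by split|].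
  by apply: filterS hle => x hx; rewrite /D hx mule0.
have := ae_eq0_of_integral mvr vr0 (nnm_rpot (lexx 0%R) hD) D0.
apply: filterS => x Dx; rewrite -[leRHS]adde0 -Dx -rpotD //.
apply: le_rpot => //; first exact: nnmD.
by move=> y; rewrite /D; case: ifPn => hy; rewrite ?adde0 // leeDr // nnm_ge0.
Qed.

Lemma le_limn_einf (u v : nat -> \bar R) : (forall n, u n <= v n) ->
  limn_einf u <= limn_einf v.
Proof.
move=> uv; rewrite !limn_einf_lim; apply: lee_lim; [exact: is_cvg_einfs|exact: is_cvg_einfs|].
apply: nearW => n; apply: le_ereal_inf_tmp => _ [k kn <-] /=.
by apply: ge_ereal_inf; exists (u k) => //; exists k.
Qed.

Lemma limn_einf_ge0 (u : nat -> \bar R) : (forall n, 0 <= u n) -> 0 <= limn_einf u.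
Proof.
move=> u0; have <- : limn_einf (fun=> 0 : \bar R) = 0.
  rewrite is_cvg_limn_einfE; last exact: is_cvg_cst.
  by apply: cvg_lim => //; exact: cvg_cst.
exact: le_limn_einf.
Qed.

Lemma fatou_le (f : nat -> E -> \bar R) f' (c : nat -> \bar R) c' :
  (forall n, nnm (f n)) -> nnm f' ->
  {ae m, forall x, f n x @[n --> \oo] --> f' x} ->
  (forall n, \int[m]_x f n x <= c n) -> c n @[n --> \oo] --> c' ->
  \int[m]_x f' x <= c'.
Proof.
move=> hf hf' ff' fc cc'.
have ml : measurable_fun setT (fun x => limn_einf (f ^~ x)).
  apply: measurableT_comp => //; apply: measurable_fun_limn_esup => n.
  by apply: measurableT_comp => //; exact: nnm_meas (hf n).
have -> : \int[m]_x f' x = \int[m]_x limn_einf (f ^~ x).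
  apply: ge0_ae_eq_integral => //.
  - exact: nnm_meas hf'.
  - by move=> x _; exact: nnm_ge0 hf'.
  - by move=> x _; apply: limn_einf_ge0 => n; exact: nnm_ge0 (hf n).
  - apply: filterS ff' => x fx _; apply/esym.
    rewrite is_cvg_limn_einfE; last by apply/cvg_ex; exists (f' x).
    exact: cvg_lim.
apply: (@le_trans _ _ (limn_einf (fun n => \int[m]_x f n x))).
  by apply: fatou => // n; [exact: nnm_meas (hf n)|move=> x _; exact: nnm_ge0 (hf n)].
rewrite -(cvg_lim _ cc') // -is_cvg_limn_einfE; last by apply/cvg_ex; exists c'.
by apply: le_limn_einf => n.
Qed.

Lemma aeI (P Q : E -> Prop) : {ae m, forall x, P x} -> {ae m, forall x, Q x} ->
  {ae m, forall x, P x /\ Q x}.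
Proof. exact: filterI. Qed.

Lemma cvge0_near_lt (f : nat -> \bar R) (e : R) : f n @[n --> \oo] --> 0 -> (0 < e)%R ->
  \forall n \near \oo, f n < e%:E.
Proof.
move=> /fine_cvgP[fe /cvgrPdist_lt f0] e0; have := f0 _ e0; apply: filterS2 fe => n fn.
rewrite sub0r normrN => h; rewrite -(fineK fn) lte_fin; apply: le_lt_trans h.
exact: ler_norm.
Qed.

Lemma ae_dominated_cvg (f : nat -> E -> \bar R) f' b :
  (forall n, nnm (f n)) -> nnm f' -> nnm b -> \int[m]_x b x < +oo ->
  {ae m, forall x, f n x @[n --> \oo] --> f' x} ->
  {ae m, forall x n, f n x <= b x} ->
  \int[m]_x f n x @[n --> \oo] --> \int[m]_x f' x.
Proof.
move=> hf hf' hb ib ff' fb.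
have ib' : m.-integrable setT b.
  apply/integrableP; split; first exact: nnm_meas hb.
  by under eq_integral do rewrite gee0_abs ?(nnm_ge0 _ hb) //.
have [] := @dominated_convergence _ _ _ m setT measurableT f f' b _ _ _ ib' _ => //.
- by move=> n; exact: nnm_meas (hf n).
- exact: nnm_meas hf'.
- by apply: filterS ff' => x fx _.
- by apply: filterS fb => x fx n _; rewrite gee0_abs ?(nnm_ge0 _ (hf n)).
Qed.

Lemma supermedian_rpot0 h : nnm h -> supermedian (rpot 0 h).
Proof.
by move=> hh; split=> [|a x a0]; [exact: nnm_rpot|exact: le_rpot0].
Qed.

Lemma supermedian_w : supermedian (fun x => (w x)%:E).
Proof.
have -> : (fun x => (w x)%:E) = rpot 0 (fun y => (vr y)%:E).
  by apply/funext => x; rewrite wE.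
by apply: supermedian_rpot0; exact: nnm_vr.
Qed.

Lemma supermedianD e e' : supermedian e -> supermedian e' ->
  supermedian (fun x => e x + e' x).
Proof.
move=> [he se] [he' se']; split=> [|a x a0]; first exact: nnmD.
rewrite rpotD // ge0_muleDr; [|apply: rpot_ge0 => y; exact: nnm_ge0..].
  by apply: leeD; [exact: se|exact: se'].
all: exact: nnm_ge0.
Qed.

Lemma supermedianZ (c : R) e : (0 <= c)%R -> supermedian e ->
  supermedian (fun x => c%:E * e x).
Proof.
move=> c0 [he se]; split=> [|a x a0]; first exact: nnmZ.
by rewrite rpotZ // muleCA; apply: lee_wpmul2l => //; exact: se.
Qed.

Lemma supermedian_min e e' : supermedian e -> supermedian e' ->
  supermedian (fun x => mine (e x) (e' x)).
Proof.
move=> [he se] [he' se']; split=> [|a x a0]; first exact: nnm_min.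
have a0' := ltW a0.
rewrite le_min; apply/andP; split.
  apply: (le_trans _ (se a x a0)); apply: lee_wpmul2l => //.
  by apply: le_rpot => //; [exact: nnm_min|move=> y; rewrite ge_min lexx].
apply: (le_trans _ (se' a x a0)); apply: lee_wpmul2l => //.
by apply: le_rpot => //; [exact: nnm_min|move=> y; rewrite ge_min lexx orbT].
Qed.

(** The value is meaningful where the potential of [|k|] is finite, which is at almost every point in
    all uses. *)
Definition pot (k : E -> R) : E -> R :=
  dpot (fun x => Num.max (k x) 0%R) (fun x => Num.max (- k x) 0)%R 0.

Section posneg.
Variable k : E -> R.
Hypothesis mk : measurable_fun setT k.

Lemma nnm_pos : nnm (fun x => (Num.max (k x) 0%R)%:E).
Proof.
apply: nnm_EFin; last by move=> x; rewrite le_max lexx orbT.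
exact: measurable_maxr.
Qed.

Lemma nnm_neg : nnm (fun x => (Num.max (- k x) 0)%R%:E).
Proof.
apply: nnm_EFin; last by move=> x; rewrite le_max lexx orbT.
by apply: measurable_maxr => //; exact: measurableT_comp.
Qed.

Lemma pos_le_norm (r : R) : (Num.max r 0 <= `|r|)%R.
Proof. by rewrite ge_max normr_ge0 ler_norm. Qed.

Lemma neg_le_norm (r : R) : (Num.max (- r) 0 <= `|r|)%R.
Proof. by rewrite -normrN pos_le_norm. Qed.

Lemma norm_posneg (r : R) : `|r|%R = (Num.max r 0 + Num.max (- r) 0)%R.
Proof.
case: (leP 0%R r) => r0; first by rewrite max_r ?addr0 ?oppr_le0 // ger0_norm.
by rewrite add0r max_l ?oppr_ge0 ?ltW // ltr0_norm.
Qed.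

Lemma sub_posneg (r : R) : r = (Num.max r 0 - Num.max (- r) 0)%R.
Proof.
case: (leP 0%R r) => r0; first by rewrite max_r ?subr0 ?oppr_le0.
by rewrite max_l ?oppr_ge0 ?ltW // sub0r opprK.
Qed.

Lemma rpot_pos_fin x : rpot 0 (fun y => `|k y|%:E) x < +oo ->
  exists2 r, (0 <= r)%R & rpot 0 (fun y => (Num.max (k y) 0%R)%:E) x = r%:E.
Proof.
apply: rpot_lty_le; [exact: nnm_pos|exact: nnm_abs|].
by move=> y; rewrite lee_fin pos_le_norm.
Qed.

Lemma rpot_neg_fin x : rpot 0 (fun y => `|k y|%:E) x < +oo ->
  exists2 r, (0 <= r)%R & rpot 0 (fun y => (Num.max (- k y) 0)%R%:E) x = r%:E.
Proof.
apply: rpot_lty_le; [exact: nnm_neg|exact: nnm_abs|].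
by move=> y; rewrite lee_fin neg_le_norm.
Qed.

Lemma pot_le x : rpot 0 (fun y => `|k y|%:E) x < +oo ->
  `|pot k x|%:E <= rpot 0 (fun y => `|k y|%:E) x.
Proof.
move=> kx; have [r r0 Er] := rpot_pos_fin kx; have [s s0 Es] := rpot_neg_fin kx.
have -> : rpot 0 (fun y => `|k y|%:E) x = (r + s)%:E.
  rewrite EFinD -Er -Es -rpotD; [|exact: nnm_pos|exact: nnm_neg].
  by apply: eq_rpot => y; rewrite -EFinD -norm_posneg.
rewrite /pot /dpot Er Es lee_fin /= (le_trans (ler_normB _ _)) //.
by rewrite !ger0_norm.
Qed.

Lemma measurable_pot : measurable_fun setT (pot k).
Proof.
apply: measurable_funB; apply: measurableT_comp => //; apply: (res_meas HV) => //.
  exact: nnm_pos.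
exact: nnm_neg.
Qed.

End posneg.

Lemma pot_dist (k k' : E -> R) x : measurable_fun setT k -> measurable_fun setT k' ->
  rpot 0 (fun y => `|k y|%:E) x < +oo -> rpot 0 (fun y => `|k' y|%:E) x < +oo ->
  `|pot k x - pot k' x|%:E <= rpot 0 (fun y => `|k y - k' y|%:E) x.
Proof.
move=> mk mk' kx k'x; have mkk' : measurable_fun setT (fun y => k y - k' y)%R.
  exact: measurable_funB.
have hkk' : nnm (fun y => `|k y - k' y|%:E) by exact: nnm_abs.
have [|] := ltP (rpot 0 (fun y => `|k y - k' y|%:E) x) +oo; last first.
  by rewrite leye_eq => /eqP ->; rewrite leey.
move=> fin1; have [t t0 Et] := rpot_lty_le hkk' hkk' (fun y => lexx _) fin1.
have [r r0 Er] := rpot_pos_fin mk kx; have [s s0 Es] := rpot_neg_fin mk kx.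
have [r' r'0 Er'] := rpot_pos_fin mk' k'x; have [s' s'0 Es'] := rpot_neg_fin mk' k'x.
have := @le_rpot 0%R (fun y => (Num.max (k y) 0%R)%:E + (Num.max (- k' y) 0)%R%:E)
  (fun y => (Num.max (- k y) 0)%R%:E + (Num.max (k' y) 0%R)%:E + `|k y - k' y|%:E) x.
have := @le_rpot 0%R (fun y => (Num.max (- k y) 0)%R%:E + (Num.max (k' y) 0%R)%:E)
  (fun y => (Num.max (k y) 0%R)%:E + (Num.max (- k' y) 0)%R%:E + `|k y - k' y|%:E) x.
have h1 := nnm_pos mk; have h2 := nnm_neg mk; have h3 := nnm_pos mk'; have h4 := nnm_neg mk'.
have h13 := nnmD h1 h4; have h24 := nnmD h2 h3.
rewrite !rpotD // Er Es Er' Es' Et -!EFinD !lee_fin => i1 i2.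
have {}i1 : (s + r' <= r + s' + t)%R.
  apply: i1 => //; first exact: nnmD.
  move=> y; rewrite -!EFinD lee_fin.
  have := sub_posneg (k y); have := sub_posneg (k' y).
  by have := ler_norm (k' y - k y)%R; rewrite distrC; lra.
have {}i2 : (r + s' <= s + r' + t)%R.
  apply: i2 => //; first exact: nnmD.
  move=> y; rewrite -!EFinD lee_fin.
  have := sub_posneg (k y); have := sub_posneg (k' y).
  by have := ler_norm (k y - k' y)%R; lra.
rewrite /pot /dpot Er Es Er' Es' /= ler_norml; apply/andP; split; lra.
Qed.

(** * A priori estimates for the semilinear equation *)

Section semilinear.
Variables (C : R) (rho : E -> R) (g : E -> R -> R).
Hypothesis wC : forall x, (w x <= C)%R.
Hypothesis ivr : \int[m]_x (vr x)%:E < +oo.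
Hypothesis w_gt0 : forall x, (0 < w x)%R.
Hypothesis suprho : supermedian (fun x => (rho x)%:E).
Hypothesis wrho : {ae m, forall x, (w x <= rho x)%R}.
Hypothesis mg : forall y, measurable_fun setT (g ^~ y).
Hypothesis cg : forall x, continuous (g x).
Hypothesis sg : forall x y, (g x y * y <= 0)%R.

Variables (h0 : E -> R) (W0 : E -> \bar R).
Hypothesis mh0 : measurable_fun setT h0.
Hypothesis supW0 : supermedian W0.
Hypothesis W0fin : {ae m, forall x, W0 x < +oo}.
Hypothesis h0W0 : {ae m, forall x, `|h0 x|%:E <= W0 x}.

Variables (u k0 H : E -> R).
Hypothesis mk0 : measurable_fun setT k0.
Hypothesis ik0 : \int[m]_x ((rho x)%:E * `|k0 x|%:E) < +oo.
Hypothesis uE : {ae m, forall x, u x = (h0 x + pot k0 x)%R}.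
Hypothesis mH : measurable_fun setT H.
Hypothesis H0 : forall x, (0 <= H x)%R.
Hypothesis iH : \int[m]_x ((rho x)%:E * (H x)%:E) < +oo.
Hypothesis gH : {ae m, forall x y,
  ((0 <= y <= u x)%R || (u x <= y <= 0)%R) -> (`|g x y| <= H x)%R}.
Hypothesis gball : forall M : R, exists b : E -> R,
  [/\ measurable_fun setT b, forall x, (0 <= b x)%R,
      \int[m]_x ((rho x)%:E * (b x)%:E) < +oo &
      {ae m, forall x y, (`|y| <= M -> `|g x y| <= b x)%R}].

Let F x : R := (`|k0 x| + H x)%R.
Let mF : measurable_fun setT F.
Proof. by apply: measurable_funD => //; exact: measurableT_comp. Qed.
Let F0 x : (0 <= F x)%R. Proof. by rewrite addr_ge0. Qed.
Let hF : nnm (fun x => (F x)%:E). Proof. exact: nnm_EFin. Qed.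
Let hk0 : nnm (fun x => `|k0 x|%:E). Proof. exact: nnm_abs. Qed.
Let hH : nnm (fun x => (H x)%:E). Proof. exact: nnm_EFin. Qed.
Let hrho : nnm (fun x => (rho x)%:E). Proof. exact: suprho.1. Qed.
Let hw' := nnm_w.
Let hvr' := nnm_vr.

Let irhoF : \int[m]_x ((rho x)%:E * (F x)%:E) < +oo.
Proof.
have -> : \int[m]_x ((rho x)%:E * (F x)%:E) =
    \int[m]_x ((rho x)%:E * `|k0 x|%:E + (rho x)%:E * (H x)%:E).
  by apply: eq_integral => x _; rewrite -ge0_muleDr ?(nnm_ge0 x hk0) ?(nnm_ge0 x hH) // -EFinD.
by rewrite nnm_integralD; [exact: lte_add_pinfty|exact: nnmM..].
Qed.

Let le_w_rho h : nnm h -> \int[m]_x ((rho x)%:E * h x) < +oo ->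
  \int[m]_x ((w x)%:E * h x) < +oo.
Proof.
move=> hh; apply: le_lt_trans; apply: nnm_ae_le_integral; [exact: nnmM|exact: nnmM|].
by apply: filterS wrho => x wx; apply: lee_wpmul2r; [exact: nnm_ge0 hh|rewrite lee_fin].
Qed.

Let iwF : \int[m]_x ((w x)%:E * (F x)%:E) < +oo. Proof. exact: le_w_rho. Qed.
Let iwk0 : \int[m]_x ((w x)%:E * `|k0 x|%:E) < +oo. Proof. exact: le_w_rho. Qed.

(** Solutions of all truncated problems are of this kind and, unlike the solutions of one given
    problem, so are their limits when the truncation varies. *)
Definition admissible (v k : E -> R) :=
  [/\ measurable_fun setT v, measurable_fun setT k,
      \int[m]_x ((w x)%:E * `|k x|%:E) < +oo,
      {ae m, forall x, v x = (h0 x + pot k x)%R} &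
      {ae m, forall x, (k x * v x <= 0)%R /\ (`|k x| <= `|g x (v x)|)%R}].

Section half.
Variables (ap an : E -> R).
Hypotheses (map : measurable_fun setT ap) (man : measurable_fun setT an).
Hypotheses (ap0 : forall x, (0 <= ap x)%R) (an0 : forall x, (0 <= an x)%R).
Hypotheses (ip : \int[m]_x ((w x)%:E * (ap x)%:E) < +oo)
  (im : \int[m]_x ((w x)%:E * (an x)%:E) < +oo).
Hypothesis apF : {ae m, forall x, (0 < dpot ap an 0 x -> ap x <= F x)%R}.

Let SP x : R := if (0 < dpot ap an 0 x)%R then ap x else 0%R.
Let SN x : R := if (0 < dpot ap an 0 x)%R then an x else 0%R.
Let mS : measurable_fun setT (fun x => (0 < dpot ap an 0 x)%R).
Proof. by apply: measurable_fun_ltr => //; exact: measurable_dpot. Qed.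
Let mSP : measurable_fun setT SP. Proof. exact: measurable_fun_ifT. Qed.
Let mSN : measurable_fun setT SN. Proof. exact: measurable_fun_ifT. Qed.
Let SP0 x : (0 <= SP x)%R. Proof. by rewrite /SP; case: ifP. Qed.
Let SN0 x : (0 <= SN x)%R. Proof. by rewrite /SN; case: ifP. Qed.
Let hSP : nnm (fun x => (SP x)%:E). Proof. exact: nnm_EFin. Qed.
Let hSN : nnm (fun x => (SN x)%:E). Proof. exact: nnm_EFin. Qed.

Let SPF : {ae m, forall x, (SP x)%:E <= (F x)%:E}.
Proof. by apply: filterS apF => x h; rewrite lee_fin /SP; case: ifP => // /h. Qed.

(** The Kato inequality involves [ap] only on the set where the potential is positive, and there it is
    at most [F]. *)
Lemma half_bound : {ae m, forall x, (dpot ap an 0 x)%:E <= rpot 0 (fun y => (F y)%:E) x}.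
Proof.
have := maximum_principle map man ap0 an0 ip im.
apply: filterS2 (ae_le_rpot hSP hF SPF) => x h1 h2.
apply: le_trans h1; apply: le_trans h2.
apply: (@le_trans _ _ (Num.max (dpot ap an 0 x) 0)%:E); first by rewrite lee_fin le_max lexx.
by rewrite leeDl // rpot_ge0.
Qed.

(** By the Kato inequality the potential of [SN] is below the potential of [SP], so
    [supermedian_test] bounds the integral of [SN e] by that of [SP e]. *)
Lemma half_integral e (j : R) : (0 <= j)%R -> supermedian e ->
  (forall y, e y <= j%:E * (w y)%:E) ->
  \int[m]_x (((SP x)%:E + (SN x)%:E) * e x) <=
  \int[m]_x ((F x)%:E * e x) + \int[m]_x ((F x)%:E * e x).
Proof.
move=> j0 supe ej; have he := supe.1.
have -> : \int[m]_x (((SP x)%:E + (SN x)%:E) * e x) =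
    \int[m]_x ((SP x)%:E * e x + (SN x)%:E * e x).
  by apply: eq_integral => x _; rewrite ge0_muleDl ?lee_fin.
rewrite nnm_integralD; [|exact: nnmM..].
have le1 : \int[m]_x ((SP x)%:E * e x) <= \int[m]_x ((F x)%:E * e x).
  apply: nnm_ae_le_integral; [exact: nnmM|exact: nnmM|].
  by apply: filterS SPF => x; apply: lee_wpmul2r; exact: nnm_ge0 he.
apply: leeD => //; apply: le_trans le1.
have le_if (a : E -> R) : (forall x, (0 <= a x)%R) -> forall x,
    ((if (0 < dpot ap an 0 x)%R then a x else 0%R)%:E <= (a x)%:E :> \bar R).
  by move=> a0 x; case: ifP => _; rewrite lee_fin.
apply: (supermedian_test mSP mSN SP0 SN0 _ _ _ j0 supe ej).
- apply: le_lt_trans ip; apply: nnm_le_integral; [exact: nnmM|apply: nnmM => //; exact: nnm_EFin|].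
  by move=> x; apply: lee_wpmul2l; [rewrite lee_fin w_ge0|exact: le_if].
- apply: le_lt_trans im; apply: nnm_le_integral; [exact: nnmM|apply: nnmM => //; exact: nnm_EFin|].
  by move=> x; apply: lee_wpmul2l; [rewrite lee_fin w_ge0|exact: le_if].
- have := maximum_principle map man ap0 an0 ip im; apply: filterS => x.
  by apply: le_trans; rewrite leeDr // lee_fin le_max lexx orbT.
Qed.

End half.

Section apriori.
Variables v k : E -> R.
Hypothesis vk : admissible v k.

Let mv : measurable_fun setT v. Proof. by case: vk. Qed.
Let mk : measurable_fun setT k. Proof. by case: vk. Qed.
Let iwk : \int[m]_x ((w x)%:E * `|k x|%:E) < +oo. Proof. by case: vk. Qed.
Let hk : nnm (fun x => `|k x|%:E). Proof. exact: nnm_abs. Qed.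

(** With this choice [ap - an = k - k0], whose potential is [v - u]. *)
Let ap x : R := (Num.max (k x) 0 + Num.max (- k0 x) 0)%R.
Let an x : R := (Num.max (- k x) 0 + Num.max (k0 x) 0)%R.

Let max0 (r : R) : (0 <= Num.max r 0)%R. Proof. by rewrite le_max lexx orbT. Qed.

Let map : measurable_fun setT ap.
Proof.
by apply: measurable_funD; apply: measurable_maxr => //; exact: measurableT_comp.
Qed.
Let man : measurable_fun setT an.
Proof.
by apply: measurable_funD; apply: measurable_maxr => //; exact: measurableT_comp.
Qed.
Let ap0 x : (0 <= ap x)%R. Proof. by rewrite addr_ge0. Qed.
Let an0 x : (0 <= an x)%R. Proof. by rewrite addr_ge0. Qed.

Let isum : \int[m]_x ((w x)%:E * (`|k x|%:E + `|k0 x|%:E)) < +oo.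
Proof.
have -> : \int[m]_x ((w x)%:E * (`|k x|%:E + `|k0 x|%:E)) =
    \int[m]_x ((w x)%:E * `|k x|%:E + (w x)%:E * `|k0 x|%:E).
  by apply: eq_integral => x _; rewrite ge0_muleDr.
by rewrite nnm_integralD; [exact: lte_add_pinfty|exact: nnmM..].
Qed.

Let ip : \int[m]_x ((w x)%:E * (ap x)%:E) < +oo.
Proof.
apply: le_lt_trans isum; apply: nnm_le_integral.
- by apply: nnmM => //; exact: nnm_EFin.
- by apply: nnmM => //; exact: nnmD.
- move=> x; apply: lee_wpmul2l; first by rewrite lee_fin w_ge0.
  by rewrite -EFinD lee_fin lerD ?pos_le_norm ?neg_le_norm.
Qed.
Let im : \int[m]_x ((w x)%:E * (an x)%:E) < +oo.
Proof.
apply: le_lt_trans isum; apply: nnm_le_integral.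
- by apply: nnmM => //; exact: nnm_EFin.
- by apply: nnmM => //; exact: nnmD.
- move=> x; apply: lee_wpmul2l; first by rewrite lee_fin w_ge0.
  by rewrite -EFinD lee_fin lerD ?pos_le_norm ?neg_le_norm.
Qed.

Let dE : {ae m, forall x, dpot ap an 0 x = (v x - u x)%R /\
  dpot an ap 0 x = (u x - v x)%R}.
Proof.
have [_ _ _ vE _] := vk.
have kfin := ae_rpot_lty hk iwk; have k0fin := ae_rpot_lty hk0 iwk0.
have := aeI (aeI vE uE) (aeI kfin k0fin).
apply: filterS => x [[-> ->] [kx k0x]].
have [r r0 Er] := rpot_pos_fin mk kx; have [s s0 Es] := rpot_neg_fin mk kx.
have [r' r'0 Er'] := rpot_pos_fin mk0 k0x; have [s' s'0 Es'] := rpot_neg_fin mk0 k0x.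
have apE : rpot 0 (fun y => (ap y)%:E) x = (r + s')%:E.
  rewrite EFinD -Er -Es' -rpotD; [|exact: nnm_pos|exact: nnm_neg].
  by apply: eq_rpot => y; rewrite -EFinD.
have anE : rpot 0 (fun y => (an y)%:E) x = (s + r')%:E.
  rewrite EFinD -Er' -Es -rpotD; [|exact: nnm_neg|exact: nnm_pos].
  by apply: eq_rpot => y; rewrite -EFinD.
by rewrite /dpot apE anE /pot /dpot Er Es Er' Es' /=; split; ring.
Qed.

(** Where [u < v], either [0 < v] and then [k <= 0], or [u < v <= 0] and then [|k| <= H] since [v]
    lies between [u] and 0; in both cases [ap <= F]. *)
Let facts : {ae m, forall x, [/\ dpot ap an 0 x = (v x - u x)%R,
  dpot an ap 0 x = (u x - v x)%R, (u x < v x -> ap x <= F x)%R,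
  (v x < u x -> an x <= F x)%R & (u x = v x -> `|k x| <= F x)%R]}.
Proof.
have [_ _ _ _ kg] := vk.
have := aeI dE (aeI kg gH); apply: filterS => x [[d1 d2] [[kv kgx] gHx]].
have nk0 := norm_posneg (k0 x); have nk := norm_posneg (k x).
have p1 := max0 (k0 x); have p2 := max0 (- k0 x)%R.
have p3 := max0 (k x); have p4 := max0 (- k x)%R; have Hx := H0 x.
split=> // uv; rewrite /ap /an /F.
- have [v0|v0] := ltP 0%R (v x).
    have : (k x <= 0)%R by rewrite -(pmulr_lle0 _ v0).
    by move=> /max_r ->; lra.
  have : (`|k x| <= H x)%R.
    by apply: (le_trans kgx); apply: gHx; rewrite (ltW uv) v0 orbT.
  lra.
- have [v0|v0] := ltP (v x) 0%R.
    have : (- k x <= 0)%R by rewrite oppr_le0 -(nmulr_lle0 _ v0).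
    by move=> /max_r ->; lra.
  have : (`|k x| <= H x)%R.
    by apply: (le_trans kgx); apply: gHx; rewrite (ltW uv) v0.
  lra.
- have : (`|k x| <= H x)%R.
    apply: (le_trans kgx); apply: gHx; rewrite -uv lexx.
    by case: (leP 0%R (u x)) => // /ltW ->.
  lra.
Qed.

Lemma apriori_dist : {ae m, forall x,
  `|v x - u x|%:E <= rpot 0 (fun y => (F y)%:E) x}.
Proof.
have h1 : {ae m, forall x, (0 < dpot ap an 0 x -> ap x <= F x)%R}.
  by apply: filterS facts => x [-> _ h _ _]; rewrite subr_gt0.
have h2 : {ae m, forall x, (0 < dpot an ap 0 x -> an x <= F x)%R}.
  by apply: filterS facts => x [_ -> _ h _]; rewrite subr_gt0.
have := aeI facts (aeI (half_bound map man ap0 an0 ip im h1)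
  (half_bound man map an0 ap0 im ip h2)).
apply: filterS => x [[-> -> _ _ _] [i1 i2]].
by case: (leP 0%R (v x - u x)%R) => h; [rewrite ger0_norm|rewrite ltr0_norm // opprB].
Qed.

(** Two integrals of [F e] come from each of the sets [u < v] and [v < u], and one from [u = v]. *)
Lemma apriori_integral e (j : R) : (0 <= j)%R -> supermedian e ->
  (forall y, e y <= j%:E * (w y)%:E) ->
  \int[m]_x (`|k x|%:E * e x) <= 5%:E * \int[m]_x ((F x)%:E * e x).
Proof.
move=> j0 supe ej; have he := supe.1.
have h1 : {ae m, forall x, (0 < dpot ap an 0 x -> ap x <= F x)%R}.
  by apply: filterS facts => x [-> _ h _ _]; rewrite subr_gt0.
have h2 : {ae m, forall x, (0 < dpot an ap 0 x -> an x <= F x)%R}.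
  by apply: filterS facts => x [_ -> _ h _]; rewrite subr_gt0.
have i1 := half_integral map man ap0 an0 ip im h1 j0 supe ej.
have i2 := half_integral man map an0 ap0 im ip h2 j0 supe ej.
pose S1 x : \bar R := (if (0 < dpot ap an 0 x)%R then ap x else 0%R)%:E +
  (if (0 < dpot ap an 0 x)%R then an x else 0%R)%:E.
pose S2 x : \bar R := (if (0 < dpot an ap 0 x)%R then an x else 0%R)%:E +
  (if (0 < dpot an ap 0 x)%R then ap x else 0%R)%:E.
have hS (a b c : E -> R) : measurable_fun setT a -> measurable_fun setT b ->
    measurable_fun setT c -> (forall x, (0 <= a x)%R) -> (forall x, (0 <= b x)%R) ->
    nnm (fun x => (if (0 < c x)%R then a x else 0%R)%:E + (if (0 < c x)%R then b x else 0%R)%:E).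
  move=> ma mb mc a0 b0; apply: nnmD; apply: nnm_EFin.
  - by apply: measurable_fun_ifT => //; exact: measurable_fun_ltr.
  - by move=> x; case: ifP.
  - by apply: measurable_fun_ifT => //; exact: measurable_fun_ltr.
  - by move=> x; case: ifP.
have hS1 : nnm S1 by apply: hS => //; exact: measurable_dpot.
have hS2 : nnm S2 by apply: hS => //; exact: measurable_dpot.
apply: (@le_trans _ _ (\int[m]_x (S1 x * e x + S2 x * e x + (F x)%:E * e x))).
  apply: nnm_ae_le_integral; first exact: nnmM.
    by apply: nnmD; [apply: nnmD|]; exact: nnmM.
  apply: filterS facts => x [d1 d2 _ _ uv].
  have s1 := nnm_ge0 x hS1; have s2 := nnm_ge0 x hS2; have s3 := nnm_ge0 x hF.
  rewrite -(ge0_muleDl _ s1 s2) -(ge0_muleDl _ (adde_ge0 s1 s2) s3).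
  apply: lee_wpmul2r; first exact: nnm_ge0 he.
  rewrite /S1 /S2 d1 d2 !subr_gt0 -!EFinD lee_fin.
  have nk := norm_posneg (k x); have := F0 x; have := ap0 x; have := an0 x.
  have p1 := max0 (k0 x); have p2 := max0 (- k0 x)%R.
  rewrite /ap /an.
  by case: (ltgtP (u x) (v x)) => uvx; [lra|lra|have := uv uvx; lra].
rewrite nnm_integralD; [|by apply: nnmD; exact: nnmM|exact: nnmM].
rewrite nnm_integralD; [|exact: nnmM..].
have -> : (5%:E : \bar R) = 1%:E + 1%:E + (1%:E + 1%:E) + 1%:E.
  by rewrite -!EFinD; congr EFin; ring.
have iF := nnm_integral_ge0 m (nnmM hF he).
rewrite !ge0_muleDl ?lee_fin ?addr_ge0 ?mul1e //.
by apply: leeD => //; exact: leeD.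
Qed.

End apriori.

(** * Stability under almost everywhere limits *)

(** A bound for all admissible [v] that is supermedian, hence can enter test functions. *)
Let W x := rpot 0 (fun y => `|k0 y|%:E) x + W0 x + rpot 0 (fun y => (F y)%:E) x.

Let supW : supermedian W.
Proof.
by apply: supermedianD; [apply: supermedianD => //|]; exact: supermedian_rpot0.
Qed.

Let Wfin : {ae m, forall x, W x < +oo}.
Proof.
have := aeI (aeI (ae_rpot_lty hk0 iwk0) W0fin) (ae_rpot_lty hF iwF).
by apply: filterS => x [[a b] c]; rewrite /W; apply: lte_add_pinfty => //; exact: lte_add_pinfty.
Qed.

Let admissible_W v k : admissible v k -> {ae m, forall x, `|v x|%:E <= W x}.
Proof.
move=> vk; have := aeI (aeI (apriori_dist vk) uE) (aeI (ae_rpot_lty hk0 iwk0) h0W0).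
apply: filterS => x [[vu ux] [k0x h0x]].
have p0 := pot_le mk0 k0x.
apply: (@le_trans _ _ (`|pot k0 x|%:E + `|h0 x|%:E + `|v x - u x|%:E)).
  rewrite -!EFinD lee_fin (le_trans _ (lerD (ler_normD _ _) (lexx _))) //.
  have e1 : (pot k0 x + h0 x + (v x - u x) = v x)%R by rewrite ux; ring.
  by rewrite -{1}e1 ler_normD.
by rewrite /W; apply: leeD => //; exact: leeD.
Qed.

(** Equal to [w] where [W] is at least [n.+1 * w], and small where [W] is small: a test function that
    sees the mass of [k] on the sets where [v] may be large. *)
Let cut (n : nat) x := mine (w x)%:E ((n.+1%:R^-1)%:E * W x).

Let supcut n : supermedian (cut n).
Proof.
apply: supermedian_min; first exact: supermedian_w.
by apply: supermedianZ => //; rewrite invr_ge0.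
Qed.

Let cut_le n x : cut n x <= 1%:E * (w x)%:E.
Proof. by rewrite mul1e ge_min lexx. Qed.

Let etaF (n : nat) := 5%:E * \int[m]_x ((F x)%:E * cut n x).

Let etaF_cvg : etaF n @[n --> \oo] --> 0.
Proof.
rewrite -(mule0 5%:E); apply: cvgeZl => //.
have hcut n := (supcut n).1.
rewrite -[X in _ --> X](@integral0 _ _ _ m setT).
apply: (@ae_dominated_cvg _ _ (fun x => (w x)%:E * (F x)%:E)) => //.
- by move=> n; exact: nnmM.
- exact: nnmM.
- apply: filterS Wfin => x Wx.
  have [r Er] : exists r, W x = r%:E.
    have := nnm_ge0 x supW.1; move: Wx; case: (W x) => [r| |] // _ _; by exists r.
  have r0 : (0 <= r)%R by rewrite -lee_fin -Er; exact: (nnm_ge0 x supW.1).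
  apply: (@squeeze_cvge _ _ _ _ (cst 0) _ (fun n => (F x * (n.+1%:R^-1 * r))%:E)).
  + apply: nearW => n; apply/andP; split; first exact: (nnm_ge0 x (nnmM hF (hcut n))).
    rewrite EFinM; apply: lee_wpmul2l; first by rewrite lee_fin.
    by rewrite /cut Er -EFinM ge_min lexx orbT.
  + exact: cvg_cst.
  + apply/fine_cvgP; split; first exact: nearW.
    have -> : (0 = F x * (0 * r) :> R)%R by rewrite mul0r mulr0.
    by apply: cvgMr; apply: cvgMl; exact: cvg_harmonic.
- apply: nearW => x n; rewrite muleC; apply: lee_wpmul2r; first by rewrite lee_fin.
  by rewrite /cut ge_min lexx.
Qed.

(** Almost everywhere convergence of [ks] is upgraded to convergence in L1 with weight [w]. Where
    [|vs n|] is large, so is [W], [cut] equals [w], and the a priori estimate against [cut] bounds the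
    mass by [etaF]; where [|vs n|] is bounded, [gball] gives a dominating function. *)
Lemma admissible_limit (vs ks : nat -> E -> R) (v k : E -> R) :
  (forall n, admissible (vs n) (ks n)) ->
  measurable_fun setT v -> measurable_fun setT k ->
  {ae m, forall x, vs n x @[n --> \oo] --> v x} ->
  {ae m, forall x, ks n x @[n --> \oo] --> k x} ->
  {ae m, forall x, (k x * v x <= 0)%R /\ (`|k x| <= `|g x (v x)|)%R} ->
  admissible v k.
Proof.
move=> adm mv mk vsv ksk kg.
have mvs n : measurable_fun setT (vs n) by case: (adm n).
have mks n : measurable_fun setT (ks n) by case: (adm n).
have hk : nnm (fun x => `|k x|%:E) by exact: nnm_abs.
have hks n : nnm (fun x => `|ks n x|%:E) by exact: nnm_abs.
have mD n : measurable_fun setT (fun x => ks n x - k x)%R by exact: measurable_funB.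
have hD n : nnm (fun x => `|ks n x - k x|%:E) by exact: nnm_abs.
have bound e (j : R) : (0 <= j)%R -> supermedian e ->
    (forall y, e y <= j%:E * (w y)%:E) ->
    \int[m]_x (`|k x|%:E * e x) <= 5%:E * \int[m]_x ((F x)%:E * e x).
  move=> j0 supe ej; have he := supe.1.
  apply: (@fatou_le (fun n x => `|ks n x|%:E * e x) _
    (fun=> 5%:E * \int[m]_x ((F x)%:E * e x))).
  - by move=> n; exact: nnmM.
  - exact: nnmM.
  - apply: filterS ksk => x kx; apply: cvgeZr.
      rewrite ge0_fin_numE ?(nnm_ge0 x he) //; apply: le_lt_trans (ej x) _.
      by rewrite -EFinM ltry.
    by apply/fine_cvgP; split; [exact: nearW|exact: cvg_norm].
  - by move=> n; exact: (apriori_integral (adm n) j0 supe ej).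
  - exact: cvg_cst.
have iwk : \int[m]_x ((w x)%:E * `|k x|%:E) < +oo.
  under eq_integral do rewrite muleC.
  apply: (@le_lt_trans _ _ (5%:E * \int[m]_x ((F x)%:E * (w x)%:E))).
    by apply: (bound _ 1%R) => //; [exact: supermedian_w|move=> y; rewrite mul1e].
  rewrite lte_mul_pinfty //; by under eq_integral do rewrite muleC.
have iwks n : \int[m]_x ((w x)%:E * `|ks n x|%:E) < +oo by case: (adm n).
have L1 (e : R) : (0 < e)%R -> \forall n \near \oo,
    \int[m]_x ((w x)%:E * `|ks n x - k x|%:E) <= e%:E.
  move=> e0; have e40 : (0 < e / 4)%R by rewrite divr_gt0.
  have [l0 _ /(_ l0 (leqnn l0)) le_l0] := cvge0_near_lt etaF_cvg e40.
  pose M := (C * l0.+1%:R)%R.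
  have [b [mb b0 ib gb]] := gball M.
  have hb : nnm (fun x => (b x)%:E) by exact: nnm_EFin.
  pose f n x : \bar R := if (`|vs n x| <= M)%R then (w x)%:E * `|ks n x - k x|%:E else 0.
  have mle n : measurable_fun setT (fun x => (`|vs n x| <= M)%R).
    by apply: measurable_fun_ler => //; exact: measurableT_comp.
  have hf n : nnm (f n).
    split; last by move=> x; rewrite /f; case: ifP => // _; exact: (nnm_ge0 x (nnmM hw' (hD n))).
    by apply: measurable_fun_ifT => //; exact: nnm_meas (nnmM hw' (hD n)).
  have hbk : nnm (fun x => (w x)%:E * ((b x)%:E + `|k x|%:E)) by apply: nnmM => //; exact: nnmD.
  have ibk : \int[m]_x ((w x)%:E * ((b x)%:E + `|k x|%:E)) < +oo.
    under eq_integral do rewrite ge0_muleDr ?lee_fin //.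
    by rewrite nnm_integralD; [apply: lte_add_pinfty => //; exact: le_w_rho|exact: nnmM..].
  have fcvg : \int[m]_x f n x @[n --> \oo] --> \int[m]_x (cst 0 x : \bar R).
    apply: (ae_dominated_cvg hf _ hbk ibk) => //.
    - apply: filterS ksk => x kx.
      apply: (@squeeze_cvge _ _ _ _ (cst 0) _ (fun n => (w x * `|ks n x - k x|)%:E)).
      + apply: nearW => n; rewrite (nnm_ge0 x (hf n)) /= /f.
        by case: ifP => _; rewrite -?EFinM // lee_fin mulr_ge0 // w_ge0.
      + exact: cvg_cst.
      + apply/fine_cvgP; split; first exact: nearW.
        rewrite -[X in _ --> X](mulr0 (w x)); apply: cvgMr.
        rewrite -[X in _ --> X](normr0 R) -(subrr (k x)).
        by apply: cvg_norm; apply: cvgB => //; exact: cvg_cst.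
    - have adm4 : {ae m, forall x n, (`|ks n x| <= `|g x (vs n x)|)%R}.
        apply/ae_foralln => n; have [_ _ _ _] := adm n.
        by apply: filterS => x [].
      apply: filterS2 gb adm4 => x gbx kx n.
      rewrite /f; case: ifPn => vM; last exact: (nnm_ge0 x hbk).
      apply: lee_wpmul2l; first by rewrite lee_fin w_ge0.
      rewrite -EFinD lee_fin (le_trans (ler_normB _ _)) // lerD2r.
      by apply: (le_trans (kx n)); exact: gbx.
  rewrite integral0 in fcvg.
  have := cvge0_near_lt fcvg e40; apply: filterS => n fn.
  have hcut := (supcut l0).1.
  apply: (@le_trans _ _ (\int[m]_x (f n x + (`|ks n x|%:E * cut l0 x + `|k x|%:E * cut l0 x)))).
    apply: nnm_ae_le_integral; first exact: nnmM.
      by apply: nnmD => //; apply: nnmD; exact: nnmM.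
    apply: filterS (admissible_W (adm n)) => x vW.
    have c0 := nnm_ge0 x hcut.
    rewrite /f; case: ifPn => vM.
      by rewrite leeDl // adde_ge0 // mule_ge0.
    rewrite add0e -ge0_muleDl ?lee_fin // muleC.
    have -> : cut l0 x = (w x)%:E.
      rewrite /cut; apply/min_idPl; apply: (@le_trans _ _ ((l0.+1%:R)^-1 * M)%:E).
        by rewrite lee_fin /M mulrCA mulVf ?mulr1.
      rewrite EFinM; apply: lee_wpmul2l; first by rewrite lee_fin invr_ge0.
      by apply: le_trans vW; rewrite lee_fin ltW // ltNge.
    apply: lee_wpmul2r; first by rewrite lee_fin w_ge0.
    by rewrite -EFinD lee_fin ler_normB.
  have hk1 := nnmM (hks n) hcut; have hk2 := nnmM hk hcut.
  rewrite (nnm_integralD m (hf n) (nnmD hk1 hk2)) (nnm_integralD m hk1 hk2).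
  have i1 : \int[m]_x (`|ks n x|%:E * cut l0 x) <= (e / 4)%:E.
    apply: le_trans (ltW le_l0).
    exact: (apriori_integral (adm n) ler01 (supcut l0) (cut_le l0)).
  have i2 : \int[m]_x (`|k x|%:E * cut l0 x) <= (e / 4)%:E.
    by apply: le_trans (ltW le_l0); exact: (bound _ 1%R ler01 (supcut l0) (cut_le l0)).
  apply: (le_trans (leeD (ltW fn) (leeD i1 i2))).
  by rewrite -!EFinD lee_fin; lra.
have L1c : \int[m]_x ((w x)%:E * `|ks n x - k x|%:E) @[n --> \oo] --> 0.
  apply/fine_cvgP; split.
    have := L1 1%R ltr01; apply: filterS => n h.
    rewrite ge0_fin_numE ?(nnm_integral_ge0 m (nnmM hw' (hD n))) //.
    by apply: le_lt_trans h _; rewrite ltry.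
  apply/cvgrPdist_le => /= e e0; have := L1 e e0; apply: filterS => n h.
  rewrite sub0r normrN ger0_norm ?fine_ge0 ?(nnm_integral_ge0 m (nnmM hw' (hD n))) //.
  rewrite -lee_fin fineK // ge0_fin_numE ?(nnm_integral_ge0 m (nnmM hw' (hD n))) //.
  by apply: le_lt_trans h _; rewrite ltry.
split=> //.
pose r x := `|v x - (h0 x + pot k x)|%R.
have mr : measurable_fun setT (fun x => v x - (h0 x + pot k x))%R.
  apply: measurable_funB => //; apply: measurable_funD => //; exact: measurable_pot.
have hr : nnm (fun x => (r x)%:E) by exact: nnm_abs.
pose fs n x := (Num.max (r x - `|vs n x - v x|) 0)%:E.
have hfs n : nnm (fs n).
  apply: nnm_EFin; last by move=> x; rewrite le_max lexx orbT.
  apply: measurable_maxr => //; apply: measurable_funB; first exact: measurableT_comp.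
  by apply: measurableT_comp => //; exact: measurable_funB.
suff : \int[m]_x ((vr x)%:E * (r x)%:E) <= 0.
  move=> /(ae_eq0_of_integral mvr vr0 hr); apply: filterS => x [] /eqP.
  by rewrite normr_eq0 subr_eq0 => /eqP.
apply: (@fatou_le (fun n x => (vr x)%:E * fs n x) _
  (fun n => \int[m]_x ((w x)%:E * `|ks n x - k x|%:E))) => //.
- by move=> n; exact: nnmM.
- exact: nnmM.
- apply: filterS vsv => x vx; apply: cvgeZl => //.
  apply/fine_cvgP; split; first exact: nearW.
  rewrite /fs /=; have r0 : (0 <= r x)%R by exact: normr_ge0.
  apply/cvgrPdist_le => /= e e0; move/cvgrPdist_le : vx => /(_ _ e0).
  apply: filterS => n; rewrite distrC => h; have d0 := normr_ge0 (vs n x - v x)%R.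
  by case: (leP (r x - `|vs n x - v x|)%R 0%R) => i; rewrite ler_norml;
    apply/andP; split; lra.
- move=> n; rewrite -int_vr_rpot0 //; apply: nnm_ae_le_integral; [exact: nnmM|
    by apply: nnmM => //; exact: nnm_rpot|].
  have [_ _ _ vE _] := adm n.
  have := aeI vE (aeI (ae_rpot_lty (hks n) (iwks n)) (ae_rpot_lty hk iwk)).
  apply: filterS => x [vx [ksx kx]]; apply: lee_wpmul2l; first by rewrite lee_fin ltW.
  apply: le_trans (pot_dist (mks n) mk ksx kx).
  rewrite lee_fin ge_max normr_ge0 andbT lerBlDr /r.
  have -> : (v x - (h0 x + pot k x) = (pot (ks n) x - pot k x) + (v x - vs n x))%R.
    by rewrite vx; ring.
  by rewrite (le_trans (ler_normD _ _)) // lerD2l distrC.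
Qed.

(** * Truncation and solvability *)

(** The two levels are independent, because the maximal solution increases with [n] and decreases with
    [k]. *)
Definition truncg (n k : nat) x y : R :=
  (Num.min (Num.max (g x y) 0) (n.+1%:R * vr x) -
   Num.min (Num.max (- g x y) 0) (k.+1%:R * vr x))%R.

Lemma truncg_abs n k x y : (`|truncg n k x y| <= `|g x y|)%R.
Proof.
have n0 : (0 <= n.+1%:R * vr x)%R by rewrite mulr_ge0 // ltW.
have k0' : (0 <= k.+1%:R * vr x)%R by rewrite mulr_ge0 // ltW.
rewrite /truncg; move: n0 k0'; set a := (n.+1%:R * _)%R; set b := (k.+1%:R * _)%R.
move=> a0 b0; case: (leP 0%R (g x y)) => g0.
  rewrite (max_r (_ : - g x y <= 0)%R) ?oppr_le0 // (min_l b0) subr0.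
  by rewrite !ger0_norm // ?le_min ?g0 // ge_min lexx.
have ng0 : (0 <= - g x y)%R by rewrite oppr_ge0 ltW.
rewrite (max_l ng0) (min_l a0) sub0r normrN (ltr0_norm g0) ger0_norm ?ge_min ?lexx //.
by rewrite le_min b0 ng0.
Qed.

Lemma truncg_sign n k x y : (truncg n k x y * y <= 0)%R.
Proof.
have n0 : (0 <= n.+1%:R * vr x)%R by rewrite mulr_ge0 // ltW.
have k0' : (0 <= k.+1%:R * vr x)%R by rewrite mulr_ge0 // ltW.
rewrite /truncg; move: n0 k0'; set a := (n.+1%:R * _)%R; set b := (k.+1%:R * _)%R.
move=> a0 b0; have := sg x y; case: (leP 0%R (g x y)) => g0.
  rewrite (max_r (_ : - g x y <= 0)%R) ?oppr_le0 // (min_l b0) subr0.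
  by case: (leP (g x y) a) => ga; nra.
have ng0 : (0 <= - g x y)%R by rewrite oppr_ge0 ltW.
rewrite (max_l ng0) (min_l a0) sub0r mulNr.
by case: (leP (- g x y)%R b) => gb; nra.
Qed.

Lemma truncg_bound n k x y :
  (- (k.+1%:R * vr x) <= truncg n k x y <= n.+1%:R * vr x)%R.
Proof.
have n0 : (0 <= n.+1%:R * vr x)%R by rewrite mulr_ge0 // ltW.
have k0' : (0 <= k.+1%:R * vr x)%R by rewrite mulr_ge0 // ltW.
rewrite /truncg; move: n0 k0'; set a := (n.+1%:R * _)%R; set b := (k.+1%:R * _)%R.
move=> a0 b0.
have i1 : (0 <= Num.min (Num.max (g x y) 0) a)%R by rewrite le_min a0 le_max lexx orbT.
have i2 : (0 <= Num.min (Num.max (- g x y) 0) b)%R by rewrite le_min b0 le_max lexx orbT.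
have i3 : (Num.min (Num.max (g x y) 0) a <= a)%R by rewrite ge_min lexx orbT.
have i4 : (Num.min (Num.max (- g x y) 0) b <= b)%R by rewrite ge_min lexx orbT.
by apply/andP; split; lra.
Qed.

Lemma truncg_incr n n' k x y : (n <= n')%N -> (truncg n k x y <= truncg n' k x y)%R.
Proof.
move=> nn; rewrite /truncg lerD2r le_min ge_min lexx /=.
by rewrite ge_min ler_pM2r // ler_nat ltnS nn orbT.
Qed.

Lemma truncg_decr n k k' x y : (k <= k')%N -> (truncg n k' x y <= truncg n k x y)%R.
Proof.
move=> kk; rewrite /truncg lerD2l lerN2 le_min ge_min lexx /=.
by rewrite ge_min ler_pM2r // ler_nat ltnS kk orbT.
Qed.

Lemma truncg_continuous n k x : continuous (truncg n k x).
Proof.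
have cst_cont (c : R) : continuous (fun _ : R => c) by move=> ?; exact: cvg_cst.
have c1 : continuous (g x \max (fun=> 0%R)).
  by apply: max_fun_continuous; [exact: cg|exact: cst_cont].
have c2 : continuous ((fun y => - g x y)%R \max (fun=> 0%R)).
  by apply: max_fun_continuous; [move=> y; apply: cvgN; exact: cg|exact: cst_cont].
have c3 := @min_fun_continuous _ _ _ _ _ c1 (cst_cont (n.+1%:R * vr x)%R).
have c4 := @min_fun_continuous _ _ _ _ _ c2 (cst_cont (k.+1%:R * vr x)%R).
by move=> y; apply: cvgB; [exact: c3|exact: c4].
Qed.

Lemma measurable_truncg n k y : measurable_fun setT (truncg n k ^~ y).
Proof.
apply: measurable_funB; apply: measurable_minr; try exact: measurable_funM.
  by apply: measurable_maxr.
by apply: measurable_maxr => //; exact: measurableT_comp.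
Qed.

Let pot_fin (k : E -> R) (N : nat) x : measurable_fun setT k ->
  (forall y, (`|k y| <= N%:R * vr y)%R) -> rpot 0 (fun y => `|k y|%:E) x < +oo.
Proof.
move=> mk kN; apply: (@le_lt_trans _ _ (rpot 0 (fun y => N%:R%:E * (vr y)%:E) x)).
  by apply: le_rpot; [exact: nnm_abs|exact: nnmZ|] => y; rewrite -EFinM lee_fin.
by rewrite rpotZ // wE -EFinM ltry.
Qed.

(** The truncation is at least [- N vr], so adding [N vr] makes the right-hand side nonnegative, at
    the price of a shift of the potential by [N w], and [continuous_max_solution] applies. Maximality
    is what makes the solutions monotone in the levels of truncation. *)
Lemma truncated_solution n k : exists kk : E -> R,
  [/\ measurable_fun setT kk, forall x, kk x = truncg n k x (h0 x + pot kk x)%R &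
    forall k' : E -> R, measurable_fun setT k' ->
      (exists N : nat, forall x, (`|k' x| <= N%:R * vr x)%R) ->
      (forall x, (k' x <= truncg n k x (h0 x + pot k' x))%R) ->
      forall x, (pot k' x <= pot kk x)%R].
Proof.
pose N := (n + k).+2; have N0 : (0 <= N%:R :> R)%R by [].
have nN : (n.+1%:R <= N%:R :> R)%R by rewrite ler_nat ltnS leqW // leq_addr.
have kN : (k.+1%:R <= N%:R :> R)%R by rewrite ler_nat ltnS leqW // leq_addl.
have nv x : (n.+1%:R * vr x <= N%:R * vr x)%R by rewrite ler_pM2r.
have kv x : (k.+1%:R * vr x <= N%:R * vr x)%R by rewrite ler_pM2r.
pose B x z := (truncg n k x (h0 x + (z - N%:R * w x)) + N%:R * vr x)%R.
pose F2 x := (2 * N%:R * vr x)%R.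
have mw : measurable_fun setT w by apply/measurable_EFinP; exact: nnm_meas hw'.
have mB y : measurable_fun setT (B ^~ y).
  apply: measurable_funD; last exact: measurable_funM.
  apply: (@caratheodory_measurable _ _ _ (truncg n k)).
  - by move=> z; exact: measurable_truncg.
  - by move=> x; exact: truncg_continuous.
  - by apply: measurable_funD => //; apply: measurable_funB => //; exact: measurable_funM.
have cB x : continuous (B x).
  move=> y; apply: cvgD; last exact: cvg_cst.
  apply: continuous_cvg; first exact: truncg_continuous.
  by apply: cvgD; [exact: cvg_cst|apply: cvgB; [exact: cvg_id|exact: cvg_cst]].
have BF x y : (0 <= B x y <= F2 x)%R.
  have /andP[i1 i2] := truncg_bound n k x (h0 x + (y - N%:R * w x)).
  have := nv x; have := kv x; rewrite /B /F2 => i3 i4.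
  by apply/andP; split; lra.
have mF2 : measurable_fun setT F2 by exact: measurable_funM.
have F2fin x : rpot 0 (fun y => (F2 y)%:E) x < +oo.
  have -> : rpot 0 (fun y => (F2 y)%:E) x = rpot 0 (fun y => (2 * N%:R)%:E * (vr y)%:E) x.
    by apply: eq_rpot => y; rewrite -EFinM.
  by rewrite rpotZ //; rewrite wE -EFinM ltry.
have [zeta [mz z0 zE zmax]] := continuous_max_solution mB mF2 cB BF F2fin.
pose kk x := truncg n k x (h0 x + (zeta x - N%:R * w x))%R.
have mkk : measurable_fun setT kk.
  apply: (@caratheodory_measurable _ _ _ (truncg n k)).
  - by move=> z; exact: measurable_truncg.
  - by move=> x; exact: truncg_continuous.
  - by apply: measurable_funD => //; apply: measurable_funB => //; exact: measurable_funM.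
have hNv : nnm (fun x => N%:R%:E * (vr x)%:E) by exact: nnmZ.
(* Adding [N vr] to a density adds [N w] to its potential. *)
have shift (k' pp pn : E -> R) : measurable_fun setT k' ->
    (exists N : nat, forall x, (`|k' x| <= N%:R * vr x)%R) ->
    measurable_fun setT pp -> measurable_fun setT pn ->
    (forall x, (0 <= pp x)%R) -> (forall x, (0 <= pn x)%R) ->
    (forall x, (pp x <= F2 x)%R) -> (forall x, (pp x - pn x = k' x + N%:R * vr x)%R) ->
    (forall x, rpot 0 (fun y => (pn y)%:E) x < +oo) ->
    forall x, dpot pp pn 0 x = (pot k' x + N%:R * w x)%R.
  move=> mk' [N' kN'] mpp mpn pp0 pn0 ppF pE pnfin x.
  have kx := pot_fin x mk' kN'.
  have [r r0 Er] := rpot_pos_fin mk' kx; have [s s0 Es] := rpot_neg_fin mk' kx.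
  have hpp : nnm (fun y => (pp y)%:E) by exact: nnm_EFin.
  have hpn : nnm (fun y => (pn y)%:E) by exact: nnm_EFin.
  have hF2 : nnm (fun y => (F2 y)%:E).
    by apply: nnm_EFin => // y; apply: le_trans (ppF y).
  have [a a0 Ea] := rpot_lty_le hpp hF2 (fun y => ppF y) (F2fin x).
  have [b b0 Eb] := rpot_lty_le hpn hpn (fun y => lexx _) (pnfin x).
  have : rpot 0 (fun y => (pp y)%:E + (Num.max (- k' y) 0)%:E) x =
         rpot 0 (fun y => (pn y)%:E + (Num.max (k' y) 0)%:E + N%:R%:E * (vr y)%:E) x.
    apply: eq_rpot => y; rewrite -EFinM -!EFinD; congr EFin.
    by have := pE y; have := sub_posneg (k' y); lra.
  have h1 := nnm_neg mk'; have h2 := nnm_pos mk'.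
  rewrite (rpotD _ _ hpp h1) (rpotD _ _ (nnmD hpn h2) hNv) (rpotD _ _ hpn h2).
  rewrite (rpotZ _ _ N0 hvr') wE Er Es Ea Eb -EFinM -!EFinD => -[e1].
  by rewrite /pot /dpot Er Es Ea Eb /=; lra.
have kkN x : (`|kk x| <= N%:R * vr x)%R.
  have /andP[i1 i2] := truncg_bound n k x (h0 x + (zeta x - N%:R * w x)).
  have := nv x; have := kv x; rewrite /kk => i3 i4.
  by rewrite ler_norml; apply/andP; split; lra.
have pot0 x : rpot 0 (fun _ : E => 0%R%:E) x = 0 by rewrite /rpot integral0.
have potkk x : (pot kk x = zeta x - N%:R * w x)%R.
  have : dpot (fun x => B x (zeta x)) (fun=> 0%R) 0 x = (pot kk x + N%:R * w x)%R.
    apply: shift => //.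
    - by exists N.
    - exact: caratheodory_measurable.
    - by move=> y; have /andP[] := BF y (zeta y).
    - by move=> y; have /andP[] := BF y (zeta y).
    - by move=> y; rewrite subr0.
    - by move=> y; rewrite pot0 ltry.
  by rewrite /dpot -zE pot0 subr0 /= => ->; rewrite addrK.
exists kk; split=> //.
  by move=> x; rewrite potkk.
move=> k' mk' [N' kN'] k'le x; rewrite potkk.
pose pp y := Num.max (k' y + N%:R * vr y)%R 0%R.
pose pn y := Num.max (- (k' y + N%:R * vr y))%R 0%R.
have msum : measurable_fun setT (fun y => k' y + N%:R * vr y)%R.
  by apply: measurable_funD => //; exact: measurable_funM.
have mpp : measurable_fun setT pp by exact: measurable_maxr.
have mpn : measurable_fun setT pn.
  by apply: measurable_maxr => //; exact: measurableT_comp.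
have pp0 y : (0 <= pp y)%R by rewrite le_max lexx orbT.
have pn0 y : (0 <= pn y)%R by rewrite le_max lexx orbT.
have vr0' y := ltW (vr0 y).
have ppF y : (pp y <= F2 y)%R.
  rewrite /pp ge_max; apply/andP; split; last by rewrite !mulr_ge0.
  have /andP[_ i2] := truncg_bound n k y (h0 y + pot k' y).
  have := k'le y; have := nv y; rewrite /F2; lra.
have pnfin y : rpot 0 (fun y => (pn y)%:E) y < +oo.
  apply: (@le_lt_trans _ _ (rpot 0 (fun z => N'%:R%:E * (vr z)%:E) y)).
    apply: le_rpot; [exact: nnm_EFin|exact: nnmZ|] => z.
    rewrite -EFinM lee_fin /pn ge_max; apply/andP; split; last by rewrite mulr_ge0.
    have : (0 <= N%:R * vr z)%R by rewrite mulr_ge0.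
    by have := kN' z; rewrite ler_norml => /andP[]; lra.
  by rewrite rpotZ // wE -EFinM ltry.
have pE y : (pp y - pn y = k' y + N%:R * vr y)%R.
  by rewrite [RHS]sub_posneg.
have dE := shift k' pp pn mk' (ex_intro _ N' kN') mpp mpn pp0 pn0 ppF pE pnfin.
have := zmax pp pn mpp mpn _ pn0 pnfin _ x; rewrite dE lerBrDr; apply.
- by move=> y; rewrite pp0 ppF.
- move=> y; rewrite dE /B addrK -lerBlDl pE lerD2r; exact: k'le.
Qed.

Lemma ae_cvg_measurable (vs : nat -> E -> R) : (forall n, measurable_fun setT (vs n)) ->
  {ae m, forall x, cvgn (vs ^~ x)} ->
  exists2 v : E -> R, measurable_fun setT v & {ae m, forall x, vs n x @[n --> \oo] --> v x}.
Proof.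
move=> mvs vscvg.
exists (fun x => fine (limn_esup (fun n => (vs n x)%:E))).
  apply: measurableT_comp => //; apply: measurable_fun_limn_esup => n.
  exact/measurable_EFinP.
apply: filterS vscvg => x /cvg_ex[l vl].
have vl' : (vs n x)%:E @[n --> \oo] --> l%:E.
  by apply/fine_cvgP; split; [exact: nearW|exact: vl].
rewrite is_cvg_limn_esupE; last by apply/cvg_ex; exists l%:E.
by rewrite (cvg_lim _ vl').
Qed.

(** The maximal solutions of the truncated problems decrease in [k], increase in [n] and are bounded by
    [W], so that both limits exist, and [admissible_limit] applies to each. Integrability against
    [rho] comes from the a priori estimate against [min rho (j w)], as [j] grows. *)
Lemma semilinear_solvable : exists v : E -> R,
  [/\ measurable_fun setT v,
      \int[m]_x ((rho x)%:E * `|g x (v x)|%:E) < +oo,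
      \int[m]_x ((w x)%:E * `|g x (v x)|%:E) < +oo &
      {ae m, forall x, v x = (h0 x + pot (fun x => g x (v x)) x)%R}].
Proof.
have [ks ksP] := choice (fun nk : nat * nat => truncated_solution nk.1 nk.2).
pose vs n k x := (h0 x + pot (ks (n, k)) x)%R.
have mks n k : measurable_fun setT (ks (n, k)) by have [] := ksP (n, k).
have ksE n k x : ks (n, k) x = truncg n k x (vs n k x) by have [_ ->] := ksP (n, k).
have mvs n k : measurable_fun setT (vs n k).
  by apply: measurable_funD => //; exact: measurable_pot.
have ksN n k x : (`|ks (n, k) x| <= (n.+1 + k.+1)%:R * vr x)%R.
  have /andP[] := truncg_bound n k x (vs n k x); rewrite -ksE natrD mulrDl.
  have i1 : (0 <= n.+1%:R * vr x)%R by rewrite mulr_ge0 // ltW.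
  have i2 : (0 <= k.+1%:R * vr x)%R by rewrite mulr_ge0 // ltW.
  by move=> i3 i4; rewrite ler_norml; apply/andP; split; lra.
have C0 : (0 <= C)%R by exact: le_trans (w_ge0 point) (wC point).
have adm n k : admissible (vs n k) (ks (n, k)).
  split=> //.
  - have CN : (0 <= C * (n.+1 + k.+1)%:R)%R by rewrite mulr_ge0.
    apply: (@le_lt_trans _ _ (\int[m]_x ((C * (n.+1 + k.+1)%:R)%:E * (vr x)%:E))).
      apply: nnm_le_integral; [by apply: nnmM => //; exact: nnm_abs|exact: nnmZ|] => y.
      rewrite -!EFinM lee_fin -mulrA; apply: ler_pM => //; exact: w_ge0.
    by rewrite nnm_integralZ ?lte_mul_pinfty ?lee_fin //.
  - exact: nearW.
  - apply: nearW => x; rewrite ksE; split; first exact: truncg_sign.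
    exact: truncg_abs.
have vs_decr n k k' x : (k <= k')%N -> (vs n k' x <= vs n k x)%R.
  move=> kk'; rewrite /vs lerD2l; have [_ _ mx] := ksP (n, k); apply: mx => //.
    by exists (n.+1 + k'.+1)%N; exact: ksN.
  by move=> y; rewrite {1}ksE; exact: truncg_decr.
have vs_incr n n' k x : (n <= n')%N -> (vs n k x <= vs n' k x)%R.
  move=> nn'; rewrite /vs lerD2l; have [_ _ mx] := ksP (n', k); apply: mx => //.
    by exists (n.+1 + k.+1)%N; exact: ksN.
  by move=> y; rewrite {1}ksE; exact: truncg_incr.
have bounded (us : nat -> E -> R) (ls : nat -> E -> R) :
    (forall n, admissible (us n) (ls n)) ->
    {ae m, forall x, exists M : R, forall n, (`|us n x| <= M)%R}.
  move=> ul; have : {ae m, forall x n, `|us n x|%:E <= W x}.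
    by apply/ae_foralln => n; exact: admissible_W (ul n).
  apply: filterS2 Wfin => x Wx uW; exists (fine (W x)) => n.
  have := uW n; rewrite -{1}(@fineK _ (W x)) // ge0_fin_numE //.
  exact: (nnm_ge0 x supW.1).
have vrx_gt0 (j : nat) x : (0 < j.+1%:R * vr x)%R by rewrite mulr_gt0.
have /choice[v1 v1P] : forall n, exists v : E -> R, measurable_fun setT v /\
    {ae m, forall x, vs n k x @[k --> \oo] --> v x}.
  move=> n; have [|v mv vE] := @ae_cvg_measurable (vs n) (mvs n); last by exists v.
  apply: filterS (bounded _ _ (adm n)) => x [M vM].
  apply: nonincreasing_is_cvgn; first by move=> k k' kk'; exact: vs_decr.
  by exists (- M)%R => _ [k _ <-]; have := vM k; rewrite ler_norml => /andP[].
have mv1 n := (v1P n).1; have v1E n := (v1P n).2.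
(* Truncation levels that grow are eventually not felt by a convergent sequence. *)
have level (us : nat -> R) x l : us n @[n --> \oo] --> (l : R) ->
    \forall n \near \oo, (us n <= n.+1%:R * vr x)%R.
  move=> ul; have : \forall n \near \oo, (us n <= l + 1)%R.
    have /cvgrPdist_le /(_ _ ltr01) := ul; apply: filterS => n.
    by rewrite ler_norml => /andP[]; lra.
  have : \forall n \near \oo, ((l + 1) / vr x <= n%:R)%R by exact: nbhs_infty_ger.
  apply: filterS2 => n h1 h2; apply: (le_trans h2).
  rewrite -ler_pdivrMr //; apply: (le_trans h1); by rewrite ler_nat.
pose g1 (n : nat) x y := (Num.min (Num.max (g x y) 0) (n.+1%:R * vr x) - Num.max (- g x y) 0)%R.
have cmax x : continuous (fun y => Num.max (g x y) 0%R).
  by move=> y; apply: (@max_fun_continuous _ _ _ (g x) (fun=> 0%R)); [exact: cg|move=> ?; exact: cvg_cst].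
have cmaxN x : continuous (fun y => Num.max (- g x y)%R 0%R).
  by move=> y; apply: (@max_fun_continuous _ _ _ (fun y => - g x y)%R (fun=> 0%R)) => z; [apply: cvgN; exact: cg|exact: cvg_cst].
have cg1 n x : continuous (g1 n x).
  move=> y; apply: cvgB; last exact: cmaxN.
  by apply: (@min_fun_continuous _ _ _ (fun y => Num.max (g x y) 0%R) (fun=> (n.+1%:R * vr x)%R)) => [|z]; [exact: cmax|exact: cvg_cst].
have mg1 n y : measurable_fun setT (g1 n ^~ y).
  apply: measurable_funB; [apply: measurable_minr; [exact: measurable_maxr|exact: measurable_funM]|].
  by apply: measurable_maxr => //; exact: measurableT_comp.
pose k1 n x := g1 n x (v1 n x).
have mk1 n : measurable_fun setT (k1 n) by exact: caratheodory_measurable.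
have g1_trunc n x y : \forall k \near \oo, g1 n x y = truncg n k x y.
  have c0 : Num.max (- g x y)%R 0%R @[_ --> \oo] --> Num.max (- g x y)%R 0%R by exact: cvg_cst.
  have := level _ x _ c0.
  by apply: filterS => k hk; rewrite /g1 /truncg (min_l hk).
have adm1 n : admissible (v1 n) (k1 n).
  apply: (admissible_limit (adm n)) => //.
    apply: filterS (v1E n) => x vx.
    have c1 : g1 n x (vs n k x) @[k --> \oo] --> k1 n x.
      by apply: continuous_cvg => //; exact: cg1.
    apply: cvg_trans c1; apply: near_eq_cvg.
    have c2 : Num.max (- g x (vs n k x))%R 0%R @[k --> \oo] --> Num.max (- g x (v1 n x))%R 0%R.
      exact: (cvg_comp _ _ vx (@cmaxN x (v1 n x))).
    have := level _ x _ c2; apply: filterS => k hk.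
    by rewrite ksE /g1 /truncg (min_l hk).
  apply: nearW => x; have [k _ /(_ k (leqnn k)) e1] := g1_trunc n x (v1 n x).
  by rewrite /k1 e1; split; [exact: truncg_sign|exact: truncg_abs].
have [v mv vE] : exists2 v : E -> R, measurable_fun setT v &
    {ae m, forall x, v1 n x @[n --> \oo] --> v x}.
  apply: ae_cvg_measurable => //.
  have v1E' : {ae m, forall x n, vs n k x @[k --> \oo] --> v1 n x} by exact/ae_foralln.
  apply: filterS2 (bounded _ _ adm1) v1E' => x [M vM] v1x.
  apply: nondecreasing_is_cvgn.
    move=> n n' nn'; apply: (ler_cvg_to (v1x n) (v1x n')).
    by apply: nearW => k; exact: vs_incr.
  by exists M => _ [k _ <-]; have := vM k; rewrite ler_norml => /andP[].
pose k x := g x (v x).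
have mk : measurable_fun setT k by exact: caratheodory_measurable.
have admv : admissible v k.
  apply: (admissible_limit adm1) => //; last by apply: nearW => x; split; [exact: sg|].
  apply: filterS vE => x vx.
  have c1 : g x (v1 n x) @[n --> \oo] --> k x by apply: continuous_cvg => //; exact: cg.
  apply: cvg_trans c1; apply: near_eq_cvg.
  have c2 : Num.max (g x (v1 n x))%R 0%R @[n --> \oo] --> Num.max (g x (v x))%R 0%R.
    exact: (cvg_comp _ _ vx (@cmax x (v x))).
  have := level _ x _ c2; apply: filterS => n hk.
  by rewrite /k1 /g1 (min_l hk) [LHS]sub_posneg.
have [_ _ iwk vkE _] := admv.
exists v; split=> //.
have hk : nnm (fun x => `|k x|%:E) by exact: nnm_abs.
pose ee (j : nat) x := mine (rho x)%:E (j%:R%:E * (w x)%:E).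
have supee j : supermedian (ee j).
  by apply: supermedian_min => //; apply: supermedianZ => //; exact: supermedian_w.
have hee j := (supee j).1.
apply: (@le_lt_trans _ _ (5%:E * \int[m]_x ((rho x)%:E * (F x)%:E))); last first.
  by rewrite lte_mul_pinfty.
apply: (@fatou_le (fun j x => `|k x|%:E * ee j x) _
   (fun=> 5%:E * \int[m]_x ((rho x)%:E * (F x)%:E))).
- by move=> j; exact: nnmM.
- exact: nnmM.
- apply: nearW => x; rewrite muleC; apply: cvgeZl => //.
  have : \forall j \near \oo, (rho x / w x <= j%:R)%R by exact: nbhs_infty_ger.
  move=> near1; apply: (@cvg_trans _ (((rho x)%:E : \bar R) @[_ --> \oo])); last exact: cvg_cst.
  apply: near_eq_cvg; apply: filterS near1 => j hj.
  by rewrite /ee; apply/esym/min_idPl; rewrite -EFinM lee_fin -ler_pdivrMr.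
- move=> j; apply: le_trans (apriori_integral admv _ (supee j) (_ : forall y, ee j y <= j%:R%:E * (w y)%:E)) _ => //.
    by move=> y; rewrite ge_min lexx orbT.
  apply: lee_wpmul2l => //; apply: nnm_le_integral; [exact: nnmM|exact: nnmM|] => x.
  by rewrite muleC; apply: lee_wpmul2r; [rewrite lee_fin|rewrite ge_min lexx].
- exact: cvg_cst.
Qed.

End semilinear.

End resolvent.

(** * Joint measurability of the paths *)

Section paths.
Context {R : realType} {E : pmetricType R}.
Hypothesis hE : locally_compact [set: E].
Hypothesis hsep : separable E.

Lemma closure_ball_ball (p y : E) (r s : R) : 0 < s -> closure (ball p r) y -> ball p (r + s) y.
Proof.
move=> s0 cy; have [z [pz yz]] := cy _ (nbhsx_ballx y _ s0).
by apply: ball_triangle pz _; apply: ball_sym.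
Qed.

(** Compact sets remain closed when the cemetery is adjoined, so membership in them passes to limits
    along a path. *)
Lemma countable_compact_base : exists K : nat -> set E,
  (forall i, compact (K i) /\ closed (K i)) /\
  forall U x, open U -> U x -> exists i, K i `<=` U /\ nbhs x (K i).
Proof.
have [D [cD dD]] := hsep.
have [p [_ Dp]] : setT `&` D !=set0 by apply: dD (@openT _); exists point.
have /countable_injP[e einj] := cD.
pose q (n : nat) := xget p [set x | D x /\ e x = n].
have qP x : D x -> q (e x) = x.
  move=> Dx; rewrite /q; case: xgetP => [y _ [Dy eyx]|/(_ x)]; last by case.
  by apply: einj => //; rewrite inE.
pose C (i j : nat) := closure (ball (q i) j.+1%:R^-1).
pose K (n : nat) := if unpickle n is Some (i, j) then
  (if pselect (compact (C i j)) then C i j else set0) else set0.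
exists K; split.
  move=> n; rewrite /K; case: (unpickle n) => [[i j]|]; last first.
    by split; [exact: compact0|exact: closed0].
  case: pselect => cij; last by split; [exact: compact0|exact: closed0].
  by split => //; exact: closed_closure.
move=> U x oU Ux.
have [W nW' [cW _]] := @hE x I.
have {nW'}nW : nbhs x W by move: nW'; rewrite /within /=; apply: filterS => y; exact.
have : nbhs x (U `&` W) by apply: filterI => //; exact: open_nbhs_nbhs.
move=> /nbhs_ballP[r /= r0 rUW].
have [j jr] : exists j : nat, j.+1%:R^-1 < r / 3.
  have r3 : 0 < r / 3 by rewrite divr_gt0.
  have [N _ NP] := near_infty_natSinv_lt (PosNum r3).
  by exists N; apply: (NP N) => /=.
have j0 : (0 : R) < j.+1%:R^-1 by rewrite invr_gt0.
have j20 : (0 : R) < j.+1%:R^-1 / 2 by rewrite divr_gt0.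
have [y [yx Dy]] : (ball x (j.+1%:R^-1 / 2))°  `&` D !=set0.
  apply: dD; last exact: open_interior.
  by exists x; exact: nbhsx_ballx.
have {}yx := interior_subset yx.
have Csub : C (e y) j `<=` ball x r.
  move=> z; rewrite /C qP // => cz.
  have /(ball_triangle yx) := closure_ball_ball j0 cz.
  apply: le_ball; move: jr j0; move: (j.+1%:R^-1) => t; lra.
exists (pickle (e y, j)); rewrite /K pickleK.
have cC : compact (C (e y) j).
  apply: (subclosed_compact _ cW); first exact: closed_closure.
  by move=> z /Csub /rUW[].
have -> : (if pselect (compact (C (e y) j)) then C (e y) j else set0) = C (e y) j.
  by case: pselect.
split; first by move=> z /Csub /rUW[].
rewrite /C qP //; apply: (@filterS _ _ _ (ball y j.+1%:R^-1)); first exact: subset_closure.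
apply/nbhs_ballP; exists (j.+1%:R^-1 / 2) => //= z xz.
by rewrite [X in ball _ X](splitr j.+1%:R^-1); apply: ball_triangle xz; exact: ball_sym.
Qed.

Variable XX : hunt_process E.

(** Paths are specified at nonnegative times only; clamping makes the map total in time. *)
Definition path_at (z : measurableTypeR R * Omega XX) : cem E := XX (Num.max z.1 0) z.2.

Lemma closed_some_compact (K : set E) : compact K -> closed K ->
  closed (Some @` K : set (cem E)).
Proof.
move=> cK clK; rewrite closedE => -[x|] h.
  have [Kx|nKx] := pselect (K x); first by exists x.
  exfalso; apply: h.
  have : nbhs x (~` K) by apply: open_nbhs_nbhs; split => //; exact: closed_openC.
  move/one_point_compactification_some_nbhs; apply: filterS.
  by move=> _ [y nKy <-] [z Kz [zy]]; apply: nKy; rewrite -zy.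
exfalso; apply: h; exists K; first by split.
by move=> _ [[y nKy <-]|->] [z Kz] // [zy]; apply: nKy; rewrite -zy.
Qed.

Lemma measurable_some_closed (K : set E) : compact K -> closed K ->
  measurable (Some @` K : set (Borel (cem E))).
Proof.
move=> cK clK; rewrite -[X in measurable X]setCK; apply: measurableC.
by apply: sub_sigma_algebra; apply: closed_openC; exact: closed_some_compact.
Qed.

Lemma measurable_path_at_closed (K : set E) (n : nat) : compact K -> closed K ->
  measurable [set z : measurableTypeR R * Omega XX |
    (Some @` K) (XX ((Num.truncn (n.+1%:R * Num.max z.1 0)).+1%:R / n.+1%:R) z.2)].
Proof.
move=> cK clK.
have -> : [set z : measurableTypeR R * Omega XX |
    (Some @` K) (XX ((Num.truncn (n.+1%:R * Num.max z.1 0)).+1%:R / n.+1%:R) z.2)] =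
  \bigcup_k ([set t : R | (k%:R <= n.+1%:R * Num.max t 0 < k.+1%:R)%R] `*`
              (XX (k.+1%:R / n.+1%:R) @^-1` (Some @` K))).
  apply/seteqP; split => [z /= h|z [k _ [/= h1 h2]]].
    exists (Num.truncn (n.+1%:R * Num.max z.1 0)) => //; split => //=.
    by apply: truncn_itv; rewrite mulr_ge0 // le_max lexx orbT.
  by rewrite (truncn_def h1).
apply: bigcupT_measurable => k; apply: measurableX.
  have mf : measurable_fun setT (fun t : R => n.+1%:R * Num.max t 0).
    by apply: measurable_funM => //; apply: measurable_maxr.
  have := mf measurableT _ (measurable_itv `[k%:R, k.+1%:R[).
  by rewrite setTI; congr measurable; apply/funext => t /=; rewrite in_itv.
rewrite -[X in measurable X]setTI.
by apply: X_meas => //; exact: measurable_some_closed.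
Qed.

(** The times [tn n z] tend to the current time from above, so by right-continuity the path is in
    [U] if and only if, for some compact [K i] inside [U], it is in [K i] at all [tn n z] with [n]
    large. At such a time the position is a step function of time. *)
Lemma measurable_path_at_open (U : set E) : open U ->
  measurable [set z : measurableTypeR R * Omega XX | (Some @` U) (path_at z)].
Proof.
move=> oU; have [K [cK KP]] := countable_compact_base.
pose tn (n : nat) (z : measurableTypeR R * Omega XX) : R :=
  (Num.truncn (n.+1%:R * Num.max z.1 0)).+1%:R / n.+1%:R.
have tn_gt n z : Num.max z.1 0 < tn n z.
  by rewrite ltr_pdivlMr // mulrC; exact: truncnS_gt.
have tn_cvg z : XX (tn n z) z.2 @[n --> \oo] --> path_at z.
  have z0 : 0 <= Num.max z.1 0 by rewrite le_max lexx orbT.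
  have h : tn n z @[n --> \oo] --> (Num.max z.1 0)^'+.
    move=> B /nbhs_ballP[e /= e0 eB].
    have := near_infty_natSinv_lt (PosNum e0); apply: filterS => n /= ne.
    apply: eB (tn_gt n z); rewrite /ball /= ltr0_norm ?subr_lt0 // opprB.
    apply: le_lt_trans ne; rewrite lerBlDr ler_pdivrMr // mulrDl mulVf //.
    have : (Num.truncn (n.+1%:R * Num.max z.1 0))%:R <= n.+1%:R * Num.max z.1 0.
      by rewrite truncn_le mulr_ge0.
    by rewrite -natr1; lra.
  apply: cvg_trans (@X_right _ _ XX z.2 _ z0) => B /= hB.
  exact: (h ((XX ^~ z.2) @^-1` B) hB).
pose I := [set i | K i `<=` U].
have -> : [set z : measurableTypeR R * Omega XX | (Some @` U) (path_at z)] =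
  \bigcup_(i in I) \bigcup_N \bigcap_(n in [set n | (N <= n)%N])
    [set z | (Some @` K i) (XX (tn n z) z.2)].
  apply/seteqP; split => [z [x Ux /= xz]|z [i KU [N _ zN]]].
    have [i [KU nK]] := KP _ _ oU Ux.
    exists i => //.
    have := one_point_compactification_some_nbhs _ _ nK; rewrite xz => /(tn_cvg z).
    by move=> [N _ NP]; exists N => // n /= Nn; exact: NP.
  suff : (Some @` K i) (path_at z) by apply: image_subset.
  have clK : closed (Some @` K i : set (cem E)).
    by have [] := cK i; exact: closed_some_compact.
  apply: clK => V /(tn_cvg z)[M _ MV].
  by exists (XX (tn (maxn N M) z) z.2); split;
    [apply: zN; exact: leq_maxl|apply: MV; exact: leq_maxr].
apply: bigcup_measurable => i _; apply: bigcupT_measurable => N.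
apply: bigcap_measurable; first by exists N => /=.
by move=> n _; apply: measurable_path_at_closed; have [] := cK i.
Qed.

Lemma measurable_path_at (B : set (Borel E)) : measurable B ->
  measurable [set z : measurableTypeR R * Omega XX | (Some @` B) (path_at z)].
Proof.
pose G : set (set E) := [set B | measurable [set z : measurableTypeR R * Omega XX | (Some @` B) (path_at z)]].
suff : <<s (@open E) >> `<=` G by move=> h /h.
apply: smallest_sub; last by move=> U oU; exact: measurable_path_at_open.
split.
- rewrite /G /= (_ : [set _ | _] = set0) //.
  by apply/seteqP; split => // z [].
- move=> B1 GB1; rewrite /G /=.
  rewrite (_ : [set _ | _] = [set z | (Some @` setT) (path_at z)] `\`
    [set z | (Some @` B1) (path_at z)]).
    by apply: measurableD => //; exact: measurable_path_at_open openT.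
  apply/seteqP; split => [z /= [x [_ nB1x] xz]|z /= [[x _ xz] nB1]].
    by split; [exists x|move=> [y B1y]; rewrite -xz => -[yx]; apply: nB1x; rewrite -yx].
  by exists x => //; split => // B1x; apply: nB1; exists x.
- move=> F GF; rewrite /G /=.
  rewrite (_ : [set _ | _] = \bigcup_i [set z | (Some @` F i) (path_at z)]).
    exact: bigcupT_measurable.
  apply/seteqP; split => [z /= [x [i _ Fx] xz]|z [i _ /= [x Fx xz]]].
    by exists i => //; exists x.
  by exists x => //; exists i.
Qed.

End paths.

(** * The transition kernel *)

Section kernel_pullback.
Context d1 d2 d3 (X : measurableType d1) (Y : measurableType d2) (Z : measurableType d3).
Variables (R : realType) (k : R.-spker Y ~> Z) (f : X -> Y).
Hypothesis mf : measurable_fun setT f.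

Definition kpull (_ : measurable_fun setT f) (x : X) : {measure set Z -> \bar R} := k (f x).

Lemma measurable_kpull U : measurable U -> measurable_fun setT (kpull mf ^~ U).
Proof. by move=> mU; exact: (measurableT_comp (measurable_kernel k _ mU)). Qed.

HB.instance Definition _ := isKernel.Build _ _ _ _ _ (kpull mf) measurable_kpull.

Lemma kpull_sub : (ereal_sup [set kpull mf x setT | x in setT] <= 1)%E.
Proof. by apply: ge_ereal_sup => _ [x _ <-]; exact: sprob_kernel_le1. Qed.

HB.instance Definition _ := Kernel_isSubProbability.Build _ _ _ _ _ (kpull mf) kpull_sub.

End kernel_pullback.

Section transition_kernel.
Context {R : realType} {E : pmetricType R}.
Hypothesis hE : locally_compact [set: E].
Hypothesis hsep : separable E.
Variable XX : hunt_process E.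
Local Open Scope ereal_scope.

Lemma measurable_some : measurable_fun [set: Borel E] (Some : Borel E -> Borel (cem E)).
Proof.
apply: (@measurability _ _ (Borel E) (Borel (cem E)) setT Some (@open (cem E)) erefl).
move=> _ [U oU <-]; rewrite setTI; apply: sub_sigma_algebra.
move: oU; apply: open_comp => x _.
exact: one_point_compactification_some_continuous.
Qed.

Let mstart : measurable_fun setT (Some \o fst : Borel E * measurableTypeR R -> Borel (cem E)).
Proof. exact: (measurableT_comp measurable_some measurable_fst). Qed.

Definition position (z : (Borel E * measurableTypeR R) * Omega XX) : {measure set (Borel E) -> \bar R} :=
  if path_at (z.1.2, z.2) is Some y then @dirac _ (Borel E) y R else mzero.

Lemma measurable_position U : measurable U -> measurable_fun setT (position ^~ U).
Proof.
move=> mU.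
have mS : measurable [set z : (Borel E * measurableTypeR R) * Omega XX | (Some @` U) (path_at (z.1.2, z.2))].
  rewrite -[X in measurable X]setTI.
  have mf : measurable_fun setT (fun z : (Borel E * measurableTypeR R) * Omega XX => (z.1.2, z.2)).
    apply: measurable_fun_pair => //.
    exact: (measurableT_comp measurable_snd measurable_fst).
  exact: (mf measurableT _ (measurable_path_at hE hsep mU)).
rewrite (_ : position ^~ U = EFin \o \1_[set z | (Some @` U) (path_at (z.1.2, z.2))]).
  by apply/measurable_EFinP; exact: measurable_indic.
apply/funext => z /=; rewrite /position indicE.
case py: (path_at (z.1.2, z.2)) => [y|]; last first.
  by rewrite memNset //= py => -[].
transitivity ((\1_U y)%:E : \bar R); first by [].
rewrite indicE; have [Uy|nUy] := pselect (U y).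
  by rewrite !mem_set //= py; exists y.
by rewrite !memNset //= py => -[x Ux [xy]]; apply: nUy; rewrite -xy.
Qed.

HB.instance Definition _ := isKernel.Build _ _ _ _ _ position measurable_position.

Lemma position_sub : ereal_sup [set position z [set: Borel E] | z in setT] <= 1.
Proof.
apply: ge_ereal_sup => _ [z _ <-]; rewrite /position.
by case: path_at => [y|] /=; [rewrite diracT|rewrite /mzero].
Qed.

HB.instance Definition _ := Kernel_isSubProbability.Build _ _ _ _ _ position position_sub.

Definition transition0 (z : Borel E * measurableTypeR R) : {measure set (Borel E) -> \bar R} :=
  (kpull (pr XX) mstart \; position) z.

HB.instance Definition _ := isKernel.Build _ _ _ _ _ transition0
  (measurable_kernel (kpull (pr XX) mstart \; position)).

Lemma transition_sub : ereal_sup [set transition0 z [set: Borel E] | z in setT] <= 1.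
Proof.
apply: ge_ereal_sup => _ [z _ <-]; rewrite /transition0 /= /mkcomp /kcomp.
apply: (@le_trans _ _ (\int[kpull (pr XX) mstart z]_w 1)).
  apply: ge0_le_integral => //.
    apply: (measurableT_comp (measurable_kernel position _ measurableT)).
    exact: measurable_fun_pair.
  by move=> w _; exact: sprob_kernel_le1.
by rewrite integral_cst // mul1e; exact: sprob_kernel_le1.
Qed.

HB.instance Definition _ := Kernel_isSubProbability.Build _ _ _ _ _ transition0 transition_sub.

(** The time is an argument of the kernel, so that it can be integrated out. *)
Definition transition : R.-spker (Borel E * measurableTypeR R) ~> Borel E := transition0.

Lemma transition_Pt (t : R) (h : E -> \bar R) (x : E) : (0 <= t)%R ->
  @nnm _ (Borel E) R h -> \int[transition (x, t)]_y h y = Pt XX t h x.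
Proof.
move=> t0 [mh h0].
rewrite /transition /= /transition0 integral_kcomp //.
rewrite /Pt; transitivity (\int[pr XX (Some x)]_w \int[position ((x, t), w)]_z h z); first by [].
apply: eq_integral => w _; rewrite /position /path_at /= max_l //.
case: (XX t w) => [y|] /=; first by rewrite integral_dirac // diracT mul1e.
by rewrite integral_measure_zero.
Qed.

Lemma measurable_some_image (B : set (Borel E)) : measurable B ->
  measurable (Some @` B : set (Borel (cem E))).
Proof.
pose F : set (set E) := [set B | measurable (Some @` B : set (Borel (cem E)))].
suff : <<s (@open E) >> `<=` F by move=> h /h.
have openF : @open E `<=` F.
  move=> U oU; apply: sub_sigma_algebra.
  exact: one_point_compactification_open_some.
apply: smallest_sub => //; split.
- by rewrite /F /= image_set0.
- move=> C FC; rewrite /F /=.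
  rewrite (_ : Some @` _ = Some @` setT `\` Some @` C).
    by apply: measurableD => //; exact: openF openT.
  apply/seteqP; split => [_ [x [_ nC] <-]|_ [[x _ <-] nC]].
    by split; [exists x|move=> [y Cy [yx]]; apply: nC; rewrite -yx].
  by exists x => //; split => // Cx; apply: nC; exists x.
- by move=> C FC; rewrite /F /= image_bigcup; exact: bigcupT_measurable.
Qed.

Lemma transition_set (t : R) (x : E) (B : set (Borel E)) : (0 <= t)%R -> measurable B ->
  transition (x, t) B = pr XX (Some x) (XX t @^-1` (Some @` B)).
Proof.
move=> t0 mB.
have mXB : measurable (XX t @^-1` (Some @` B)).
  by rewrite -[X in measurable X]setTI; apply: X_meas => //; exact: measurable_some_image.
have nB : @nnm _ (Borel E) R (fun y => (\1_B y)%:E).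
  split; last by move=> y; rewrite lee_fin.
  by apply/measurable_EFinP; exact: measurable_indic.
transitivity (\int[transition (x, t)]_y (\1_B y)%:E).
  by rewrite integral_indic // setIT.
rewrite transition_Pt // /Pt.
transitivity (\int[pr XX (Some x)]_w (\1_(XX t @^-1` (Some @` B)) w)%:E); last first.
  by rewrite integral_indic // setIT.
apply: eq_integral => w _; rewrite [in RHS]indicE; case xw : (XX t w) => [y|] /=; last first.
  by rewrite memNset //= xw => -[].
rewrite indicE; have [By|nBy] := pselect (B y).
  by rewrite !mem_set //= xw; exists y.
by rewrite !memNset //= xw => -[z Bz [zy]]; apply: nBy; rewrite -zy.
Qed.

Lemma cemetery_absorbing (t : R) (B : set (Borel E)) : (0 <= t)%R -> measurable B ->
  pr XX None (XX t @^-1` (Some @` B)) = 0.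
Proof.
move=> t0 mB.
have mN : measurable [set w | XX 0%R w = None].
  have -> : [set w | XX 0%R w = None] = ~` (XX 0%R @^-1` (Some @` setT)).
    apply/seteqP; split => [w /= -> [x]|w /= nx] //.
    by case xw: (XX 0%R w) => [y|] //; exfalso; apply: nx; exists y.
  apply: measurableC; rewrite -[X in measurable X]setTI.
  by apply: X_meas => //; exact: measurable_some_image.
have mXB : measurable (XX t @^-1` (Some @` B)).
  by rewrite -[X in measurable X]setTI; apply: X_meas => //; exact: measurable_some_image.
apply/eqP; rewrite eq_le measure_ge0 andbT.
apply: (@le_trans _ _ (pr XX None (~` [set w | XX 0%R w = None]))).
  apply: le_measure; rewrite ?inE //; first exact: measurableC.
  by move=> w [x Bx xw] w0; have := X_trap (lexx 0%R) t0 w0; rewrite -xw.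
have p1 : pr XX None setT = 1 by exact: prob_kernel.
rewrite -setTD measureD //; last by rewrite [X in X < _]p1 ltry.
have p0 : pr XX None [set w | XX 0%R w = None] = 1 by exact: X_normal.
rewrite setTI; change (pr XX None setT - pr XX None [set w | XX 0%R w = None] <= 0).
by rewrite p1 p0 subee.
Qed.

Let slice (t : R) : measurable_fun setT (fun x : Borel E => (x, t : measurableTypeR R)).
Proof. exact: measurable_fun_pair. Qed.

Let slice2 (t : R) : measurable_fun setT (fun z : Borel E * Borel E => (z.2, t : measurableTypeR R)).
Proof. exact: measurable_fun_pair. Qed.

(** The strong Markov property at the constant time [s]. *)
Lemma transition_semigroup (s t : R) (h : E -> \bar R) (x : E) : (0 <= s)%R -> (0 <= t)%R ->
  @nnm _ (Borel E) R h ->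
  \int[transition (x, s)]_y \int[transition (y, t)]_z h z = \int[transition (x, s + t)%R]_z h z.
Proof.
move=> s0 t0 [mh h0].
transitivity (\int[kcomp (kpull transition (@slice s)) (kpull transition (@slice2 t)) x]_z h z).
  by symmetry; exact: (integral_kcomp (kpull transition (@slice s))
    (kpull transition (@slice2 t)) x h0 mh).
apply: eq_measure_integral => B mB _; rewrite /kcomp /kpull.
transitivity (\int[transition (x, s)]_y transition (y, t) B); first by [].
rewrite transition_Pt //; last first.
  split => //; exact: (measurable_kernel (kpull transition (@slice t)) _ mB).
have [F [hF _ strongM _]] := X_filtration XX.
rewrite transition_set ?addr_ge0 //.
have mB' := measurable_some_image mB.
have st : stopping_time F (fun=> s%:E).
  split=> [w|r r0]; first by rewrite lee_fin.
  have [sF _ _] := filt_sigma hF r0.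
  have [sr|sr] := leP s r.
    rewrite (_ : [set _ | _] = setT `\` set0).
      by have [_ + _] := filt_sigma hF r0; apply.
    by rewrite setD0; apply/seteqP; split => // w _ /=; rewrite lee_fin.
  rewrite (_ : [set _ | _] = set0) //.
  by apply/seteqP; split => // w /=; rewrite lee_fin leNgt sr.
have := strongM _ st (Some x) t _ setT t0 mB'.
rewrite setTI /= => ->; last first.
  by split => // r r0; rewrite setTI; exact: st.2.
apply: eq_integral => w _; case: (XX s w) => [y|] /=; last by rewrite cemetery_absorbing.
by rewrite transition_set.
Qed.
End transition_kernel.

(** * Integration in time *)

Section sfinite_pack.
Context d (X : measurableType d) (R : realType) (mu : {measure set X -> \bar R}).

(** A copy of [mu] that carries the structure given by the assumption. *)
Definition with_sfinite (_ : sfinite_measure mu) : set X -> \bar R := mu.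

Hypothesis smu : sfinite_measure mu.
HB.instance Definition _ := Measure.on (with_sfinite smu).
HB.instance Definition _ := isSFinite.Build _ _ _ (with_sfinite smu) smu.
End sfinite_pack.

Section tonelli.
Context d1 d2 (X : measurableType d1) (Y : measurableType d2) (R : realType).
Local Open Scope ereal_scope.

Lemma tonelli (mu : {measure set X -> \bar R}) (nu : {measure set Y -> \bar R})
    (f : X -> Y -> \bar R) : sfinite_measure mu -> sfinite_measure nu ->
  measurable_fun setT (fun z : X * Y => f z.1 z.2) -> (forall x y, 0 <= f x y) ->
  \int[mu]_x \int[nu]_y f x y = \int[nu]_y \int[mu]_x f x y.
Proof.
move=> smu snu mf f0.
exact: (sfinite_Fubini (with_sfinite smu) (with_sfinite snu) (fun z => f z.1 z.2)).
Qed.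

End tonelli.

Section lebesgue_shift.
Context (R : realType).
Local Open Scope ereal_scope.
Local Notation leb := (@lebesgue_measure R).

Lemma lebesgue_shift (s : R) (f : R -> \bar R) : measurable_fun setT f ->
  (forall t, 0 <= f t) -> \int[leb]_t f (s + t)%R = \int[leb]_t f t.
Proof.
move=> mf f0.
have ms : measurable_fun setT (fun t : measurableTypeR R => (s + t)%R : measurableTypeR R).
  by apply: measurable_funD.
transitivity (\int[pushforward leb (fun t : measurableTypeR R => (s + t)%R : measurableTypeR R)]_t f t).
  by rewrite ge0_integral_pushforward.
apply: eq_measure_integral => B mB _; symmetry; apply: lebesgue_measure_unique mB.
move=> _ [[a b] _ <-] /=; rewrite /pushforward.
have -> : (fun t : R => (s + t)%R) @^-1` `]a, b] = `](a - s)%R, (b - s)%R]%classic.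
  by apply/seteqP; split => t /=; rewrite !in_itv /= => /andP[? ?]; apply/andP; split; lra.
rewrite !lebesgue_measure_itv /= !lte_fin ltrD2r.
by case: ifP => // _; rewrite -!EFinB; congr _%:E; lra.
Qed.

Lemma integral_expR (c r : R) : (0 < c)%R -> (0 <= r)%R ->
  c%:E * \int[leb]_t (if (0 <= t <= r)%R then expR (- (c * t)) else 0%R)%:E =
  (1 - expR (- (c * r)))%:E.
Proof.
move=> c0; rewrite le_eqVlt => /predU1P[<-|r0].
  rewrite mulr0 oppr0 expR0 subrr.
  rewrite (_ : (fun _ => _) = (fun t => (\1_[set 0%R] t)%:E)).
    rewrite integral_indic // setIT.
    transitivity (c%:E * leb [set 0%R]); first by [].
    by rewrite lebesgue_measure_set1 mule0.
  apply/funext => t; rewrite -eq_le indicE.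
  have [<-|t0] := eqVneq 0%R t; first by rewrite mem_set // mulr0 oppr0 expR0.
  by rewrite memNset //= => /esym/eqP; rewrite (negbTE t0).
rewrite -mulNr EFinB -(exponential_prob_itv0c c r0) /exponential_prob.
rewrite -ge0_integralZl //; last 3 first.
- apply/measurable_EFinP; apply: measurable_fun_ifT => //.
  - apply: measurable_and; first exact: measurable_fun_ler.
    exact: measurable_fun_ler.
  - by apply: (measurableT_comp (@measurable_expR R)); apply: measurableT_comp.
- by move=> t _; case: ifP => _; rewrite lee_fin // expR_ge0.
- by rewrite lee_fin ltW.
rewrite [RHS]integral_mkcond; apply: eq_integral => t _; rewrite patchE.
case: ifPn => tr.
  rewrite mem_set /= ?in_itv //.
  by rewrite exponential_pdfE ?mulNr //; case/andP: tr.
by rewrite memNset /= ?in_itv ?(negbTE tr) // mule0.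
Qed.
End lebesgue_shift.

(** * The resolvent of a semigroup of kernels *)

Section constant_kernel.
Context d1 d2 (X : measurableType d1) (Y : measurableType d2) (R : realType).
Variable mu : {finite_measure set Y -> \bar R}.

Definition kcst_finite (_ : X) : {measure set Y -> \bar R} := mu.

Lemma measurable_kcst_finite U : measurable U -> measurable_fun setT (kcst_finite ^~ U).
Proof. by move=> mU; exact: measurable_cst. Qed.

HB.instance Definition _ := isKernel.Build _ _ _ _ _ kcst_finite measurable_kcst_finite.

Lemma kcst_finite_uub : measure_fam_uub kcst_finite.
Proof.
exists (fine (mu setT) + 1) => x; rewrite -[ltLHS]fineK ?fin_num_measure //.
by rewrite lte_fin ltrDl.
Qed.

HB.instance Definition _ := Kernel_isFinite.Build _ _ _ _ _ kcst_finite kcst_finite_uub.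

End constant_kernel.

Section sfinite_constant_kernel.
Context d1 d2 (X : measurableType d1) (Y : measurableType d2) (R : realType).
Variable mu : {sfinite_measure set Y -> \bar R}.

Definition kcst (_ : X) : {measure set Y -> \bar R} := mu.

Lemma measurable_kcst U : measurable U -> measurable_fun setT (kcst ^~ U).
Proof. by move=> mU; exact: measurable_cst. Qed.

HB.instance Definition _ := isKernel.Build _ _ _ _ _ kcst measurable_kcst.

Lemma sfinite_kcst : exists s : (R.-fker X ~> Y)^nat,
  forall x U, measurable U -> kcst x U = kseries s x U.
Proof.
exists (fun n => @kcst_finite _ _ X _ R (sfinite_measure_seq mu n)) => x U mU.
exact: (sfinite_measure_seqP mu mU).
Qed.

HB.instance Definition _ := Kernel_isSFinite.Build _ _ _ _ _ kcst sfinite_kcst.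

End sfinite_constant_kernel.
Arguments kcst {d1 d2} X {Y R} mu.

Section laplace.
Context d (E : measurableType d) (R : realType).
Variable p : R.-spker (E * measurableTypeR R) ~> E.
Local Notation leb := (@lebesgue_measure R).
Local Notation nnm := (@nnm _ E R).

(** The discount of a Laplace transform; clamping [a] at 0 keeps the discounted kernel
    subprobability for every index. *)
Definition wt (a t : R) : R := if (0 <= t)%R then expR (- (Num.max a 0 * t)) else 0%R.

Lemma wt_ge0 a t : (0 <= wt a t)%R.
Proof. by rewrite /wt; case: ifP => // _; exact: expR_ge0. Qed.

Lemma wt_le1 a t : (wt a t <= 1)%R.
Proof.
rewrite /wt; case: ifP => // t0; rewrite -expR0 ler_expR oppr_le0 mulr_ge0 //.
by rewrite le_max lexx orbT.
Qed.

Lemma measurable_wt a : measurable_fun setT (wt a).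
Proof.
apply: measurable_fun_ifT => //; first exact: measurable_fun_ler.
by apply: (measurableT_comp (@measurable_expR R)); apply: measurableT_comp.
Qed.

Local Open Scope ereal_scope.

Definition killed (a : R) (z : E * measurableTypeR R) : {measure set E -> \bar R} :=
  mscale (NngNum (wt_ge0 a z.2)) (p z).

Lemma measurable_killed a U : measurable U -> measurable_fun setT (killed a ^~ U).
Proof.
move=> mU; apply: emeasurable_funM; last exact: measurable_kernel.
by apply/measurable_EFinP; exact: (measurableT_comp (measurable_wt a) measurable_snd).
Qed.

HB.instance Definition _ a := isKernel.Build _ _ _ _ _ (killed a) (measurable_killed a).

Lemma killed_sub a : ereal_sup [set killed a z setT | z in setT] <= 1.
Proof.
apply: ge_ereal_sup => _ [z _ <-]; rewrite /killed /mscale /= -[leRHS]mule1.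
change ((wt a z.2)%:E * p z setT <= 1 * 1).
by apply: lee_pmul; rewrite ?lee_fin ?wt_ge0 ?wt_le1 ?sprob_kernel_le1.
Qed.

HB.instance Definition _ a := Kernel_isSubProbability.Build _ _ _ _ _ (killed a) (killed_sub a).

Definition resolvent (a : R) : E -> {measure set E -> \bar R} := mkcomp (kcst E leb) (killed a).

Local Notation V := resolvent.
Local Notation rpot := (rpot V).

Definition Q (t : R) (h : E -> \bar R) (x : E) : \bar R := \int[p (x, t)]_y h y.

Lemma Q_ge0 t h x : nnm h -> 0 <= Q t h x.
Proof. by move=> [_ h0]; exact: integral_ge0. Qed.

Lemma measurable_Q2 h : nnm h -> measurable_fun setT (fun z : E * measurableTypeR R => Q z.2 h z.1).
Proof.
move=> [mh h0]; have := measurable_fun_integral_kernel (measurable_kernel p) h0 mh.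
by apply: eq_measurable_fun => -[x t] _.
Qed.

Lemma measurable_Q t h : nnm h -> measurable_fun setT (Q t h).
Proof.
move=> nh; apply: (measurableT_comp (measurable_Q2 nh) (_ : measurable_fun setT (fun x => (x, t)))).
exact: measurable_fun_pair.
Qed.

Lemma measurable_Qt x h : nnm h -> measurable_fun setT (fun t : measurableTypeR R => Q t h x).
Proof.
move=> nh.
apply: (measurableT_comp (measurable_Q2 nh) (_ : measurable_fun setT (fun t => (x, t)))).
exact: measurable_fun_pair.
Qed.

Lemma rpotE a h x : nnm h -> rpot a h x = \int[leb]_t ((wt a t)%:E * Q t h x).
Proof.
move=> [mh h0]; transitivity (\int[leb]_t \int[killed a (x, t)]_y h y).
  exact: (integral_kcomp (kcst E leb) (killed a) x h0 mh).
by apply: eq_integral => t _; rewrite /killed ge0_integral_mscale.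
Qed.

Hypothesis Qsg : forall (s t : R) h x, (0 <= s)%R -> (0 <= t)%R -> nnm h ->
  Q s (Q t h) x = Q (s + t)%R h x.

Lemma nnm_rpotV a h : nnm h -> nnm (rpot a h).
Proof.
move=> nh; have [mh h0] := nh; split; last by move=> x; apply: integral_ge0.
exact: (measurable_fun_integral_kernel (measurable_kernel (mkcomp (kcst E leb) (killed a))) h0 mh).
Qed.

Lemma nnm_Q t h : nnm h -> nnm (Q t h).
Proof. by move=> nh; split; [exact: measurable_Q|move=> x; exact: Q_ge0]. Qed.

Lemma Q_rpot (a s : R) h x : (0 <= s)%R -> nnm h ->
  Q s (rpot a h) x = \int[leb]_t ((wt a t)%:E * Q (s + t)%R h x).
Proof.
move=> s0 nh.
rewrite /Q; under eq_integral do rewrite rpotE //.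
rewrite (tonelli (mu := p (x, s)) (nu := leb) (f := fun y t => (wt a t)%:E * Q t h y)).
- apply: eq_integral => t _; have [t0|t0] := leP 0%R t; last first.
    rewrite /wt leNgt t0 /= mul0e; apply: integral0_eq => y _; exact: mul0e.
  rewrite ge0_integralZl //; last 3 first.
  - exact: measurable_Q.
  - by move=> y _; exact: Q_ge0.
  - by rewrite lee_fin wt_ge0.
  by congr (_ * _); exact: Qsg.
- exact: sfinite_kernel_measure.
- exact: s_finite.
- apply: emeasurable_funM.
    by apply/measurable_EFinP; exact: (measurableT_comp (measurable_wt a) measurable_snd).
  exact: measurable_Q2.
- by move=> y t; rewrite mule_ge0 ?lee_fin ?wt_ge0 ?Q_ge0.
Qed.

Lemma rpot_rpot (a b : R) h x : nnm h -> rpot a (rpot b h) x =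
  \int[leb]_s \int[leb]_t ((wt a s * wt b t)%:E * Q (s + t)%R h x).
Proof.
move=> nh; rewrite (rpotE _ _ (nnm_rpotV b nh)).
apply: eq_integral => s _; have [s0|s0] := leP 0%R s; last first.
  rewrite /wt (leNgt 0%R s) s0 /= mul0e integral0_eq // => t _.
  by rewrite mul0r mul0e.
rewrite Q_rpot // -ge0_integralZl //.
- by apply: eq_integral => t _; rewrite EFinM muleA.
- apply: emeasurable_funM; first by apply/measurable_EFinP; exact: measurable_wt.
  apply: (measurableT_comp (measurable_Qt x nh) (_ : measurable_fun setT (fun t => (s + t)%R))).
  by apply: measurable_funD.
- by move=> t _; rewrite mule_ge0 ?lee_fin ?wt_ge0 ?Q_ge0.
- by rewrite lee_fin wt_ge0.
Qed.

Lemma measurable_wt2 a b : measurable_fun setT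
  (fun z : measurableTypeR R * measurableTypeR R => (wt a z.1 * wt b (z.2 - z.1))%R).
Proof.
apply: measurable_funM; first exact: (measurableT_comp (measurable_wt a) measurable_fst).
apply: (measurableT_comp (measurable_wt b)); apply: measurable_funB;
  [exact: measurable_snd|exact: measurable_fst].
Qed.

(** The resolvent equation at the level of the discounts. *)
Lemma wt_convolution (a b r : R) : (0 <= a)%R -> (a < b)%R ->
  (b - a)%:E * \int[leb]_s (wt b s * wt a (r - s))%:E = (wt a r - wt b r)%:E.
Proof.
move=> a0 ab; have b0 : (0 <= b)%R by rewrite ltW // (le_lt_trans a0).
have ba0 : (0 < b - a)%R by rewrite subr_gt0.
have [r0|r0] := leP 0%R r; last first.
  rewrite integral0_eq ?mule0 => [|s _]; last first.
    rewrite /wt; case: leP => s0; rewrite ?mul0r //; case: leP; rewrite ?mulr0 // => ?.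
    by exfalso; lra.
  by rewrite /wt leNgt r0 /= subrr.
transitivity ((expR (- (a * r)))%:E * ((b - a)%:E *
    \int[leb]_t (if (0 <= t <= r)%R then expR (- ((b - a) * t)) else 0%R)%:E)).
  rewrite muleCA; congr (_ * _); rewrite -ge0_integralZl //.
  - apply: eq_integral => s _; rewrite /wt subr_ge0 (max_l a0) (max_l b0).
    rewrite -EFinM; congr _%:E.
    case: (leP 0%R s) => s0 /=; rewrite ?mul0r ?mulr0 //.
    case: (leP s r) => sr /=; rewrite ?mulr0 //.
    by rewrite -!expRD; congr expR; ring.
  - apply/measurable_EFinP; apply: measurable_fun_ifT => //.
    + by apply: measurable_and; exact: measurable_fun_ler.
    + by apply: (measurableT_comp (@measurable_expR R)); apply: measurableT_comp.
  - by move=> s _; case: ifP => _; rewrite lee_fin // expR_ge0.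
rewrite integral_expR // -EFinM; congr _%:E.
rewrite /wt r0 (max_l a0) (max_l b0) mulrBr mulr1 -expRD; congr (_ - expR _)%R; ring.
Qed.

Lemma rpotC (a b : R) h x : nnm h -> rpot a (rpot b h) x = rpot b (rpot a h) x.
Proof.
move=> nh; rewrite (rpot_rpot a b _ nh) (rpot_rpot b a _ nh).
pose f (s t : measurableTypeR R) := (wt a s * wt b t)%:E * Q (s + t)%R h x.
have mf : measurable_fun setT (fun z : measurableTypeR R * measurableTypeR R => f z.1 z.2).
  apply: emeasurable_funM.
    apply/measurable_EFinP; apply: measurable_funM.
      exact: (measurableT_comp (measurable_wt a) measurable_fst).
    exact: (measurableT_comp (measurable_wt b) measurable_snd).
  apply: (measurableT_comp (measurable_Qt x nh)).
  by apply: measurable_funD; [exact: measurable_fst|exact: measurable_snd].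
have f0 s t : 0 <= f s t by rewrite mule_ge0 ?Q_ge0 // lee_fin mulr_ge0 ?wt_ge0.
apply: (etrans (tonelli (s_finite leb) (s_finite leb) mf f0)).
by apply: eq_integral => s _; apply: eq_integral => t _; rewrite /f mulrC (addrC t).
Qed.

(** A translation in time and Tonelli turn the composition into a convolution of the discounts. *)
Lemma resolvent_equation (a b : R) h x : (0 <= a)%R -> (a < b)%R -> nnm h ->
  rpot a h x = rpot b h x + (b - a)%:E * rpot b (rpot a h) x.
Proof.
move=> a0 ab nh.
have ba0 : (0 < b - a)%R by rewrite subr_gt0.
have mQ := measurable_Qt x nh.
have Q0 t : 0 <= Q t h x by exact: Q_ge0.
have -> : rpot b (rpot a h) x =
    \int[leb]_r (\int[leb]_s (wt b s * wt a (r - s))%:E * Q r h x).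
  rewrite rpot_rpot //.
  transitivity (\int[leb]_s \int[leb]_r ((wt b s * wt a (r - s))%:E * Q r h x)).
    apply: eq_integral => s _.
    rewrite -(lebesgue_shift s (f := fun r => (wt b s * wt a (r - s))%:E * Q r h x)).
    - by apply: eq_integral => t _; rewrite addrAC subrr add0r.
    - apply: emeasurable_funM => //; apply/measurable_EFinP; apply: measurable_funM => //.
      by apply: (measurableT_comp (measurable_wt a)); apply: measurable_funB.
    - by move=> t; rewrite mule_ge0 // lee_fin mulr_ge0 ?wt_ge0.
  pose f (s r : measurableTypeR R) := (wt b s * wt a (r - s))%:E * Q r h x.
  have mf : measurable_fun setT (fun z : measurableTypeR R * measurableTypeR R => f z.1 z.2).
    apply: emeasurable_funM; first by apply/measurable_EFinP; exact: measurable_wt2.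
    exact: (measurableT_comp mQ measurable_snd).
  have f0 s r : 0 <= f s r by rewrite mule_ge0 // lee_fin mulr_ge0 ?wt_ge0.
  apply: (etrans (tonelli (s_finite leb) (s_finite leb) mf f0)).
  apply: eq_integral => r _; rewrite /f ge0_integralZr //.
  - apply/measurable_EFinP.
    apply: (measurableT_comp (measurable_wt2 b a) (_ : measurable_fun setT (fun s => (s, r)))).
    exact: measurable_fun_pair.
  - by move=> s _; rewrite lee_fin mulr_ge0 ?wt_ge0.
have mW : measurable_fun setT (fun r : measurableTypeR R => (wt a r - wt b r)%:E).
  by apply/measurable_EFinP; apply: measurable_funB; exact: measurable_wt.
have W0 r : (wt b r <= wt a r)%R.
  rewrite /wt; case: ifP => // r0; rewrite ler_expR lerN2 ler_wpM2r //.
  by rewrite (max_l a0) max_l ?ltW // (le_lt_trans a0).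
have EW r : (b - a)%:E * (\int[leb]_s (wt b s * wt a (r - s))%:E * Q r h x) =
    (wt a r - wt b r)%:E * Q r h x by rewrite muleA wt_convolution.
rewrite -ge0_integralZl //; last 3 first.
- rewrite (_ : (fun _ => _) =
      (fun r => (b - a)^-1%:E * ((wt a r - wt b r)%:E * Q r h x))).
    by apply: measurable_funeM; apply: emeasurable_funM.
  by apply/funext => r; rewrite -EW muleA -EFinM mulVf ?mul1e // gt_eqF.
- move=> r _; rewrite mule_ge0 // integral_ge0 // => s _.
  by rewrite lee_fin mulr_ge0 ?wt_ge0.
- by rewrite lee_fin ltW.
under [X in _ + X]eq_integral do rewrite EW.
rewrite (rpotE b _ nh) -ge0_integralD //; last 4 first.
- by move=> t _; rewrite mule_ge0 // lee_fin wt_ge0.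
- by apply: emeasurable_funM => //; apply/measurable_EFinP; exact: measurable_wt.
- by move=> t _; rewrite mule_ge0 // lee_fin subr_ge0.
- exact: emeasurable_funM.
rewrite rpotE //; apply: eq_integral => t _.
rewrite -ge0_muleDl ?lee_fin ?wt_ge0 ?subr_ge0 //.
by rewrite -EFinD addrCA subrr addr0.
Qed.

Lemma rpot_cvg0 h x : nnm h -> rpot n.+1%:R^-1 h x @[n --> \oo] --> rpot 0 h x.
Proof.
move=> nh; have mQ := measurable_Qt x nh.
have Q0 t : 0 <= Q t h x by exact: Q_ge0.
rewrite (_ : (fun n : nat => _) =
  (fun n => \int[leb]_t ((wt n.+1%:R^-1 t)%:E * Q t h x))); last first.
  by apply/funext => n; rewrite rpotE.
rewrite rpotE //.
have wcvg t : (wt n.+1%:R^-1 t)%:E * Q t h x @[n --> \oo] --> (wt 0 t)%:E * Q t h x.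
  have [t0|t0] := leP 0%R t; last first.
    under eq_fun do rewrite /wt leNgt t0 /= mul0e.
    by rewrite /wt leNgt t0 /= mul0e; exact: cvg_cst.
  have w0 (a : R) : (0 < wt a t)%R by rewrite /wt t0 expR_gt0.
  have := Q0 t; case: (Q t h x) => [q _|_|//]; last first.
    under eq_fun do rewrite gt0_muley ?lte_fin ?w0 //.
    by rewrite gt0_muley ?lte_fin ?w0 //; exact: cvg_cst.
  under eq_fun do rewrite -EFinM; rewrite -EFinM.
  apply: cvg_EFin; first exact: nearW.
  rewrite /= [X in X @ _](_ : _ = (fun n => wt n.+1%:R^-1 t * q)%R) //.
  apply: cvgMr_tmp; rewrite /wt t0 maxxx mul0r oppr0.
  under eq_fun do rewrite max_l //.
  have ht : (- (n.+1%:R^-1 * t))%R @[n --> \oo] --> 0%R.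
    by rewrite -[X in _ --> X](@oppr0 R) -(mul0r t); apply: cvgN; apply: cvgMr_tmp; exact: cvg_harmonic.
  exact: (cvg_comp _ _ ht (@continuous_expR R 0%R)).
rewrite [X in _ --> X](_ : _ =
  \int[leb]_t (limn (fun n => (wt n.+1%:R^-1 t)%:E * Q t h x))); last first.
  by apply: eq_integral => t _; symmetry; apply/cvg_lim.
apply: cvg_monotone_convergence => //.
- by move=> n; apply: emeasurable_funM => //; apply/measurable_EFinP; exact: measurable_wt.
- by move=> n t _; rewrite mule_ge0 // lee_fin wt_ge0.
- move=> t _ m n mn; apply: lee_wpmul2r => //; rewrite lee_fin.
  rewrite /wt; case: ifP => // t0.
  rewrite ler_expR lerN2 ler_wpM2r // !max_l // lef_pV2 ?posrE //.
  by rewrite ler_nat.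
Qed.

Variable m : {measure set E -> \bar R}.
Hypothesis sm : sfinite_measure m.
Hypothesis Qsym : forall (t : R) h k, (0 <= t)%R -> nnm h -> nnm k ->
  \int[m]_x (k x * Q t h x) = \int[m]_x (h x * Q t k x).

Lemma integral_rpotE a h k : nnm h -> nnm k -> \int[m]_x (k x * rpot a h x) =
  \int[leb]_t ((wt a t)%:E * \int[m]_x (k x * Q t h x)).
Proof.
move=> nh [mk k0].
transitivity (\int[m]_x \int[leb]_t ((wt a t)%:E * (k x * Q t h x))).
  apply: eq_integral => x _; rewrite rpotE // -ge0_integralZl //.
  - by apply: eq_integral => t _; rewrite muleCA.
  - apply: emeasurable_funM; last exact: measurable_Qt.
    by apply/measurable_EFinP; exact: measurable_wt.
  - by move=> t _; rewrite mule_ge0 ?lee_fin ?wt_ge0 ?Q_ge0.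
pose f x (t : measurableTypeR R) := (wt a t)%:E * (k x * Q t h x).
have mf : measurable_fun setT (fun z : E * measurableTypeR R => f z.1 z.2).
  apply: emeasurable_funM.
    by apply/measurable_EFinP; exact: (measurableT_comp (measurable_wt a) measurable_snd).
  apply: emeasurable_funM; last exact: measurable_Q2.
  exact: (measurableT_comp mk measurable_fst).
have f0 x t : 0 <= f x t by rewrite mule_ge0 ?lee_fin ?wt_ge0 // mule_ge0 ?Q_ge0.
apply: (etrans (tonelli sm (s_finite leb) mf f0)).
apply: eq_integral => t _; rewrite /f ge0_integralZl //.
- by apply: emeasurable_funM => //; exact: measurable_Q.
- by move=> x _; rewrite mule_ge0 ?Q_ge0.
- by rewrite lee_fin wt_ge0.
Qed.

Lemma sym_resolvent_resolvent : sym_resolvent m V.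
Proof.
split.
- by move=> a h _ /(nnm_rpotV a)[].
- by move=> a b h x a0 ab nh; exact: resolvent_equation.
- by move=> a b h x a0 ab nh; rewrite rpotC //; exact: resolvent_equation.
- move=> a h k a0 nh nk; rewrite (integral_rpotE a nh nk) (integral_rpotE a nk nh).
  apply: eq_integral => t _; have [t0|t0] := leP 0%R t; first by rewrite Qsym.
  by rewrite /wt leNgt t0 /= !mul0e.
- exact: rpot_cvg0.
Qed.
End laplace.

(** * Self-adjointness of the semigroup *)

Section borel_ae.
Context {R : realType} {E : pmetricType R}.
Variable m : {measure set (Borel E) -> \bar R}.
Implicit Types P Q S : E -> Prop.

Lemma ae_impl P Q : (forall x, P x -> Q x) -> (\forall x \ae m, P x) -> \forall x \ae m, Q x.
Proof. by move=> PQ; exact: (@filterS (Borel E) _ (ae_filter_ringOfSetsType m) P Q PQ). Qed.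

Lemma ae_impl2 P Q S : (forall x, P x -> Q x -> S x) ->
  (\forall x \ae m, P x) -> (\forall x \ae m, Q x) -> \forall x \ae m, S x.
Proof. by move=> PQ; exact: (@filterS2 (Borel E) _ (ae_filter_ringOfSetsType m) P Q S PQ). Qed.

Lemma ae_all P : (forall x, P x) -> \forall x \ae m, P x.
Proof. by move=> PQ; exact: (@filterE (Borel E) _ (ae_filter_ringOfSetsType m) P PQ). Qed.

Lemma ae_and P Q :
  (\forall x \ae m, P x) -> (\forall x \ae m, Q x) -> \forall x \ae m, P x /\ Q x.
Proof. exact: ae_impl2. Qed.

End borel_ae.

Section hilbert.
Context {R : realType} {E : pmetricType R}.
Variable m : {measure set (Borel E) -> \bar R}.
Implicit Types u v w : E -> R.

Lemma L2_measurable u : L2 m u -> borel_fun u.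
Proof. by rewrite /L2 inE => /andP[]; rewrite inE. Qed.

Lemma L2_integrable_mul u v : L2 m u -> L2 m v ->
  m.-integrable setT (EFin \o (fun x => u x * v x)).
Proof. by move=> hu hv; apply/Lfun1_integrable; exact: Lfun2_mul_Lfun1. Qed.

Lemma L2_lin (a : R) u v : L2 m u -> L2 m v -> L2 m (fun x => a * u x + v x).
Proof.
move=> hu hv; have h2 : (1 <= 2%:E :> \bar R)%E by rewrite lee_fin ler1n.
have [_ h] := Lfun_submod_closed m h2.
exact: (h a u v hu hv).
Qed.

Lemma L2_0 : L2 m (fun=> 0).
Proof.
have h2 : (1 <= 2%:E :> \bar R)%E by rewrite lee_fin ler1n.
by have [h _] := Lfun_submod_closed m h2.
Qed.

Lemma L2_scale (a : R) u : L2 m u -> L2 m (fun x => a * u x).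
Proof.
move=> hu; have := L2_lin a hu L2_0; congr L2.
by apply/funext => x; rewrite addr0.
Qed.

Lemma L2B u v : L2 m u -> L2 m v -> L2 m (fun x => u x - v x).
Proof.
move=> hu hv; have := L2_lin (-1) hv hu; congr L2.
by apply/funext => x; rewrite mulN1r addrC.
Qed.

Lemma ipC u v : ip m u v = ip m v u.
Proof. by rewrite /ip; apply: eq_Rintegral => x _; rewrite mulrC. Qed.

Lemma ip_linl (a : R) u v w : L2 m u -> L2 m v -> L2 m w ->
  ip m (fun x => a * u x + v x) w = a * ip m u w + ip m v w.
Proof.
move=> hu hv hw; rewrite /ip -RintegralZl //; last exact: L2_integrable_mul.
rewrite -RintegralD //; last 2 first.
- have := L2_integrable_mul (L2_scale a hu) hw.
  by congr (_.-integrable _ _); apply/funext => x /=; rewrite mulrA.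
- exact: L2_integrable_mul.
by apply: eq_Rintegral => x _; rewrite mulrDl mulrA.
Qed.

Lemma ip_linr (a : R) u v w : L2 m u -> L2 m v -> L2 m w ->
  ip m w (fun x => a * u x + v x) = a * ip m w u + ip m w v.
Proof. by move=> hu hv hw; rewrite ipC ip_linl // !(ipC w). Qed.

Lemma ipBl u v w : L2 m u -> L2 m v -> L2 m w ->
  ip m (fun x => u x - v x) w = ip m u w - ip m v w.
Proof.
move=> hu hv hw; rewrite -[X in _ = X]addrC -mulN1r -ip_linl //.
by congr ip; apply/funext => x; rewrite mulN1r addrC.
Qed.

Lemma ipBr u v w : L2 m u -> L2 m v -> L2 m w ->
  ip m w (fun x => u x - v x) = ip m w u - ip m w v.
Proof. by move=> hu hv hw; rewrite ipC ipBl // !(ipC w). Qed.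

Lemma ip_ge0 u : 0 <= ip m u u.
Proof. by apply: Rintegral_ge0 => x _; rewrite -expr2 sqr_ge0. Qed.

Lemma ip_ae u u' v : L2 m u -> L2 m u' -> L2 m v -> aeq m u u' -> ip m u v = ip m u' v.
Proof.
move=> hu hu' hv uu'; rewrite /ip /Rintegral; congr fine.
apply: ae_eq_integral => //.
- by have /measurable_int := L2_integrable_mul hu hv.
- by have /measurable_int := L2_integrable_mul hu' hv.
- by apply: (ae_impl _ uu') => x /= ux _; rewrite ux.
Qed.

Lemma ip_aer u u' v : L2 m u -> L2 m u' -> L2 m v -> aeq m u u' -> ip m v u = ip m v u'.
Proof. by move=> hu hu' hv h; rewrite ipC (ip_ae hu hu' hv h) ipC. Qed.

Lemma norm2_ae u u' : L2 m u -> L2 m u' -> aeq m u u' -> norm2 m u = norm2 m u'.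
Proof.
by move=> hu hu' h; rewrite /norm2 (ip_ae hu hu' hu h) (ip_aer hu hu' hu' h).
Qed.

Lemma norm2_sqr u : norm2 m u ^+ 2 = ip m u u.
Proof. by rewrite /norm2 sqr_sqrtr // ip_ge0. Qed.

Lemma norm2_ge0 u : 0 <= norm2 m u.
Proof. exact: sqrtr_ge0. Qed.

Lemma cauchy_schwarz u v : L2 m u -> L2 m v -> `|ip m u v| <= norm2 m u * norm2 m v.
Proof.
move=> hu hv.
have H (l : R) : 0 <= l ^+ 2 * ip m u u + 2 * l * ip m u v + ip m v v.
  have := ip_ge0 (fun x => l * u x + v x).
  rewrite ip_linl ?ip_linr //; last exact: L2_lin.
  by rewrite (ipC v u); congr (0 <= _); ring.
rewrite -ler_sqr ?nnegrE ?mulr_ge0 ?norm2_ge0 // exprMn !norm2_sqr.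
rewrite real_normK ?num_real //.
have := ip_ge0 u; rewrite le_eqVlt => /predU1P[u0|u0].
  have H2 l := H l; move: H2; rewrite -u0 => H2.
  have [->|c0] := eqVneq (ip m u v) 0; first by rewrite expr0n mul0r.
  exfalso; have := H2 (- (ip m v v + 1) / (2 * ip m u v)).
  rewrite (_ : 2 * _ * _ = - (ip m v v + 1)); last by field.
  by rewrite mulr0 add0r; have := ip_ge0 v; lra.
have := H (- ip m u v / ip m u u).
rewrite -(pmulr_rge0 _ u0) (_ : ip m u u * (_ + _) = ip m u u * ip m v v - ip m u v ^+ 2).
  by rewrite subr_ge0.
by field; rewrite gt_eqF.
Qed.

End hilbert.

Section self_adjoint_semigroup.
Context {R : realType} {E : pmetricType R}.
Variable m : {measure set (Borel E) -> \bar R}.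
Variables (A : l2op m) (T : R -> (E -> R) -> (E -> R)).
Hypothesis hA : self_adjoint A.
Hypothesis hT : markov_semigroup m T.
Hypothesis hAT : generates A T.
Implicit Types u v w : E -> R.

Let quot (h : R) u x := h^-1 * (T h u x - u x) - A u x.

Lemma L2_quot (h : R) u : 0 <= h -> dom A u -> L2 m (quot h u).
Proof.
move=> h0 du; have hu := dom_L2 du; apply: L2B; last exact: app_L2.
by apply: L2_scale; apply: L2B => //; exact: sg_L2.
Qed.

Lemma quot_cvg u : dom A u -> norm2 m (quot t u) @[t --> 0^'+] --> (0 : R).
Proof.
move=> du; have [h _] := hAT (dom_L2 du) (app_L2 du).
by apply: h; split => //; apply: ae_all.
Qed.

Lemma sgB (t : R) u v : 0 <= t -> L2 m u -> L2 m v ->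
  aeq m (T t (fun x => u x - v x)) (fun x => T t u x - T t v x).
Proof.
move=> t0 hu hv; have := sg_lin hT (-1) t0 hv hu.
rewrite /aeq (_ : (fun x => -1 * v x + u x) = (fun x => u x - v x)).
  by apply: ae_impl => x ->; rewrite mulN1r addrC.
by apply/funext => x; rewrite mulN1r addrC.
Qed.

Lemma sg_scale (t a : R) u : 0 <= t -> L2 m u ->
  aeq m (T t (fun x => a * u x)) (fun x => a * T t u x).
Proof.
move=> t0 hu.
have h0 := sg_lin hT 1 t0 (L2_0 m) (L2_0 m).
have := sg_lin hT a t0 hu (L2_0 m).
rewrite /aeq (_ : (fun x => a * u x + 0) = (fun x => a * u x)); last first.
  by apply/funext => x; rewrite addr0.
rewrite (_ : (fun x => 1 * 0 + 0) = (fun=> 0)) in h0; last first.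
  by apply/funext => x; rewrite addr0 mulr0.
by apply: (ae_impl2 _ h0) => x h1 ->; lra.
Qed.

Lemma sg_comm (s t : R) u : 0 <= s -> 0 <= t -> L2 m u ->
  aeq m (T s (T t u)) (T t (T s u)).
Proof.
move=> s0 t0 hu; have h1 := sgD hT s0 t0 hu; have h2 := sgD hT t0 s0 hu.
by rewrite /aeq; rewrite addrC in h1; apply: (ae_impl2 _ h1 h2) => x <- <-.
Qed.

Lemma sg_quot (s h : R) u : 0 <= s -> 0 <= h -> dom A u ->
  aeq m (T s (quot h u)) (fun x => h^-1 * (T h (T s u) x - T s u x) - T s (A u) x).
Proof.
move=> s0 h0 du; have hu := dom_L2 du; have hAu := app_L2 du.
have hTu := sg_L2 hT h0 hu.
have hd : L2 m (fun x => T h u x - u x) by apply: L2B.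
have h1 := sgB s0 (L2_scale h^-1 hd) hAu.
have h2 := sg_scale h^-1 s0 hd.
have h3 := sgB s0 hTu hu.
have h4 := sg_comm s0 h0 hu.
rewrite /aeq.
by apply: (ae_impl2 _ (ae_and h1 h2) (ae_and h3 h4)) => x [-> ->] [-> ->].
Qed.

Lemma norm2_quot_sg (s h : R) u : 0 <= s -> 0 <= h -> dom A u ->
  norm2 m (fun x => h^-1 * (T h (T s u) x - T s u x) - T s (A u) x) <= norm2 m (quot h u).
Proof.
move=> s0 h0 du; have hu := dom_L2 du; have hAu := app_L2 du.
have hTu := sg_L2 hT s0 hu.
rewrite -(norm2_ae _ _ (sg_quot s0 h0 du)).
- by apply: sg_contraction => //; exact: L2_quot.
- by apply: sg_L2 => //; exact: L2_quot.
- apply: L2B; last exact: sg_L2.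
  by apply: L2_scale; apply: L2B => //; exact: sg_L2.
Qed.

(** The operator [T s] commutes with the difference quotients and is a contraction, so it preserves
    their convergence. *)
Lemma dom_sg (s : R) u : 0 <= s -> dom A u -> dom A (T s u) /\ aeq m (A (T s u)) (T s (A u)).
Proof.
move=> s0 du; have hu := dom_L2 du; have hAu := app_L2 du.
apply/(hAT (sg_L2 hT s0 hu) (sg_L2 hT s0 hAu)).
apply: (@squeeze_cvgr _ _ _ _ (fun=> 0) (fun t => norm2 m (quot t u))); last exact: quot_cvg.
  by near=> t; rewrite norm2_ge0 /=; apply: norm2_quot_sg => //; near: t; exact: nbhs_right_ge.
exact: cvg_cst.
Unshelve. all: by end_near. Qed.

Lemma A_symmetric u v : dom A u -> dom A v -> ip m (A v) u = ip m v (A u).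
Proof.
move=> du dv; have [_ h] := hA.
have [+ _] := h u (A u) (dom_L2 du) (app_L2 du); apply => //.
by split => //; exact: ae_all.
Qed.

(** The terms of first order in [h] cancel by symmetry of [A], so the defect of symmetry over one time
    step is o(h), uniformly along the semigroup. *)
Lemma sg_step (s t h : R) u v : 0 <= s -> 0 <= t -> 0 < h -> dom A u -> dom A v ->
  `|ip m (T h (T s u)) (T t v) - ip m (T s u) (T h (T t v))| <=
  h * (norm2 m (quot h u) * norm2 m v + norm2 m u * norm2 m (quot h v)).
Proof.
move=> s0 t0 h0 du dv; have h0' := ltW h0.
have hu := dom_L2 du; have hv := dom_L2 dv.
have hTu := sg_L2 hT s0 hu; have hTv := sg_L2 hT t0 hv.
have [dTu ATu] := dom_sg s0 du; have [dTv ATv] := dom_sg t0 dv.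
have hTAu := sg_L2 hT s0 (app_L2 du); have hTAv := sg_L2 hT t0 (app_L2 dv).
have [q [hq nq E1]] : exists q : R -> (E -> R) -> E -> R,
  [/\ forall (r : R) w, 0 <= r -> dom A w -> L2 m (q r w),
      forall (r : R) w, 0 <= r -> dom A w -> norm2 m (q r w) <= norm2 m (quot h w) &
      forall (r : R) w, T h (T r w) = (fun x => h * q r w x + (h * T r (A w) x + T r w x))].
  exists (fun r w x => h^-1 * (T h (T r w) x - T r w x) - T r (A w) x); split.
  - move=> r w r0 dw; have hTw := sg_L2 hT r0 (dom_L2 dw).
    apply: L2B; last exact: (sg_L2 hT r0 (app_L2 dw)).
    by apply: L2_scale; apply: L2B => //; exact: sg_L2.
  - by move=> r w r0 dw; exact: norm2_quot_sg.
  - by move=> r w; apply/funext => x; field; rewrite gt_eqF.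
have hX (r : R) w : 0 <= r -> dom A w -> L2 m (fun x => h * T r (A w) x + T r w x).
  by move=> r0 dw; apply: L2_lin; [exact: (sg_L2 hT r0 (app_L2 dw))|exact: (sg_L2 hT r0 (dom_L2 dw))].
rewrite [T h (T s u)]E1 [T h (T t v)]E1.
rewrite ip_linl ?ip_linr //; try by [exact: hX|exact: hq].
rewrite ip_linl //.
have -> : ip m (T s (A u)) (T t v) = ip m (T s u) (T t (A v)).
  rewrite -(ip_ae (app_L2 dTu) hTAu hTv ATu) -(ip_aer (app_L2 dTv) hTAv hTu ATv).
  exact: A_symmetric.
rewrite (_ : _ - _ = h * (ip m (q s u) (T t v) - ip m (T s u) (q t v))); last by ring.
rewrite normrM gtr0_norm // ler_pM2l // (le_trans (ler_normB _ _)) // lerD //.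
  apply: (le_trans (cauchy_schwarz (hq _ _ s0 du) hTv)).
  apply: ler_pM; rewrite ?norm2_ge0 //; last exact: (sg_contraction hT).
  exact: nq.
apply: (le_trans (cauchy_schwarz hTu (hq _ _ t0 dv))).
apply: ler_pM; rewrite ?norm2_ge0 //; first exact: (sg_contraction hT).
exact: nq.
Qed.

(** The semigroup is moved from one factor to the other in [n.+1] steps of length [a / n.+1], which
    costs at most [a * eps (a / n.+1)] altogether. *)
Lemma sg_symmetric_dom (a : R) u v : 0 <= a -> dom A u -> dom A v ->
  ip m (T a u) v = ip m u (T a v).
Proof.
rewrite le_eqVlt => /predU1P[<-|a0] du dv.
  have hu := dom_L2 du; have hv := dom_L2 dv.
  have h0 w : L2 m w -> L2 m (T 0 w) by move=> hw; exact: sg_L2.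
  by rewrite (ip_ae (h0 _ hu) hu hv (sg0 hT hu)) (ip_aer (h0 _ hv) hv hu (sg0 hT hv)).
have hu := dom_L2 du; have hv := dom_L2 dv.
pose eps (h : R) := norm2 m (quot h u) * norm2 m v + norm2 m u * norm2 m (quot h v).
have T0 w z : L2 m w -> L2 m z -> ip m (T 0 w) z = ip m w z.
  by move=> hw hz; rewrite (ip_ae (sg_L2 hT (lexx 0) hw) hw hz (sg0 hT hw)).
have steps n : `|ip m (T a u) v - ip m u (T a v)| <= a * eps (a / n.+1%:R).
  set h := a / n.+1%:R.
  have h0 : 0 < h by rewrite divr_gt0.
  pose F (k : nat) := ip m (T ((n.+1 - k)%:R * h) u) (T (k%:R * h) v).
  have F0 : F 0 = ip m (T a u) v.
    rewrite /F subn0 mul0r /h mulrCA divff ?mulr1 ?pnatr_eq0 //.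
    by rewrite (ipC m _ (T 0 v)) (T0 _ _ hv (sg_L2 hT (ltW a0) hu)) ipC.
  have Fn : F n.+1 = ip m u (T a v).
    rewrite /F subnn mul0r /h mulrCA divff ?mulr1 ?pnatr_eq0 //.
    by rewrite (T0 _ _ hu (sg_L2 hT (ltW a0) hv)).
  have Fk k : (k <= n.+1)%N -> `|F 0 - F k| <= k%:R * (h * eps h).
    elim: k => [|k IH] kn; first by rewrite subrr normr0 mul0r.
    rewrite -natr1 mulrDl mul1r.
    rewrite (_ : F 0 - F k.+1 = (F 0 - F k) + (F k - F k.+1)); last by ring.
    apply: (le_trans (ler_normD _ _)); apply: lerD; first by apply: IH; exact: ltnW.
    have s0 : 0 <= (n.+1 - k.+1)%:R * h by rewrite mulr_ge0 // ltW.
    have t0 : 0 <= k%:R * h by rewrite mulr_ge0 // ltW.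
    have := sg_step s0 t0 h0 du dv; congr (`|_ - _| <= _).
    - apply: ip_ae => //; try by exact: (sg_L2 hT).
        by apply: (sg_L2 hT (ltW h0)); exact: (sg_L2 hT).
        by apply: (sg_L2 hT) => //; rewrite mulr_ge0 // ltW.
      have -> : (n.+1 - k)%:R * h = h + (n.+1 - k.+1)%:R * h.
        by rewrite -(subnSK kn) -natr1 mulrDl mul1r addrC.
      by apply: (ae_impl _ (sgD hT (ltW h0) s0 hu)) => x ->.
    - apply: ip_aer => //; try by exact: (sg_L2 hT).
        by apply: (sg_L2 hT (ltW h0)); exact: (sg_L2 hT).
        by apply: (sg_L2 hT) => //; rewrite mulr_ge0 // ltW.
      have -> : k.+1%:R * h = h + k%:R * h by rewrite -natr1 mulrDl mul1r addrC.
      by apply: (ae_impl _ (sgD hT (ltW h0) t0 hv)) => x ->.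
  have := Fk n.+1 (leqnn _); rewrite F0 Fn mulrA.
  by rewrite /h mulrCA divff ?mulr1 ?pnatr_eq0.
apply/eqP; rewrite -subr_eq0 -normr_le0.
have hn : a / n.+1%:R @[n --> \oo] --> (0 : R)^'+.
  move=> B /nbhs_ballP[e /= e0 eB].
  have ea0 : 0 < e / a by rewrite divr_gt0.
  have := near_infty_natSinv_lt (PosNum ea0); apply: filterS => n /= ne.
  apply: eB; last by rewrite divr_gt0.
  rewrite /ball /= sub0r normrN gtr0_norm ?divr_gt0 //.
  by rewrite mulrC -ltr_pdivlMr.
have qcvg w : dom A w -> norm2 m (quot (a / n.+1%:R) w) @[n --> \oo] --> (0 : R).
  by move=> dw; exact: (cvg_comp _ _ hn (quot_cvg dw)).
have : a * eps (a / n.+1%:R) @[n --> \oo] --> (0 : R).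
  rewrite -(mulr0 a); apply: cvgMl_tmp.
  have h1 : norm2 m (quot (a / n.+1%:R) u) * norm2 m v @[n --> \oo] --> (0 : R).
    by rewrite -(mul0r (norm2 m v)); apply: cvgM; [exact: qcvg|exact: cvg_cst].
  have h2 : norm2 m u * norm2 m (quot (a / n.+1%:R) v) @[n --> \oo] --> (0 : R).
    by rewrite -(mulr0 (norm2 m u)); apply: cvgM; [exact: cvg_cst|exact: qcvg].
  by rewrite -(addr0 (0 : R)); exact: cvgD h1 h2.
by move=> h; apply: (cvgr_to_ge h); exact: nearW.
Qed.

(** The domain is dense and [T a] is a contraction, in each variable in turn. *)
Lemma sg_symmetric (a : R) u v : 0 <= a -> L2 m u -> L2 m v ->
  ip m (T a u) v = ip m u (T a v).
Proof.
move=> a0; have [dense _] := hA.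
have extend w : L2 m w -> (forall z, dom A z -> ip m (T a w) z = ip m w (T a z)) ->
    forall z, L2 m z -> ip m (T a w) z = ip m w (T a z).
  move=> hw symw z hz.
  apply/eqP; rewrite -subr_eq0 -normr_le0; apply/ler_addgt0Pr => e e0.
  pose c := 2 * norm2 m w + 1.
  have c0 : 0 < c by rewrite ltr_wpDl // mulr_ge0 // norm2_ge0.
  have [z' dz' zz'] := dense z hz (e / c) (divr_gt0 e0 c0).
  have hz' := dom_L2 dz'; have hd := L2B hz hz'.
  have hTw := sg_L2 hT a0 hw; have hTz := sg_L2 hT a0 hz; have hTz' := sg_L2 hT a0 hz'.
  have hTd := sg_L2 hT a0 hd.
  have -> : ip m (T a w) z - ip m w (T a z) =
     ip m (T a w) (fun x => z x - z' x) - ip m w (T a (fun x => z x - z' x)).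
    rewrite (ip_aer hTd (L2B hTz hTz') hw (sgB a0 hz hz')) !ipBr //.
    by rewrite (symw _ dz'); ring.
  rewrite add0r; apply: (le_trans (ler_normB _ _)).
  have h1 := cauchy_schwarz hTw hd; have h2 := cauchy_schwarz hw hTd.
  have h3 := sg_contraction hT a0 hw; have h4 := sg_contraction hT a0 hd.
  have n0 := norm2_ge0 m w.
  have zz : norm2 m (fun x => z x - z' x) <= e / c by exact: ltW.
  have h5 : norm2 m w * norm2 m (fun x => z x - z' x) <= norm2 m w * (e / c).
    by rewrite ler_wpM2l.
  have h6 : norm2 m (T a w) * norm2 m (fun x => z x - z' x) <= norm2 m w * norm2 m (fun x => z x - z' x).
    by rewrite ler_wpM2r ?norm2_ge0.
  have h7 : norm2 m w * norm2 m (T a (fun x => z x - z' x)) <= norm2 m w * norm2 m (fun x => z x - z' x).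
    by rewrite ler_wpM2l.
  have h8 : e = 2 * (norm2 m w * (e / c)) + e / c.
    by rewrite /c; field; rewrite gt_eqF.
  have h9 : 0 < e / c by rewrite divr_gt0.
  lra.
move=> hu hv; apply: (extend u hu) => // z dz; rewrite ipC [RHS]ipC.
apply/esym; apply: (extend z (dom_L2 dz)) => //.
by move=> z' dz'; exact: sg_symmetric_dom.
Qed.
End self_adjoint_semigroup.

(** * Symmetry of the transition kernel *)

Section monotone_limits.
Context d (T : measurableType d) (R : realType).
Local Open Scope ereal_scope.

(** Multiplication of extended reals is not continuous at the products of 0 with infinity;
    monotonicity excludes the bad sequences. *)
Lemma cvge_mul_nd (c a : \bar R) (u : nat -> \bar R) : 0 <= c -> (forall n, 0 <= u n) ->
  {homo u : n k / (n <= k)%N >-> n <= k} -> u n @[n --> \oo] --> a ->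
  c * u n @[n --> \oo] --> c * a.
Proof.
move=> c0 u0 ndu ua; case: c c0 => [c c0|_|//]; first exact: cvgeZl.
have := ereal_nondecreasing_cvgn ndu => us.
have aE : a = ereal_sup (range u) by apply: (cvg_unique _ ua us).
have [a0|a0] := eqVneq a 0.
  have u00 n : u n = 0.
    by apply/eqP; rewrite eq_le u0 andbT -a0 aE; apply: ereal_sup_ubound; exists n.
  by under eq_fun do rewrite u00; rewrite a0; exact: cvg_cst.
have a0' : 0 < a.
  by rewrite lt_neqAle eq_sym a0 aE (le_trans (u0 0%N)) //; apply: ereal_sup_ubound; exists 0%N.
rewrite gt0_mulye //.
have [N uN] : exists N, 0 < u N.
  apply: contrapT => /forallNP h; move: a0'; rewrite aE ltNge => /negP; apply.
  by apply: ge_ereal_sup => _ [n _ <-]; rewrite leNgt; apply/negP; exact: h.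
apply: cvg_near_cst; exists N => // n /= Nn.
by rewrite gt0_mulye // (lt_le_trans uN) //; exact: ndu.
Qed.

Lemma cvg_nnm_integral (mu : {measure set T -> \bar R}) (f : nat -> T -> \bar R) g :
  (forall n, nnm (f n)) -> (forall x, {homo f ^~ x : n k / (n <= k)%N >-> n <= k}) ->
  (forall x, f n x @[n --> \oo] --> g x) ->
  \int[mu]_x f n x @[n --> \oo] --> \int[mu]_x g x.
Proof.
move=> nf ndf fg.
rewrite [X in _ --> X](_ : _ = \int[mu]_x (limn (f ^~ x))).
  apply: cvg_monotone_convergence => //.
  - by move=> n; exact: nnm_meas.
  - by move=> n x _; exact: nnm_ge0.
by apply: eq_integral => x _; symmetry; apply/cvg_lim => //; exact: fg.
Qed.

(** When [vr] is bounded and square integrable, so are these functions, and they increase to [h]. *)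
Definition cut (X : Type) (vr : X -> R) (h : X -> \bar R) (n : nat) (x : X) : \bar R :=
  mine (h x) (n%:R * vr x)%:E.

Variables (vr : T -> R) (h : T -> \bar R).
Hypothesis vr0 : forall x, (0 < vr x)%R.
Hypothesis mvr : measurable_fun setT vr.
Hypothesis nh : nnm h.

Lemma nnm_cut n : nnm (cut vr h n).
Proof.
apply: nnm_min => //; apply: nnm_EFin; first exact: measurable_funM.
by move=> x; rewrite mulr_ge0 // ltW.
Qed.

Lemma cut_nd x : {homo cut vr h ^~ x : n k / (n <= k)%N >-> n <= k}.
Proof.
move=> n k nk; rewrite /cut le_min ge_min lexx /= ge_min lee_fin.
by rewrite ler_wpM2r ?orbT ?ler_nat // ltW.
Qed.

Lemma cut_le_vr n x : cut vr h n x <= (n%:R * vr x)%:E.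
Proof. by rewrite /cut ge_min lexx orbT. Qed.

Lemma cut_fin n x : (fine (cut vr h n x))%:E = cut vr h n x.
Proof.
rewrite fineK // ge0_fin_numE; last exact: (nnm_ge0 x (nnm_cut n)).
exact: (le_lt_trans (cut_le_vr n x) (ltry _)).
Qed.

Lemma cut_cvg x : cut vr h n x @[n --> \oo] --> h x.
Proof.
have := nnm_ge0 x nh; rewrite /cut; case: (h x) => [r r0|_|//]; last first.
  apply/cvgeyPge => B; exists (Num.truncn (`|B| / vr x)).+1 => // n /= Nn.
  rewrite le_min leey lee_fin (le_trans (ler_norm B)) //.
  rewrite -ler_pdivrMr // (le_trans (ltW (truncnS_gt _))) // ler_nat //.
apply: cvg_near_cst; exists (Num.truncn (r / vr x)).+1 => // n /= Nn.
apply/min_idPl; rewrite lee_fin -ler_pdivrMr // (le_trans (ltW (truncnS_gt _))) //.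
by rewrite ler_nat.
Qed.

End monotone_limits.

Section symmetric_kernel.
Context {R : realType} {E : pmetricType R}.
Variable m : {measure set (Borel E) -> \bar R}.
Variable p : R.-spker (Borel E * measurableTypeR R) ~> Borel E.
Variables (A : l2op m) (T : R -> (E -> R) -> (E -> R)).
Hypothesis hA : self_adjoint A.
Hypothesis hT : markov_semigroup m T.
Hypothesis hAT : generates A T.
Hypothesis assoc : forall (t : R) (h : E -> R), 0 <= t -> (forall x, 0 <= h x) -> L2 m h ->
  (exists C : R, forall x, `|h x| <= C) -> \forall x \ae m, (T t h x)%:E = Q p t (EFin \o h) x.
Variable vr : E -> R.
Hypothesis vr0 : forall x, 0 < vr x.
Hypothesis mvr : borel_fun vr.
Hypothesis vrC : exists C : R, forall x, vr x <= C.
Hypothesis vr2 : L2 m vr.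
Local Notation nnm := (@nnm _ (Borel E) R).
Local Notation Q := (Q p).

Lemma L2_le u v : borel_fun u -> L2 m v -> (forall x, `|u x| <= `|v x|) -> L2 m u.
Proof.
move=> mu hv uv; have mv := L2_measurable hv; rewrite /L2 inE; apply/andP; split; first by rewrite inE.
rewrite inE /= /finite_norm; move: hv; rewrite /L2 inE => /andP[_]; rewrite inE /= /finite_norm.
move=> h; apply: le_lt_trans h; rewrite unlock.
apply: gt0_ler_poweR.
- by rewrite invr_ge0.
- by rewrite in_itv /= leey andbT integral_ge0.
- by rewrite in_itv /= leey andbT integral_ge0.
have mp w : borel_fun w -> measurable_fun setT (fun x : Borel E => (`|w x|%:E `^ 2)%E).
  move=> mw; apply/measurable_EFinP.
  apply/(@measurableT_comp _ _ _ _ _ _ (fun x : R => x `^ 2)%R) => //.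
  exact: measurableT_comp.
apply: nnm_le_integral => [||x]; last by rewrite lee_fin ge0_ler_powR ?nnegrE.
  by split; [exact: mp|move=> x; rewrite lee_fin powR_ge0].
by split; [exact: mp|move=> x; rewrite lee_fin powR_ge0].
Qed.

Local Open Scope ereal_scope.

Lemma bounded_L2_symmetric (t : R) (h k : E -> R) : (0 <= t)%R ->
  L2 m h -> L2 m k -> (forall x, (0 <= h x)%R) -> (forall x, (0 <= k x)%R) ->
  (exists C : R, forall x, (`|h x| <= C)%R) -> (exists C : R, forall x, (`|k x| <= C)%R) ->
  \int[m]_x ((k x)%:E * Q t (EFin \o h) x) = \int[m]_x ((h x)%:E * Q t (EFin \o k) x).
Proof.
move=> t0 h2 k2 h0 k0 hb kb.
have H (u v : E -> R) : L2 m u -> L2 m v -> (forall x, (0 <= u x)%R) -> (forall x, (0 <= v x)%R) ->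
    (exists C : R, forall x, (`|u x| <= C)%R) ->
    \int[m]_x ((v x)%:E * Q t (EFin \o u) x) = (ip m v (T t u))%:E.
  move=> u2 v2 u0 v0 ub.
  have iv := L2_integrable_mul v2 (sg_L2 hT t0 u2).
  rewrite /ip /Rintegral fineK; last exact: integrable_fin_num.
  apply: ae_eq_integral => //.
  - apply: emeasurable_funM; first by apply/measurable_EFinP; exact: (L2_measurable v2).
    by apply: measurable_Q; apply: nnm_EFin => //; exact: (L2_measurable u2).
  - by have /measurable_int := iv.
  - by apply: (ae_impl _ (assoc t0 u0 u2 ub)) => x ux _; rewrite -ux /= EFinM.
by rewrite !H // ipC (sg_symmetric hA hT hAT).
Qed.

(** For bounded functions in L2 this is the symmetry of [T t]; monotone limits of cut-offs are then
    taken in one factor at a time. *)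
Lemma kernel_symmetric (t : R) (h k : E -> \bar R) : (0 <= t)%R -> nnm h -> nnm k ->
  \int[m]_x (k x * Q t h x) = \int[m]_x (h x * Q t k x).
Proof.
move=> t0 nh nk.
pose c (f : E -> \bar R) n x := fine (cut vr f n x).
have nc f n : nnm f -> nnm (cut vr f n).
  by move=> nf; exact: (@nnm_cut _ (Borel E) R vr f vr0 mvr nf n).
have cE f n x : nnm f -> (c f n x)%:E = cut vr f n x.
  by move=> nf; exact: (@cut_fin _ (Borel E) R vr f vr0 mvr nf n x).
have c0 f n x : nnm f -> (0 <= c f n x)%R.
  by move=> nf; rewrite -lee_fin cE //; have [_] := nc f n nf; apply.
have cvr f n x : nnm f -> (c f n x <= n%:R * vr x)%R.
  by move=> nf; rewrite -lee_fin cE // /cut ge_min lexx orbT.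
have cb f n : nnm f -> exists C : R, forall x, (`|c f n x| <= C)%R.
  move=> nf; have [C vC] := vrC; exists (n%:R * C)%R => x.
  by rewrite ger0_norm ?c0 // (le_trans (cvr _ _ _ nf)) // ler_wpM2l.
have mc f n : nnm f -> borel_fun (c f n).
  move=> nf; apply: measurableT_comp => //; by have [] := nc f n nf.
have c2 f n : nnm f -> L2 m (c f n).
  move=> nf; apply: (L2_le (mc f n nf) (L2_scale n%:R vr2)) => x.
  by rewrite !ger0_norm ?cvr ?c0 // mulr_ge0 // ltW.
have E1 f n : nnm f -> cut vr f n = EFin \o c f n.
  by move=> nf; apply/funext => x; rewrite /= cE.
have nQ := fun (f : E -> \bar R) (nf : nnm f) => nnm_Q p t nf.
have Qle f f' x : nnm f -> nnm f' -> (forall x, f x <= f' x) -> Q t f x <= Q t f' x.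
  by move=> nf nf' ff'; apply: nnm_le_integral.
have Qcvg f x : nnm f -> Q t (cut vr f n) x @[n --> \oo] --> Q t f x.
  move=> nf; apply: cvg_nnm_integral => //; first by move=> n; exact: nc.
    by move=> y; exact: (@cut_nd _ (Borel E) R vr _ vr0).
  by move=> y; exact: (@cut_cvg _ (Borel E) R vr _ vr0).
have lim1 f g : nnm f -> nnm g ->
    \int[m]_x (g x * Q t (cut vr f n) x) @[n --> \oo] --> \int[m]_x (g x * Q t f x).
  move=> nf ng; have ncf n := nc f n nf.
  have Qnd x : {homo (fun n => Q t (cut vr f n) x) : n k / (n <= k)%N >-> n <= k}.
    by move=> i j ij; apply: Qle => // y; exact: (@cut_nd _ (Borel E) R vr _ vr0).
  apply: cvg_nnm_integral.
  - by move=> n; apply: nnmM => //; exact: nQ.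
  - by move=> x i j ij; apply: lee_wpmul2l; [exact: (nnm_ge0 x ng)|exact: Qnd].
  - move=> x; apply: cvge_mul_nd => //; first exact: (nnm_ge0 x ng).
      by move=> n; exact: Q_ge0.
    exact: Qcvg.
have lim2 f g : nnm f -> nnm g ->
    \int[m]_x (cut vr f n x * Q t g x) @[n --> \oo] --> \int[m]_x (f x * Q t g x).
  move=> nf ng; have ncf n := nc f n nf.
  apply: cvg_nnm_integral.
  - by move=> n; apply: nnmM => //; exact: nQ.
  - by move=> x i j ij; apply: lee_wpmul2r; [exact: Q_ge0|exact: (@cut_nd _ (Borel E) R vr _ vr0)].
  - move=> x; rewrite muleC; under eq_fun do rewrite muleC.
    apply: cvge_mul_nd => //; first exact: Q_ge0.
    + by move=> n; exact: (nnm_ge0 x (ncf n)).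
    + exact: (@cut_nd _ (Borel E) R vr _ vr0).
    + exact: (@cut_cvg _ (Borel E) R vr _ vr0).
have S1 n f g : nnm f -> nnm g ->
    \int[m]_x (cut vr g n x * Q t f x) = \int[m]_x (f x * Q t (cut vr g n) x).
  move=> nf ng; have l1 := lim1 f _ nf (nc g n ng).
  have l2 := lim2 f _ nf (nc g n ng).
  suff e : (fun i => \int[m]_x (cut vr g n x * Q t (cut vr f i) x)) =
      (fun i => \int[m]_x (cut vr f i x * Q t (cut vr g n) x)).
    by rewrite e in l1; exact: (cvg_unique _ l1 l2).
  apply/funext => i; rewrite (E1 g n ng) (E1 f i nf).
  by apply: bounded_L2_symmetric => //; first [exact: c2|exact: cb|move=> x; exact: c0].
have l1 := lim1 k h nk nh; have l2 := lim2 k h nk nh.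
have e : (fun i => \int[m]_x (h x * Q t (cut vr k i) x)) =
    (fun i => \int[m]_x (cut vr k i x * Q t h x)).
  by apply/funext => i; rewrite S1.
by rewrite e in l1; exact: (cvg_unique _ l2 l1).
Qed.

End symmetric_kernel.

(** * Strong continuity of the resolvent in weighted L1 *)

Section l1_continuity.
Context d (E : measurableType d) (R : realType).
Variables (m : {measure set E -> \bar R}) (V : R -> E -> {measure set E -> \bar R}).
Hypothesis HV : sym_resolvent m V.
Variables (vr w : E -> R) (C : R).
Hypothesis mvr : measurable_fun setT vr.
Hypothesis vr0 : forall x, 0 < vr x.
Local Open Scope ereal_scope.
Hypothesis wE : forall x, rpot V 0 (fun y => (vr y)%:E) x = (w x)%:E.
Hypothesis wC : forall x, (w x <= C)%R.
Hypothesis res1 : forall (a : R) x, (0 < a)%R -> a%:E * rpot V a (fun=> 1) x <= 1.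
Local Notation rpot := (rpot V).

Let nw : nnm (fun x => (w x)%:E).
Proof. by have [] := supermedian_w HV mvr vr0 wE. Qed.

Let w0 x : 0 <= (w x)%:E.
Proof. by have [_] := nw; apply. Qed.

Let mw : measurable_fun setT w.
Proof. by have [/measurable_EFinP] := nw. Qed.

(** By symmetry this is [a U_a w <= w]. *)
Lemma resolvent_contraction (a : R) h : (0 < a)%R -> nnm h ->
  \int[m]_x ((w x)%:E * (a%:E * rpot a h x)) <= \int[m]_x ((w x)%:E * h x).
Proof.
move=> a0 nh; have nr := nnm_rpot HV (ltW a0) nh.
have nrw := nnm_rpot HV (ltW a0) nw.
have -> : \int[m]_x ((w x)%:E * (a%:E * rpot a h x)) =
    \int[m]_x (h x * (a%:E * rpot a (fun y => (w y)%:E) x)).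
  under eq_integral do rewrite muleCA.
  under [RHS]eq_integral do rewrite muleCA.
  rewrite (nnm_integralZ _ (ltW a0) (nnmM nw nr)) (nnm_integralZ _ (ltW a0) (nnmM nh nrw)).
  by rewrite (res_sym HV (ltW a0) nh nw).
apply: nnm_le_integral => [||x].
- by apply: nnmM => //; exact: (nnmZ (ltW a0) nrw).
- exact: nnmM.
rewrite muleC; apply: lee_wpmul2r; first exact: (nnm_ge0 x nh).
by have [_] := supermedian_w HV mvr vr0 wE; apply.
Qed.

Lemma cvge0_le (u : nat -> \bar R) : (forall n, 0 <= u n) ->
  (forall e : R, (0 < e)%R -> \forall n \near \oo, u n <= e%:E) -> u n @[n --> \oo] --> 0.
Proof.
move=> u0 h.
have fin e n : u n <= e%:E -> u n \is a fin_num.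
  by move=> ue; rewrite ge0_fin_numE // (le_lt_trans ue) // ltry.
apply/fine_cvgP; split.
  by apply: filterS (h _ ltr01) => n /fin.
apply/cvgrPdist_le => e e0; apply: filterS (h _ e0) => n une.
rewrite /= sub0r normrN ger0_norm ?fine_ge0 // -lee_fin fineK //; exact: fin une.
Qed.

Definition l1_cvg (f : E -> R) :=
  \int[m]_x ((w x)%:E * resdist V n.+1%:R f x) @[n --> \oo] --> 0.

Let nres (n : nat) (f : E -> R) : measurable_fun setT f -> (forall x, (0 <= f x)%R) ->
  nnm (fun x => (w x)%:E * resdist V n.+1%:R f x).
Proof.
move=> mf f0; apply: nnmM => //; apply: nnm_abse.
apply: emeasurable_funB; last exact/measurable_EFinP.
apply: measurable_funeM; apply: (nnm_meas (nnm_rpot HV _ _)) => //.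
exact: nnm_EFin.
Qed.

Lemma resdistD (n : nat) (f g : E -> R) x : measurable_fun setT f -> measurable_fun setT g ->
  (forall x, (0 <= f x)%R) -> (forall x, (0 <= g x)%R) ->
  resdist V n.+1%:R (fun x => (f x + g x)%R) x <=
  resdist V n.+1%:R f x + resdist V n.+1%:R g x.
Proof.
move=> mf mg f0 g0; have nf := nnm_EFin mf f0; have ng := nnm_EFin mg g0.
rewrite /resdist.
rewrite (eq_rpot _ _ _ (k := fun y => (f y)%:E + (g y)%:E)) // rpotD //.
have n0 : (0 < n.+1%:R :> R)%R by [].
have : 0 <= rpot n.+1%:R (fun y => (f y)%:E) x by apply: rpot_ge0 => y; rewrite lee_fin.
have : 0 <= rpot n.+1%:R (fun y => (g y)%:E) x by apply: rpot_ge0 => y; rewrite lee_fin.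
case: (rpot _ (fun y => (g y)%:E) x) => [b b0|_|//].
  case: (rpot _ (fun y => (f y)%:E) x) => [a a0|_|//].
    change ((`|n.+1%:R * (a + b) - (f x + g x)|%R)%:E <=
      (`|n.+1%:R * a - f x| + `|n.+1%:R * b - g x|)%R%:E); rewrite lee_fin.
    apply: le_trans (ler_normD _ _); rewrite le_eqVlt; apply/orP; left; apply/eqP.
    by congr (Num.norm _); ring.
  by rewrite [X in _ <= X + _]abs_infty_sub // addye ?leey // -EFinM -EFinB.
move=> _; rewrite [X in _ <= _ + X]abs_infty_sub // [X in _ <= X]ge0_addey ?leey ?abse_ge0 //.
Qed.

Lemma l1_cvgD (f g : E -> R) : measurable_fun setT f -> measurable_fun setT g ->
  (forall x, (0 <= f x)%R) -> (forall x, (0 <= g x)%R) ->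
  l1_cvg f -> l1_cvg g -> l1_cvg (fun x => (f x + g x)%R).
Proof.
move=> mf mg f0 g0 cf cg.
apply: (squeeze_cvge _ (@cvg_cst _ 0 _ _ _) (cvge0D cf cg)).
apply: nearW => n; apply/andP; split.
  by apply: nnm_integral_ge0; apply: nres; [exact: measurable_funD|move=> x; rewrite addr_ge0].
rewrite -nnm_integralD; [|exact: nres..].
apply: nnm_le_integral => [||x].
- by apply: nres; [exact: measurable_funD|move=> x; rewrite addr_ge0].
- by apply: nnmD; exact: nres.
by rewrite -ge0_muleDr ?abse_ge0 //; apply: lee_wpmul2l => //; exact: resdistD.
Qed.

Lemma l1_cvgZ (c : R) (f : E -> R) : (0 <= c)%R -> measurable_fun setT f ->
  (forall x, (0 <= f x)%R) -> l1_cvg f -> l1_cvg (fun x => (c * f x)%R).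
Proof.
move=> c0 mf f0 cf; have nf := nnm_EFin mf f0.
have E1 n x : resdist V n.+1%:R (fun x => (c * f x)%R) x = c%:E * resdist V n.+1%:R f x.
  rewrite /resdist (eq_rpot _ _ _ (k := fun y => c%:E * (f y)%:E)) // rpotZ //.
  rewrite -[in RHS](ger0_norm c0) -abse_EFin -abseM; congr (`| _ |).
  rewrite [RHS]muleBr //; first by rewrite (muleCA c%:E) EFinM.
  by rewrite fin_num_adde_defl.
have e : (fun n : nat => \int[m]_x ((w x)%:E * resdist V n.+1%:R (fun x => (c * f x)%R) x)) =
    (fun n : nat => c%:E * \int[m]_x ((w x)%:E * resdist V n.+1%:R f x)).
  apply/funext => n; rewrite -nnm_integralZ //; last exact: nres.
  by apply: eq_integral => x _; rewrite E1 muleCA.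
by rewrite /l1_cvg e -(mule0 c%:E); apply: cvgeZl.
Qed.

(** By [resolvent_contraction] the tail [f - fk k] contributes at most twice its own integral,
    uniformly in the index of the resolvent. *)
Lemma l1_cvg_monotone (fk : nat -> E -> R) (f : E -> R) :
  (forall k, measurable_fun setT (fk k)) -> (forall k x, (0 <= fk k x)%R) ->
  (forall x, {homo fk ^~ x : n k / (n <= k)%N >-> (n <= k)%R}) ->
  (forall k x, (fk k x <= f x)%R) -> (forall x, fk k x @[k --> \oo] --> f x) ->
  measurable_fun setT f -> \int[m]_x ((w x)%:E * (f x)%:E) < +oo ->
  (forall k, l1_cvg (fk k)) -> l1_cvg f.
Proof.
move=> mfk fk0 nd fkf cfk mf fint ck.
have f0 x : (0 <= f x)%R by apply: (le_trans (fk0 0%N x)).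
have nwf (g : E -> R) : measurable_fun setT g -> (forall x, (0 <= g x)%R) ->
    nnm (fun x => (w x)%:E * (g x)%:E).
  by move=> mg g0; apply: nnmM => //; exact: nnm_EFin.
apply: cvge0_le => [n|e e0]; first by apply: nnm_integral_ge0; exact: nres.
have icvg : \int[m]_x ((w x)%:E * (fk k x)%:E) @[k --> \oo] --> \int[m]_x ((w x)%:E * (f x)%:E).
  apply: cvg_nnm_integral => [k|x i j ij|x]; first exact: nwf.
    by apply: lee_wpmul2l => //; rewrite lee_fin; exact: nd.
  by apply: cvgeZl => //; apply: cvg_EFin; [exact: nearW|exact: cfk].
have fin k : \int[m]_x ((w x)%:E * (fk k x)%:E) \is a fin_num.
  rewrite ge0_fin_numE; last by apply: nnm_integral_ge0; exact: nwf.
  apply: le_lt_trans fint; apply: nnm_le_integral; [exact: nwf..|].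
  by move=> x; apply: lee_wpmul2l => //; rewrite lee_fin.
have ffin : \int[m]_x ((w x)%:E * (f x)%:E) \is a fin_num.
  by rewrite ge0_fin_numE //; apply: nnm_integral_ge0; exact: nwf.
have [k kP] : exists k, \int[m]_x ((w x)%:E * (f x - fk k x)%:E) <= (e / 4)%:E.
  have e40 : (0 < e / 4)%R by rewrite divr_gt0.
  move: icvg; rewrite -(fineK ffin) => /fine_cvgP[_ /cvgrPdist_le /(_ _ e40)[k _ /(_ k (leqnn k)) h]].
  exists k.
  have -> : \int[m]_x ((w x)%:E * (f x - fk k x)%:E) =
      \int[m]_x ((w x)%:E * (f x)%:E) - \int[m]_x ((w x)%:E * (fk k x)%:E).
    have D : \int[m]_x ((w x)%:E * (f x - fk k x)%:E) + \int[m]_x ((w x)%:E * (fk k x)%:E) =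
        \int[m]_x ((w x)%:E * (f x)%:E).
      rewrite -nnm_integralD; [|by apply: nwf; [exact: measurable_funB|move=> x; rewrite subr_ge0]
        |exact: nwf].
      apply: eq_integral => x _; rewrite -ge0_muleDr ?lee_fin ?subr_ge0 //.
      by rewrite -EFinD subrK.
    by rewrite -D addeK.
  rewrite -(fineK ffin) -(fineK (fin k)) -EFinB lee_fin.
  exact: (le_trans (ler_norm _) h).
pose r x := (f x - fk k x)%R.
have mr : measurable_fun setT r by exact: measurable_funB.
have r0 x : (0 <= r x)%R by rewrite subr_ge0.
have nr := nnm_EFin mr r0.
have rE n : \int[m]_x ((w x)%:E * resdist V n.+1%:R r x) <= (e / 2)%:E.
  have n0 : (0 < n.+1%:R :> R)%R by [].
  have nrr := nnmZ (ltW n0) (nnm_rpot HV (ltW n0) nr).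
  apply: (@le_trans _ _ (\int[m]_x ((w x)%:E * (n.+1%:R%:E * rpot n.+1%:R (fun y => (r y)%:E) x)) +
     \int[m]_x ((w x)%:E * (r x)%:E))).
    rewrite -nnm_integralD; [|exact: (nnmM nw nrr)|exact: nwf].
    apply: nnm_le_integral => [||x]; first exact: nres.
      by apply: nnmD; [exact: (nnmM nw nrr)|exact: nwf].
    rewrite -ge0_muleDr ?lee_fin //; last exact: (nnm_ge0 x nrr).
    apply: lee_wpmul2l => //; apply: (le_trans (lee_abs_sub _ _)).
    by rewrite !gee0_abs // ?lee_fin //; exact: (nnm_ge0 x nrr).
  have -> : (e / 2)%:E = (e / 4)%:E + (e / 4)%:E :> \bar R by rewrite -EFinD; congr _%:E; field.
  by apply: leeD => //; apply: (le_trans (resolvent_contraction n0 nr)).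
have e20 : (0 < e / 2)%R by rewrite divr_gt0.
apply: filterS (cvge0_near_lt (ck k) e20) => n /ltW hn.
have -> : e%:E = (e / 2)%:E + (e / 2)%:E :> \bar R by rewrite -EFinD -splitr.
apply: le_trans (leeD hn (rE n)).
rewrite -nnm_integralD; [|exact: nres..].
apply: nnm_le_integral => [||x]; first exact: nres.
  by apply: nnmD; exact: nres.
rewrite -ge0_muleDr ?abse_ge0 //; apply: lee_wpmul2l => //.
have -> : f = (fun x => (fk k x + r x)%R) by apply/funext => y; rewrite /r addrC subrK.
exact: resdistD.
Qed.

Hypothesis small_cvg : forall (B : set E) (N : nat), measurable B ->
  (forall x, B x -> (1 <= N%:R * vr x)%R) -> m B < +oo /\
  \int[m]_x ((\1_B x)%:E * (n.+1%:R%:E * rpot n.+1%:R (fun y => (\1_B y)%:E) x))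
    @[n --> \oo] --> m B.

(** The distance is [n U_n 1_B] off [B] and [1 - n U_n 1_B] on [B]. By contraction the integral of the
    former is at most that of the latter, which tends to 0 by [small_cvg]. *)
Lemma l1_cvg_small (B : set E) (N : nat) : measurable B ->
  (forall x, B x -> (1 <= N%:R * vr x)%R) -> l1_cvg \1_B.
Proof.
move=> mB BN; have [mBoo hB] := small_cvg mB BN.
have mi : measurable_fun setT (\1_B : E -> R) by exact: measurable_indic.
have i0 x : (0 <= \1_B x :> R)%R by [].
have ni := nnm_EFin mi i0.
have C0 : (0 <= C)%R by have := wC point; apply: le_trans; rewrite -lee_fin.
have mBfin : m B \is a fin_num by rewrite ge0_fin_numE.
pose g (n : nat) x := fine (n.+1%:R%:E * rpot n.+1%:R (fun y => (\1_B y)%:E) x).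
have n1 : @nnm _ E R (fun=> 1) by split.
have nR n := nnm_rpot HV (ler0n R n.+1) ni.
have gE n x : (g n x)%:E = n.+1%:R%:E * rpot n.+1%:R (fun y => (\1_B y)%:E) x.
  rewrite /g fineK // ge0_fin_numE; last by rewrite mule_ge0 ?lee_fin //; exact: (nnm_ge0 x (nR n)).
  have n0 : (0 < n.+1%:R :> R)%R by [].
  apply: le_lt_trans (ltry 1); apply: le_trans (res1 x n0).
  apply: lee_wpmul2l; first by rewrite lee_fin.
  apply: (le_rpot _ _ _ ni n1).
  by move=> y; rewrite lee_fin indicE lern1 leq_b1.
have g0 n x : (0 <= g n x)%R.
  by rewrite -lee_fin gE mule_ge0 ?lee_fin //; exact: (nnm_ge0 x (nR n)).
have g1 n x : (g n x <= 1)%R.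
  rewrite -lee_fin gE; have n0 : (0 < n.+1%:R :> R)%R by [].
  apply: le_trans (res1 x n0).
  apply: lee_wpmul2l; first by rewrite lee_fin.
  apply: (le_rpot _ _ _ ni n1).
  by move=> y; rewrite lee_fin indicE lern1 leq_b1.
have mg n : measurable_fun setT (g n).
  by apply: measurableT_comp => //; apply: measurable_funeM; exact: (nnm_meas (nR n)).
have d0 n x : (0 <= \1_B x * (1 - g n x))%R by rewrite mulr_ge0 ?subr_ge0.
have md n : measurable_fun setT (fun x => \1_B x * (1 - g n x))%R.
  by apply: measurable_funM => //; exact: measurable_funB.
have nd n := nnm_EFin (md n) (d0 n).
have nB := nnm_EFin mi i0.
have ng n := nnm_EFin (mg n) (g0 n).
have EB : \int[m]_x (\1_B x)%:E = m B by rewrite integral_indic // setIT.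
have wBfin : \int[m]_x ((w x)%:E * (\1_B x)%:E) \is a fin_num.
  rewrite ge0_fin_numE; last by apply: nnm_integral_ge0; exact: nnmM.
  apply: (@le_lt_trans _ _ (C%:E * m B)); last by rewrite -(fineK mBfin) -EFinM ltry.
  rewrite -EB -nnm_integralZ //; apply: nnm_le_integral => [||x]; first exact: nnmM.
    exact: nnmZ.
  by apply: lee_wpmul2r; rewrite lee_fin.
have step n : \int[m]_x ((w x)%:E * resdist V n.+1%:R \1_B x) <=
    (2 * C)%:E * \int[m]_x (\1_B x * (1 - g n x))%:E.
  have n0 : (0 < n.+1%:R :> R)%R by [].
  rewrite -(leeD2rE _ _ wBfin) -nnm_integralD; [|exact: nres|exact: nnmM].
  apply: (@le_trans _ _ (\int[m]_x ((2 * C)%:E * (\1_B x * (1 - g n x))%:E + (w x)%:E * (g n x)%:E))).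
    apply: nnm_le_integral => [||x].
    - by apply: nnmD; [exact: nres|exact: nnmM].
    - by apply: nnmD; [apply: nnmZ => //; rewrite mulr_ge0|exact: nnmM].
    rewrite /resdist -gE -EFinB /= -!EFinM -!EFinD lee_fin.
    have wx0 : (0 <= w x)%R by rewrite -lee_fin.
    have := wC x; have := g0 n x; have := g1 n x; rewrite indicE.
    case: (x \in B) => /= gx1 gx0 wx; last first.
      by rewrite subr0 ger0_norm // mulr0 addr0 mul0r mulr0 add0r.
    by rewrite ler0_norm ?subr_le0 // opprB mulr1 mul1r; nra.
  rewrite nnm_integralD; [|by apply: nnmZ => //; rewrite mulr_ge0|exact: nnmM].
  rewrite nnm_integralZ //; last by rewrite mulr_ge0.
  apply: leeD2l; under eq_integral do rewrite gE.
  exact: resolvent_contraction.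
have Ed n : \int[m]_x (\1_B x * (1 - g n x))%:E = m B -
    \int[m]_x ((\1_B x)%:E * (n.+1%:R%:E * rpot n.+1%:R (fun y => (\1_B y)%:E) x)).
  have -> : \int[m]_x ((\1_B x)%:E * (n.+1%:R%:E * rpot n.+1%:R (fun y => (\1_B y)%:E) x)) =
     \int[m]_x ((\1_B x)%:E * (g n x)%:E) by apply: eq_integral => x _; rewrite gE.
  have nBg := nnmM nB (ng n).
  have D : \int[m]_x (\1_B x * (1 - g n x))%:E + \int[m]_x ((\1_B x)%:E * (g n x)%:E) = m B.
    rewrite -EB -nnm_integralD //; apply: eq_integral => x _.
    by rewrite -EFinM -EFinD; congr _%:E; ring.
  rewrite -D addeK // ge0_fin_numE; last exact: nnm_integral_ge0.
  apply: le_lt_trans mBoo; rewrite -EB; apply: nnm_le_integral => // x.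
  by rewrite -EFinM lee_fin ler_piMr.
have lim0 : (2 * C)%:E * \int[m]_x (\1_B x * (1 - g n x))%:E @[n --> \oo] --> 0.
  have h : m B - \int[m]_x ((\1_B x)%:E * (n.+1%:R%:E * rpot n.+1%:R (fun y => (\1_B y)%:E) x))
      @[n --> \oo] --> m B - m B.
    by apply: cvgeB; [exact: fin_num_adde_defr|exact: cvg_cst|exact: hB].
  have e : (fun n => \int[m]_x (\1_B x * (1 - g n x))%:E) = (fun n => m B -
      \int[m]_x ((\1_B x)%:E * (n.+1%:R%:E * rpot n.+1%:R (fun y => (\1_B y)%:E) x))).
    by apply/funext => n; exact: Ed.
  by rewrite -(mule0 (2 * C)%:E); apply: cvgeZl => //; rewrite e; rewrite subee in h.
apply: (squeeze_cvge _ (@cvg_cst _ 0 _ _ _) lim0).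
apply: nearW => n; apply/andP; split=> //.
by apply: nnm_integral_ge0; exact: nres.
Qed.

Lemma l1_cvg_indic (B : set E) : measurable B ->
  \int[m]_x ((w x)%:E * (\1_B x)%:E) < +oo -> l1_cvg \1_B.
Proof.
move=> mB Bint.
have indic_le (A1 A2 : set E) x : A1 `<=` A2 -> (\1_A1 x <= \1_A2 x :> R)%R.
  move=> A12; rewrite !indicE; have [|] := boolP (x \in A1) => //.
  by rewrite inE => /A12 A2x; rewrite mem_set.
pose Bn (n : nat) := B `&` [set x | (1 <= n%:R * vr x)%R].
have mBn n : measurable (Bn n).
  apply: measurableI => //; rewrite -[X in measurable X]setTI.
  have mn : measurable_fun setT (fun x => n%:R * vr x)%R by exact: measurable_funM.
  have := mn measurableT _ (measurable_itv `[1%R, +oo[).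
  by congr measurable; apply/seteqP; split => x /=; rewrite in_itv /= andbT.
apply: (@l1_cvg_monotone (fun n => \1_(Bn n))) => //.
- move=> x n k nk; apply: indic_le => y [By yn]; split => //=.
  by apply: (le_trans yn); rewrite ler_wpM2r ?ler_nat // ltW.
- by move=> n x; apply: indic_le => y [].
- move=> x; apply: cvg_near_cst; rewrite !indicE.
  have [Bx|nBx] := pselect (B x); last first.
    by apply: nearW => n; rewrite indicE !memNset // => -[].
  exists (Num.truncn (vr x)^-1).+1 => // n /= nx; rewrite indicE !mem_set //; split => //=.
  rewrite -ler_pdivrMr // div1r (le_trans (ltW (truncnS_gt _))) // ler_nat //.
- by move=> n; apply: (l1_cvg_small (mBn n) (N := n)) => x [].
Qed.

Import HBNNSimple.

Lemma l1_cvg_all (f : E -> R) : measurable_fun setT f -> (forall x, (0 <= f x)%R) ->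
  \int[m]_x ((w x)%:E * (f x)%:E) < +oo -> l1_cvg f.
Proof.
move=> mf f0 fint.
have mfe : measurable_fun setT (EFin \o f) by exact/measurable_EFinP.
pose fk := nnsfun_approx measurableT mfe.
have fe0 x : setT x -> 0 <= (EFin \o f) x by move=> _; rewrite lee_fin.
have fkcvg x : fk k x @[k --> \oo] --> f x.
  by have /fine_cvgP[_] := cvg_nnsfun_approx measurableT mfe fe0 (I : setT x).
have fknd x : {homo (fun n => fk n x) : n k / (n <= k)%N >-> (n <= k)%R}.
  by move=> n k nk; have /lefP := nd_nnsfun_approx measurableT mfe nk; apply.
have kf k x : (fk k x <= f x)%R.
  rewrite -(cvg_lim (@Rhausdorff R) (fkcvg x)); apply: (nondecreasing_cvgn_le (@fknd x)).
  by apply/cvg_ex; exists (f x).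
apply: (@l1_cvg_monotone (fun n => fk n)) => //.
move=> k.
have base : l1_cvg (fun=> 0%R).
  have := l1_cvg_indic measurable0; rewrite indic0; apply.
  by rewrite integral0_eq // => x _; rewrite mule0.
have mr (r : R) : measurable (fk k @^-1` [set r]) by exact: measurable_funPTI.
have [s [rs ->]] : exists s : seq R, (forall r : R, r \in s -> (0 <= r)%R) /\
    (fk k : E -> R) = (fun x => \sum_(r <- s) (r * \1_(fk k @^-1` [set r]) x))%R.
  exists (finmap.enum_fset (fset_set (range (fk k)))); split.
    move=> r rr; have h := in_fset_set (@fimfunP _ _ (fk k)) r.
    have : r \in range (fk k) by rewrite -h; exact: rr.
    by rewrite inE => -[x _ <-].
  by apply/funext => x; rewrite {1}fimfunE fsbig_finite.
elim: s rs => [|r s IH] rs.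
  by under eq_fun do rewrite big_nil.
under eq_fun do rewrite big_cons.
have r0 : (0 <= r)%R by apply: rs; rewrite inE eqxx.
have s0 t : t \in s -> (0 <= t)%R by move=> ts; apply: rs; rewrite inE ts orbT.
apply: l1_cvgD.
- by apply: measurable_funM => //; exact: measurable_indic.
- apply: measurable_sum => t; apply: measurable_funM => //; exact: measurable_indic.
- by move=> x; rewrite mulr_ge0.
- by move=> x; rewrite big_seq sumr_ge0 // => t /s0 t0; rewrite mulr_ge0.
- move: r0; rewrite le_eqVlt => /predU1P[<-|r0]; first by under eq_fun do rewrite mul0r.
  apply: l1_cvgZ => //; first exact: ltW.
  apply: l1_cvg_indic => //; apply: (@le_lt_trans _ _ (r^-1%:E * \int[m]_x ((w x)%:E * (f x)%:E))).
    have nwf : nnm (fun x => (w x)%:E * (f x)%:E) by apply: nnmM => //; exact: nnm_EFin.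
    have ri0 : (0 <= r^-1)%R by rewrite invr_ge0 ltW.
    rewrite -(nnm_integralZ _ ri0 nwf); apply: nnm_le_integral => [||x].
    + by apply: nnmM => //; apply: nnm_EFin.
    + exact: nnmZ.
    rewrite muleCA; apply: lee_wpmul2l => //; rewrite -EFinM lee_fin indicE.
    have [xr|] := boolP (x \in _); last by rewrite mulr_ge0 // invr_ge0 ltW.
    move: xr; rewrite inE /= => xr; rewrite ler_pdivlMl // mulr1 -xr; exact: kf.
  have wf : \int[m]_x ((w x)%:E * (f x)%:E) \is a fin_num.
    rewrite ge0_fin_numE //; apply: nnm_integral_ge0; apply: nnmM => //; exact: nnm_EFin.
  by rewrite -(fineK wf) -EFinM ltry.
- exact: IH.
Qed.

End l1_continuity.

Section parametric_integral.
Context d1 d2 (X : measurableType d1) (Y : measurableType d2) (R : realType).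
Local Open Scope ereal_scope.

(** An integral against a fixed measure is one against a constant kernel. *)
Lemma measurable_sfinite_integral (mu : {measure set Y -> \bar R}) (f : X -> Y -> \bar R) :
  sfinite_measure mu -> measurable_fun setT (fun z : X * Y => f z.1 z.2) ->
  (forall x y, 0 <= f x y) -> measurable_fun setT (fun x => \int[mu]_y f x y).
Proof.
move=> smu mf f0.
have := @measurable_fun_integral_sfinite_kernel _ _ X Y R (fun z => f z.1 z.2)
  (kcst X (with_sfinite smu)).
by apply => // z.
Qed.

End parametric_integral.

Section laplace_bounds.
Context d (E : measurableType d) (R : realType).
Variable p : R.-spker (E * measurableTypeR R) ~> E.
Local Open Scope ereal_scope.
Local Notation leb := (@lebesgue_measure R).

Lemma integral_wt (a : R) : (0 < a)%R -> a%:E * \int[leb]_t (wt a t)%:E = 1.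
Proof.
move=> a0; rewrite -(integral_exponential_pdf a0) -ge0_integralZl //.
- apply: eq_integral => t _; rewrite /wt (max_l (ltW a0)).
  case: leP => t0; first by rewrite exponential_pdfE // mulNr.
  by rewrite lt0_exponential_pdf // mule0.
- by apply/measurable_EFinP; exact: measurable_wt.
- by move=> t _; rewrite lee_fin wt_ge0.
- by rewrite lee_fin ltW.
Qed.

Lemma Q1_le (t : R) x : Q p t (fun=> 1) x <= 1.
Proof. by rewrite /Q integral_cst // mul1e; exact: sprob_kernel_le1. Qed.

Lemma rpot1_le (a : R) x : (0 < a)%R -> a%:E * rpot (resolvent p) a (fun=> 1) x <= 1.
Proof.
move=> a0; rewrite -[leRHS](integral_wt a0); apply: lee_wpmul2l; first by rewrite lee_fin ltW.
have n1 : @nnm _ E R (fun=> 1) by split.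
rewrite rpotE //; apply: ge0_le_integral => //.
- by move=> t _; rewrite mule_ge0 ?lee_fin ?wt_ge0 ?Q_ge0.
- apply: emeasurable_funM; last exact: measurable_Qt.
  by apply/measurable_EFinP; exact: measurable_wt.
- by apply/measurable_EFinP; exact: measurable_wt.
- by move=> t _; rewrite -[leRHS]mule1; apply: lee_wpmul2l; rewrite ?lee_fin ?wt_ge0 // Q1_le.
Qed.

Lemma excessive_supermedian (h : E -> \bar R) : nnm h ->
  (forall (t : R) x, (0 < t)%R -> Q p t h x <= h x) -> supermedian (resolvent p) h.
Proof.
move=> nh Qh; split => // a x a0.
rewrite rpotE //.
have hx0 := nnm_ge0 x nh.
have wt0 (t : R) : (t < 0)%R -> wt a t = 0%R by move=> t0; rewrite /wt leNgt t0.
apply: (@le_trans _ _ (a%:E * \int[leb]_t ((wt a t)%:E * h x))).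
  apply: lee_wpmul2l; first by rewrite lee_fin ltW.
  apply: ae_ge0_le_integral => //.
  - by move=> t _; rewrite mule_ge0 ?lee_fin ?wt_ge0 ?Q_ge0.
  - apply: emeasurable_funM; last exact: measurable_Qt.
    by apply/measurable_EFinP; exact: measurable_wt.
  - by move=> t _; rewrite mule_ge0 ?lee_fin ?wt_ge0.
  - by apply: emeasurable_funM => //; apply/measurable_EFinP; exact: measurable_wt.
  - exists [set 0%R]; split => //; first exact: lebesgue_measure_set1.
    move=> t /= ht; apply: contrapT => /eqP t0; apply: ht => _.
    have [tlt|tgt] := ltP 0%R t; first by apply: lee_wpmul2l; [rewrite lee_fin wt_ge0|exact: Qh].
    have tl : (t < 0)%R by rewrite lt_neqAle t0.
    by rewrite (wt0 _ tl) !mul0e.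
rewrite ge0_integralZr //; last 2 first.
- by apply/measurable_EFinP; exact: measurable_wt.
- by move=> t _; rewrite lee_fin wt_ge0.
by rewrite muleA integral_wt // mul1e.
Qed.

End laplace_bounds.

Section small_sets.
Context {R : realType} {E : pmetricType R}.
Variable m : {measure set (Borel E) -> \bar R}.
Hypothesis sm : sfinite_measure m.
Variable p : R.-spker (Borel E * measurableTypeR R) ~> Borel E.
Variables (T : R -> (E -> R) -> (E -> R)).
Hypothesis hT : markov_semigroup m T.
Hypothesis assoc : forall (t : R) (h : E -> R), 0 <= t -> (forall x, 0 <= h x) -> L2 m h ->
  (exists C : R, forall x, `|h x| <= C) -> \forall x \ae m, (T t h x)%:E = Q p t (EFin \o h) x.
Variable vr : E -> R.
Hypothesis vr0 : forall x, 0 < vr x.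
Hypothesis vr2 : L2 m vr.
Local Notation nnmR := (@nnm _ (measurableTypeR R) R).
Local Notation nnm := (@nnm _ (Borel E) R).
Local Notation Q := (Q p).
Local Notation rpot := (rpot (resolvent p)).
Local Open Scope ereal_scope.
Local Notation leb := (@lebesgue_measure R).

(** The integral is the Laplace average of the scalar product of the indicator and its image by [T t],
    which is continuous at [t = 0]. *)
Lemma indic_resolvent_cvg (B : set (Borel E)) (N : nat) : measurable B ->
  (forall x, B x -> (1 <= N%:R * vr x)%R) -> m B < +oo /\
  \int[m]_x ((\1_B x)%:E * (n.+1%:R%:E * rpot n.+1%:R (fun y => (\1_B y)%:E) x))
    @[n --> \oo] --> m B.
Proof.
move=> mB BN; pose f : E -> R := \1_B.
have mf : borel_fun f by exact: measurable_indic.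
have f0 x : (0 <= f x)%R by [].
have f1 x : (f x <= 1)%R by rewrite /f indicE lern1 leq_b1.
have f2 : L2 m f.
  apply: (L2_le mf (L2_scale N%:R vr2)) => x.
  have nv : (0 <= N%:R * vr x)%R by rewrite mulr_ge0 // ltW.
  rewrite (ger0_norm (f0 x)) (ger0_norm nv) /f indicE.
  by have [|] := boolP (x \in B) => //; rewrite inE => /BN.
have fb : exists C : R, forall x, (`|f x| <= C)%R by exists 1%R => x; rewrite ger0_norm.
have nf : nnm (EFin \o f) by apply: nnm_EFin.
have mBE : m B = (ip m f f)%:E.
  rewrite /ip /Rintegral fineK; last by apply: integrable_fin_num => //; exact: L2_integrable_mul.
  transitivity (\int[m]_x (\1_B x)%:E); first by rewrite integral_indic // setIT.
  apply: eq_integral => x _.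
  by rewrite /f indicE; case: (x \in B); rewrite ?mulr1 ?mulr0.
split; first by rewrite mBE ltry.
pose psi (t : R) := \int[m]_x ((f x)%:E * Q t (EFin \o f) x).
have psiE t : (0 <= t)%R -> psi t = (ip m f (T t f))%:E.
  move=> t0; have iv := L2_integrable_mul f2 (sg_L2 hT t0 f2).
  rewrite /ip /Rintegral fineK; last exact: integrable_fin_num.
  apply: ae_eq_integral => //.
  - apply: emeasurable_funM; first exact/measurable_EFinP.
    exact: measurable_Q.
  - by have /measurable_int := iv.
  - by apply: (ae_impl _ (assoc t0 f0 f2 fb)) => x ux _; rewrite -ux /= EFinM.
have uE n : \int[m]_x ((\1_B x)%:E * (n.+1%:R%:E * rpot n.+1%:R (fun y => (\1_B y)%:E) x)) =
    n.+1%:R%:E * \int[leb]_t ((wt n.+1%:R t)%:E * psi t).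
  have nr := nnm_rpotV p n.+1%:R nf.
  rewrite -(integral_rpotE p sm n.+1%:R nf nf).
  rewrite -(nnm_integralZ m (ler0n R n.+1) (nnmM nf nr)).
  by apply: eq_integral => x _; rewrite muleCA.
have psi0 t : 0 <= psi t.
  by apply: nnm_integral_ge0; apply: nnmM => //; exact: nnm_Q.
have mpsi : measurable_fun setT psi.
  apply: (@measurable_sfinite_integral _ _ (measurableTypeR R) (Borel E) R m
    (fun t x => (f x)%:E * Q t (EFin \o f) x) sm).
    apply: emeasurable_funM.
      by apply/measurable_EFinP; exact: (measurableT_comp mf measurable_snd).
    apply: (measurableT_comp (measurable_Q2 p nf) (_ : measurable_fun setT (fun z => (z.2, z.1)))).
    exact: measurable_fun_pair.
  by move=> t x; rewrite mule_ge0 ?lee_fin ?Q_ge0.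
have ub n : n.+1%:R%:E * \int[leb]_t ((wt n.+1%:R t)%:E * psi t) <= m B.
  rewrite -uE.
  have nr := nnm_rpotV p n.+1%:R nf.
  apply: (@le_trans _ _ (\int[m]_x (f x)%:E)); last by rewrite integral_indic // setIT.
  apply: nnm_le_integral => [||x] //.
    by apply: nnmM => //; apply: nnmZ.
  rewrite -[leRHS]mule1; apply: lee_wpmul2l; first by rewrite lee_fin.
  have n0 : (0 < n.+1%:R :> R)%R by [].
  apply: le_trans (rpot1_le p x n0); apply: lee_wpmul2l; first by rewrite lee_fin.
  by apply: le_rpot => // y; rewrite lee_fin; exact: f1.
under eq_fun do rewrite uE.
set u := fun n : nat => _.
have lb (e : R) : (0 < e)%R -> \forall n \near \oo, m B - u n <= e%:E.
  move=> e0; pose c := ip m f f.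
  have c0 : (0 <= c)%R by exact: ip_ge0.
  have ee : (0 < e / 2)%R by rewrite divr_gt0.
  pose e' := (e / 2 / (norm2 m f + 1))%R.
  have nf0 := norm2_ge0 m f.
  have e'0 : (0 < e')%R by rewrite divr_gt0 // ltr_wpDl.
  have /cvgrPdist_lt /(_ _ e'0) := sg_cont hT f2.
  move=> /nbhs_ballP[d /= d0 dP].
  pose dd := (d / 2)%R; have dd0 : (0 < dd)%R by rewrite divr_gt0.
  have psi_ge (t : R) : (0 <= t <= dd)%R -> (c - e / 2)%:E <= psi t.
    move=> /andP[t0 td]; rewrite psiE // lee_fin.
    have hTt := sg_L2 hT t0 f2.
    suff : (`|ip m f (fun x => T t f x - f x)| <= e / 2)%R.
      by rewrite ipBr // ler_norml => /andP[+ _]; rewrite /c; lra.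
    have hd := L2B hTt f2.
    apply: (le_trans (cauchy_schwarz f2 hd)).
    have -> : (e / 2 = (norm2 m f + 1) * e')%R by rewrite /e'; field; rewrite gt_eqF // ltr_wpDl.
    apply: ler_pM => //; rewrite ?norm2_ge0 ?lerDl //.
    move: t0; rewrite le_eqVlt => /predU1P[<-|t0].
      rewrite (norm2_ae (u' := fun=> 0%R)) //.
      + rewrite /norm2 /ip (_ : (fun _ => _) = fun=> 0%R); last by apply/funext => x; rewrite mulr0.
        by rewrite /Rintegral integral0 sqrtr0 ltW.
      + exact: L2B (sg_L2 hT (lexx 0%R) f2) f2.
      + exact: L2_0.
      + by apply: (ae_impl _ (sg0 hT f2)) => x ->; rewrite subrr.
    have tb : ball 0%R d t.
      rewrite /ball /= sub0r normrN gtr0_norm //; apply: (le_lt_trans td).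
      by rewrite /dd ltr_pdivrMr // ltr_pMr // ltr1n.
    have := dP t tb t0; rewrite sub0r normrN ger0_norm ?norm2_ge0 // => /ltW; exact.
  have ufin n : u n \is a fin_num.
    rewrite ge0_fin_numE; first by rewrite (le_lt_trans (ub n)) // mBE ltry.
    rewrite mule_ge0 ?lee_fin // integral_ge0 // => t _.
    by rewrite mule_ge0 ?lee_fin ?wt_ge0.
  have key n : ((c - e / 2) * (1 - expR (- (n.+1%:R * dd))) <= fine (u n))%R.
    have n0 : (0 < n.+1%:R :> R)%R by [].
    have x1 : (expR (- (n.+1%:R * dd)) <= 1)%R.
      by rewrite -expR0 ler_expR oppr_le0 mulr_ge0 // ltW.
    have u0 : (0 <= fine (u n))%R.
      rewrite fine_ge0 // mule_ge0 ?lee_fin // integral_ge0 // => t _.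
      by rewrite mule_ge0 ?lee_fin ?wt_ge0.
    have [c1|/ltW c1] := leP (c - e / 2)%R 0%R.
      by apply: le_trans u0; rewrite mulr_le0_ge0 // subr_ge0.
    rewrite -lee_fin fineK // EFinM -(integral_expR n0 (ltW dd0)) muleCA.
    apply: lee_wpmul2l; first by rewrite lee_fin.
    pose I (t : R) := (if (0 <= t <= dd)%R then expR (- (n.+1%:R * t)) else 0)%R.
    have I0 t : (0 <= I t)%R by rewrite /I; case: ifP => // _; exact: expR_ge0.
    have mI : measurable_fun setT I.
      apply: measurable_fun_ifT => //.
      + by apply: measurable_and; exact: measurable_fun_ler.
      + by apply: (measurableT_comp (@measurable_expR R)); apply: measurableT_comp.
    have nI : nnmR (fun t => (I t)%:E) by exact: nnm_EFin.
    rewrite -(nnm_integralZ leb c1 nI); apply: nnm_le_integral => [||t].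
    - exact: nnmZ.
    - split; last by move=> t; rewrite mule_ge0 ?lee_fin ?wt_ge0.
      by apply: emeasurable_funM => //; apply/measurable_EFinP; exact: measurable_wt.
    - rewrite /I /wt; case: ifPn => [tI|_]; last by rewrite mule0 mule_ge0 ?lee_fin ?wt_ge0.
      have /andP[t0 _] := tI; rewrite t0 (max_l (ltW n0)) muleC.
      by apply: lee_wpmul2l; [rewrite lee_fin expR_ge0|exact: psi_ge].
  exists (Num.truncn (c / (dd * (e / 2)))).+1 => // n /= Nn.
  rewrite mBE -(fineK (ufin n)) -EFinB lee_fin.
  apply: (@le_trans _ _ (c - (c - e / 2) * (1 - expR (- (n.+1%:R * dd))))%R).
    by rewrite lerD2l lerN2; exact: key.
  set x := expR _.
  have x0 : (0 <= x)%R by exact: expR_ge0.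
  suff cx : (c * x <= e / 2)%R by nra.
  have nd : (0 < n.+1%:R * dd)%R by rewrite mulr_gt0.
  have cn : (c <= n.+1%:R * dd * (e / 2))%R.
    rewrite -mulrA -ler_pdivrMr ?mulr_gt0 // (le_trans (ltW (truncnS_gt _))) // ler_nat.
    exact: (leq_trans Nn).
  have xy : (x * (n.+1%:R * dd) <= 1)%R.
    rewrite /x expRN mulrC ler_pdivrMr ?expR_gt0 // mul1r.
    by have := expR_ge1Dx (n.+1%:R * dd); lra.
  apply: (@le_trans _ _ (n.+1%:R * dd * (e / 2) * x)%R); first by rewrite ler_wpM2r.
  rewrite mulrAC (mulrC _ x) -[leRHS]mul1r; apply: ler_wpM2r xy; exact: ltW.
have l0 : m B - u n @[n --> \oo] --> 0.
  by apply: cvge0_le => // n; rewrite sube_ge0 ?ub // ?mBE // orbT.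
have ufin n : u n \is a fin_num.
  rewrite ge0_fin_numE; first by rewrite (le_lt_trans (ub n)) // mBE ltry.
  rewrite mule_ge0 ?lee_fin // integral_ge0 // => t _.
  by rewrite mule_ge0 ?lee_fin ?wt_ge0.
have mBfin : m B \is a fin_num by rewrite mBE.
have uu : u = (fun n => m B - (m B - u n)).
  by apply/funext => n; rewrite mBE -(fineK (ufin n)) -!EFinB subKr.
have lim : m B - (m B - u n) @[n --> \oo] --> m B - 0.
  by apply: cvgeB; [exact: fin_num_adde_defr|exact: cvg_cst|exact: l0].
by rewrite sube0 in lim; rewrite uu.
Qed.
End small_sets.

(** * Potentials and excessive functions of the process *)

Section sigma_finite_weight.
Context d (T : measurableType d) (R : realType) (mu : {measure set T -> \bar R}).

Lemma weight_sfinite (h : T -> R) : measurable_fun setT h -> (forall x, 0 < h x) ->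
  (\int[mu]_x (h x)%:E < +oo)%E -> sfinite_measure mu.
Proof.
move=> mh h0 hint; apply: sfinite_measure_sigma_finite.
have ms (n : nat) : measurable [set x | 1 <= n%:R * h x].
  rewrite -[X in measurable X]setTI.
  have mn : measurable_fun setT (fun x => n%:R * h x) by exact: measurable_funM.
  have := mn measurableT _ (measurable_itv `[1, +oo[).
  by congr measurable; apply/seteqP; split => x /=; rewrite in_itv /= andbT.
exists (fun n => [set x | 1 <= n%:R * h x]).
  apply/esym/seteqP; split=> // x _; exists (Num.truncn (h x)^-1).+1 => //=.
  by rewrite -ler_pdivrMr // div1r ltW // truncnS_gt.
move=> n; split => //.
have nh := nnm_EFin mh (fun x => ltW (h0 x)).
apply: (@le_lt_trans _ _ (n%:R%:E * \int[mu]_x (h x)%:E)%E); last first.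
  rewrite -(fineK (_ : (\int[mu]_x (h x)%:E)%E \is a fin_num)) -?EFinM ?ltry //.
  by rewrite ge0_fin_numE //; exact: nnm_integral_ge0.
have -> : mu [set x | 1 <= n%:R * h x] = (\int[mu]_x (\1_[set x | 1 <= n%:R * h x] x)%:E)%E.
  by rewrite integral_indic // setIT.
rewrite -(nnm_integralZ mu (ler0n R n) nh).
apply: nnm_le_integral => [||x].
- by apply: nnm_EFin => //; exact: measurable_indic.
- exact: nnmZ.
rewrite -EFinM lee_fin indicE; have [|_] := boolP (x \in _); first by rewrite inE.
by rewrite mulr_ge0 // ltW.
Qed.

Lemma ae_eq_of_integral (f g : T -> \bar R) : nnm f -> nnm g -> (forall x, g x <= f x)%E ->
  (forall x, g x \is a fin_num) ->
  (\int[mu]_x f x = \int[mu]_x g x)%E -> (\int[mu]_x g x < +oo)%E ->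
  \forall x \ae mu, (f x - g x = 0)%E.
Proof.
move=> nf ng gf gfin fg gint.
have nfg : nnm (fun x => f x - g x)%E.
  split; last by move=> x; rewrite sube_ge0 ?gfin ?orbT.
  by apply: emeasurable_funB; exact: nnm_meas.
have gi : (\int[mu]_x g x)%E \is a fin_num.
  by rewrite ge0_fin_numE //; exact: nnm_integral_ge0.
have I0 : (\int[mu]_x (f x - g x) = 0)%E.
  have D : (\int[mu]_x (f x - g x) + \int[mu]_x g x = \int[mu]_x f x)%E.
    by rewrite -nnm_integralD //; apply: eq_integral => x _; rewrite subeK.
  by move: D; rewrite fg => D; rewrite -(addeK (\int[mu]_x (f x - g x))%E gi) D subee.
have mfg : measurable_fun setT (fun x => f x - g x)%E by exact: nnm_meas.
have : (\int[mu]_x `|f x - g x| = 0)%E.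
  by rewrite -I0; apply: eq_integral => x _; rewrite gee0_abs //; exact: (nnm_ge0 x nfg).
by move=> /(ae_eq_integral_abs mu measurableT mfg) h; apply: filterS h => x /(_ I).
Qed.

End sigma_finite_weight.

Section hunt_resolvent.
Context {R : realType} {E : pmetricType R}.
Hypothesis hE : locally_compact [set: E].
Hypothesis hsep : separable E.
Variable XX : hunt_process E.
Local Open Scope ereal_scope.
Local Notation nnmR := (@nnm _ (measurableTypeR R) R).
Local Notation nnm := (@nnm _ (Borel E) R).
Local Notation p := (transition hE hsep XX).
Local Notation V := (resolvent p).
Local Notation leb := (@lebesgue_measure R).

Lemma integral_position (h : E -> \bar R) (z : (Borel E * measurableTypeR R) * Omega XX) : nnm h ->
  \int[position z]_y h y = ext h (path_at (z.1.2, z.2)).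
Proof.
move=> [mh h0]; rewrite /position.
case: (path_at _) => [y|] /=; first by rewrite integral_dirac // diracT mul1e.
by rewrite integral_measure_zero.
Qed.

(** Tonelli between paths and time, by joint measurability of the paths. *)
Lemma Rpot_rpot (h : E -> \bar R) (x : E) : nnm h -> Rpot XX h x = rpot V 0 h x.
Proof.
move=> nh; have [mh h0] := nh.
have wt01 (t : R) : (0 <= t)%R -> wt 0 t = 1%R.
  by move=> t0; rewrite /wt t0 maxxx mul0r oppr0 expR0.
have wt0n (t : R) : (t < 0)%R -> wt 0 t = 0%R by move=> t0; rewrite /wt leNgt t0.
pose f (w : Omega XX) (t : measurableTypeR R) := (wt 0 t)%:E * \int[position ((x : Borel E, t), w)]_y h y.
have f0 w t : 0 <= f w t by rewrite mule_ge0 ?lee_fin ?wt_ge0 // integral_ge0.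
have mf : measurable_fun setT (fun z : Omega XX * measurableTypeR R => f z.1 z.2).
  apply: emeasurable_funM.
    by apply/measurable_EFinP; exact: (measurableT_comp (measurable_wt 0%R) measurable_snd).
  have mp := measurable_fun_integral_kernel (measurable_position hE hsep (XX := XX)) h0 mh.
  apply: (measurableT_comp mp (_ : measurable_fun setT
    (fun z : Omega XX * measurableTypeR R => ((x : Borel E, z.2), z.1)))).
  apply: measurable_fun_pair => //; exact: measurable_fun_pair.
transitivity (\int[pr XX (Some x)]_w \int[leb]_t f w t).
  apply: eq_integral => w _; rewrite integral_mkcond; apply: eq_integral => t _.
  rewrite /f integral_position // patchE /path_at /=.
  have [t0|t0] := leP 0%R (t : R).
    by rewrite wt01 // mul1e mem_set //= in_itv /= t0.
  by rewrite wt0n // mul0e memNset //= in_itv /= andbT leNgt t0.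
rewrite (tonelli _ _ mf f0); last 2 first.
- exact: sfinite_kernel_measure.
- exact: s_finite.
rewrite rpotE //; apply: eq_integral => t _; have [t0|t0] := leP 0%R (t : R); last first.
  by rewrite /f wt0n // mul0e integral0_eq // => w _; exact: mul0e.
rewrite [Q _ _ _ _](transition_Pt hE hsep XX x t0 nh) /f ge0_integralZl //; last 3 first.
- have mp := measurable_fun_integral_kernel (measurable_position hE hsep (XX := XX)) h0 mh.
  apply: (measurableT_comp mp (_ : measurable_fun setT
    (fun w : Omega XX => ((x : Borel E, t : measurableTypeR R), w)))).
  exact: measurable_fun_pair.
- by move=> w _; exact: integral_ge0.
- by rewrite lee_fin wt_ge0.
congr (_ * _); apply: eq_integral => w _.
by rewrite integral_position // /path_at /= max_l.
Qed.

Lemma Q_Pt (t : R) (h : E -> \bar R) (x : E) : (0 <= t)%R -> nnm h -> Q p t h x = Pt XX t h x.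
Proof. by move=> t0 nh; exact: transition_Pt. Qed.

Lemma Q_semigroup (s t : R) (h : E -> \bar R) (x : E) : (0 <= s)%R -> (0 <= t)%R -> nnm h ->
  Q p s (Q p t h) x = Q p (s + t)%R h x.
Proof. by move=> s0 t0 nh; exact: transition_semigroup. Qed.

Lemma excessive_nnm (h : E -> \bar R) : excessive XX h -> nnm h.
Proof. by move=> []. Qed.

Lemma excessive_Q_le (h : E -> \bar R) (t : R) (x : E) : excessive XX h -> (0 < t)%R ->
  Q p t h x <= h x.
Proof.
move=> eh t0; have nh := excessive_nnm eh; have [_ _ h2] := eh.
by rewrite -h2 (Q_Pt x (ltW t0) nh); apply: ereal_sup_ubound; exists t.
Qed.

Lemma le_Q (t : R) (h k : E -> \bar R) x : nnm h -> nnm k -> (forall y, h y <= k y) ->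
  Q p t h x <= Q p t k x.
Proof. by move=> nh nk hk; exact: nnm_le_integral. Qed.

Lemma Q_decr (h : E -> \bar R) (s t : R) (x : E) : nnm h ->
  (forall (t : R) x, (0 < t)%R -> Q p t h x <= h x) ->
  (0 <= s)%R -> (s < t)%R -> Q p t h x <= Q p s h x.
Proof.
move=> nh Qh s0 st.
have ts : (0 < t - s)%R by rewrite subr_gt0.
have -> : t = (s + (t - s))%R by rewrite addrC subrK.
rewrite -(Q_semigroup x s0 (ltW ts) nh); apply: le_Q => //; first exact: nnm_Q.
by move=> y; exact: Qh.
Qed.

Lemma excessive_Q_decr (h : E -> \bar R) (s t : R) (x : E) : excessive XX h ->
  (0 <= s)%R -> (s < t)%R -> Q p t h x <= Q p s h x.
Proof.
move=> eh; apply: Q_decr; first exact: excessive_nnm.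
by move=> r y; exact: excessive_Q_le.
Qed.

(** The function [t -> Q t h x] is nonincreasing, so it is at least [Q s h x] on the interval from 0 to
    [s], which has mass [1 - exp (- a s)] for the Laplace average. *)
Lemma Q_le_rpot (h : E -> \bar R) (s a : R) (x : E) : nnm h ->
  (forall (t : R) x, (0 < t)%R -> Q p t h x <= h x) -> (0 < s)%R -> (0 < a)%R ->
  (1 - expR (- (a * s)))%:E * Q p s h x <= a%:E * rpot V a h x.
Proof.
move=> nh Qh s0 a0; rewrite -(integral_expR a0 (ltW s0)) -muleA.
apply: lee_wpmul2l; first by rewrite lee_fin ltW.
pose I (t : R) := (if (0 <= t <= s)%R then expR (- (a * t)) else 0)%R.
have I0 t : (0 <= I t)%R by rewrite /I; case: ifP => // _; exact: expR_ge0.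
have mI : measurable_fun setT I.
  apply: measurable_fun_ifT => //.
  + by apply: measurable_and; exact: measurable_fun_ler.
  + by apply: (measurableT_comp (@measurable_expR R)); apply: measurableT_comp.
have nI : nnmR (fun t => (I t)%:E) by exact: nnm_EFin.
have [mi i0] := nI; rewrite -ge0_integralZr //; last exact: Q_ge0.
  2: by move=> t _; exact: (i0 t).
rewrite (rpotE p a x nh); apply: nnm_le_integral => [||t].
- split; first by apply: emeasurable_funM.
  by move=> t; apply: mule_ge0; [exact: (i0 t)|exact: Q_ge0].
- split; last by move=> t; rewrite mule_ge0 ?lee_fin ?wt_ge0 ?Q_ge0.
  apply: emeasurable_funM; last exact: measurable_Qt.
  by apply/measurable_EFinP; exact: measurable_wt.
case: ifPn => [/andP[t0 ts]|_]; last first.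
  by rewrite mul0e mule_ge0 ?lee_fin ?wt_ge0 ?Q_ge0.
rewrite /wt t0 (max_l (ltW a0)); apply: lee_wpmul2l; first by rewrite lee_fin expR_ge0.
by move: ts; rewrite le_eqVlt => /predU1P[->//|ts]; exact: Q_decr.
Qed.

(** The index of the resolvent tends to infinity in [Q_le_rpot]. *)
Lemma Q_le_of_rpot_le (h : E -> \bar R) (s c : R) (x : E) : nnm h ->
  (forall (t : R) x, (0 < t)%R -> Q p t h x <= h x) -> (0 < s)%R ->
  (forall n : nat, n.+1%:R%:E * rpot V n.+1%:R h x <= c%:E) -> Q p s h x <= c%:E.
Proof.
move=> nh Qh s0 hc.
have H (n : nat) : (1 - expR (- (n.+1%:R * s)))%:E * Q p s h x <= c%:E.
  have n0 : (0 < n.+1%:R :> R)%R by [].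
  exact: le_trans (Q_le_rpot x nh Qh s0 n0) (hc n).
have xn (n : nat) : (0 < 1 - expR (- (n.+1%:R * s)))%R.
  by rewrite subr_gt0 -expR0 ltr_expR oppr_lt0 mulr_gt0.
have := Q_ge0 p s x nh; case: (Q p s h x) H => [q H q0|H _|//]; last first.
  by have := H 0%N; rewrite gt0_muley ?lte_fin.
rewrite lee_fin in q0; rewrite lee_fin; apply/ler_addgt0Pr => e e0.
have es : (0 < e * s)%R by rewrite mulr_gt0.
pose n := Num.truncn (q / (e * s)).
have := H n; rewrite -EFinM lee_fin => Hn.
set y := expR _ in Hn.
have y0 : (0 < y)%R by exact: expR_gt0.
have qn : (q <= n.+1%:R * s * e)%R.
  by rewrite -mulrA (mulrC s) -ler_pdivrMr // ltW // truncnS_gt.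
have yn : (n.+1%:R * s * y <= 1)%R.
  rewrite /y expRN ler_pdivrMr ?expR_gt0 // mul1r.
  by have := expR_ge1Dx (n.+1%:R * s); lra.
have qy : (q * y <= e)%R.
  apply: (@le_trans _ _ (n.+1%:R * s * e * y)%R); first by rewrite ler_wpM2r // ltW.
  by rewrite mulrAC -[leRHS]mul1r; apply: ler_wpM2r => //; exact: ltW.
by move: Hn; rewrite mulrBl mul1r mulrC; lra.
Qed.

Lemma excessive_rpot_supermedian (h : E -> \bar R) : excessive XX h -> supermedian V h.
Proof.
move=> eh; apply: excessive_supermedian; first exact: excessive_nnm.
by move=> t x t0; exact: excessive_Q_le.
Qed.

Lemma excessive_Q_cvg (h : E -> \bar R) (x : E) : excessive XX h ->
  Q p n.+1%:R^-1 h x @[n --> \oo] --> h x.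
Proof.
move=> eh; have nh := excessive_nnm eh; have [_ _ h2] := eh.
have nd : {homo (fun n : nat => Q p n.+1%:R^-1 h x) : n k / (n <= k)%N >-> n <= k}.
  move=> n k; rewrite leq_eqVlt => /predU1P[->//|nk].
  by apply: excessive_Q_decr => //; rewrite ltf_pV2 ?posrE // ltr_nat.
rewrite [X in _ --> X](_ : _ = ereal_sup (range (fun n : nat => Q p n.+1%:R^-1 h x))).
  exact: ereal_nondecreasing_cvgn.
apply/eqP; rewrite eq_le; apply/andP; split; last first.
  by apply: ge_ereal_sup => _ [n _ <-]; exact: excessive_Q_le.
rewrite -h2; apply: ge_ereal_sup => _ [t /= t0 <-].
have [N _ /(_ N (leqnn N)) /= Nt] := near_infty_natSinv_lt (PosNum t0).
apply: (@le_trans _ _ (Q p N.+1%:R^-1 h x)); last by apply: ereal_sup_ubound; exists N.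
by rewrite -(Q_Pt x (ltW t0) nh); exact: excessive_Q_decr.
Qed.

(** A strictly positive excessive function rules out immediate killing, and then the process spends a
    positive time in [E]. *)
Lemma potential_gt0 (rho vr : E -> R) (x : E) : excessive XX (EFin \o rho) ->
  (forall y, (0 < rho y)%R) -> borel_fun vr -> (forall y, (0 < vr y)%R) ->
  0 < rpot V 0 (EFin \o vr) x.
Proof.
move=> erho rho0 mvr vr0.
have nrho := excessive_nnm erho.
have nvr : nnm (EFin \o vr) by apply: nnm_EFin => // y; exact: ltW.
rewrite lt_neqAle eq_sym; apply/andP; split; last by apply: rpot_ge0 => y; rewrite lee_fin ltW.
apply/eqP => R0.
have [n Qn] : exists n : nat, 0 < Q p n.+1%:R^-1 (EFin \o rho) x.
  apply: contrapT => /forallNP h; have l := @excessive_Q_cvg _ x erho.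
  have e : (fun n : nat => Q p n.+1%:R^-1 (EFin \o rho) x) = fun=> 0.
    by apply/funext => n; apply/eqP; rewrite eq_le Q_ge0 // andbT leNgt; apply/negP; exact: h.
  rewrite e in l; have l0 : (fun _ : nat => 0 : \bar R) n @[n --> \oo] --> (0 : \bar R).
    exact: cvg_cst.
  have r0 : (EFin \o rho) x = 0 by apply: (cvg_unique _ l l0).
  by have := rho0 x; rewrite -lte_fin -[(rho x)%:E]/((EFin \o rho) x) r0 ltxx.
have Qt (t : R) : (0 < t < n.+1%:R^-1)%R -> Q p t (EFin \o vr) x != 0.
  move=> /andP[t0 tn]; apply/eqP => q0.
  have := lt_le_trans Qn (@excessive_Q_decr _ _ _ x erho (ltW t0) tn).
  suff -> : Q p t (EFin \o rho) x = 0 by rewrite ltxx.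
  have mQ : measurable_fun setT (EFin \o vr : Borel E -> \bar R) by case: nvr.
  have : \int[p (x, t)]_y `|(EFin \o vr) y| = 0.
    by rewrite -[RHS]q0; apply: eq_integral => y _; rewrite gee0_abs // lee_fin ltW.
  move=> /(ae_eq_integral_abs _ measurableT mQ) h.
  rewrite /Q (ae_eq_integral (fun=> 0)) ?integral0 //; first by case: nrho.
  by apply: filterS h => y /= /(_ I) [] vy; have := vr0 y; rewrite vy ltxx.
move: R0; rewrite rpotE // => R0.
have mF : measurable_fun setT (fun t : measurableTypeR R => (wt 0 t)%:E * Q p t (EFin \o vr) x).
  apply: emeasurable_funM; last exact: measurable_Qt.
  by apply/measurable_EFinP; exact: measurable_wt.
have : \int[leb]_t `|(wt 0 t)%:E * Q p t (EFin \o vr) x| = 0.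
  rewrite -[RHS]R0; apply: eq_integral => t _; rewrite gee0_abs //.
  by rewrite mule_ge0 ?Q_ge0 // lee_fin wt_ge0.
move=> /(ae_eq_integral_abs _ measurableT mF) [N [mN N0 hN]].
have e0 : (0 < n.+1%:R^-1 :> R)%R by rewrite invr_gt0.
move: (n.+1%:R^-1 : R)%R e0 Qt => e e0 Qt.
have : leb `]0%R, e[%classic <= leb N.
  apply: le_measure; rewrite ?inE //.
  move=> t /=; rewrite in_itv /= => te; apply: hN => /= /(_ I) /eqP.
  rewrite mule_eq0 (negbTE (Qt t te)) orbF => /eqP[].
  rewrite /wt; have /andP[/ltW -> _] := te.
  by apply/eqP; rewrite gt_eqF // expR_gt0.
have -> : leb N = 0 by exact: N0.
by rewrite lebesgue_measure_itv /= lte_fin e0 -EFinB lee_fin subr0 leNgt e0.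
Qed.
End hunt_resolvent.

(** * Potentials of measures *)

Section green_potentials.
Context {R : realType} {E : pmetricType R}.
Hypothesis hE : locally_compact [set: E].
Hypothesis hsep : separable E.
Variable XX : hunt_process E.
Local Open Scope ereal_scope.
Local Notation nnm := (@nnm _ (Borel E) R).
Local Notation p := (transition hE hsep XX).
Local Notation V := (resolvent p).
Variable m : {measure set (Borel E) -> \bar R}.
Hypothesis sm : sfinite_measure m.
Hypothesis HV : sym_resolvent m V.
Variable G : E -> E -> \bar R.
Hypothesis hG : is_green XX m G.

Let mG : measurable_fun [set: Borel E * Borel E] (fun z => G z.1 z.2).
Proof. by case: hG. Qed.

Let G_excessivel y : excessive XX (G ^~ y). Proof. by case: hG. Qed.
Let G_excessiver x : excessive XX (G x). Proof. by case: hG. Qed.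
Let G0 x y : 0 <= G x y.
Proof. by have [_ + _] := G_excessiver x; apply. Qed.

Lemma rpot0_green h (x : E) : nnm h -> rpot V 0 h x = \int[m]_y (G x y * h y).
Proof.
by move=> nh; have [mh h0] := nh; rewrite -Rpot_rpot //; case: hG => _ _ _; apply.
Qed.

Lemma measurable_green_potential (nu : {measure set (Borel E) -> \bar R}) :
  sfinite_measure nu -> nnm (fun x => \int[nu]_y G x y).
Proof.
move=> snu; split; last by move=> x; exact: integral_ge0.
exact: (@measurable_sfinite_integral _ _ (Borel E) (Borel E) R nu G snu mG).
Qed.

Lemma green_potential_supermedian (nu : {measure set (Borel E) -> \bar R}) :
  sfinite_measure nu -> supermedian V (fun x => \int[nu]_y G x y).
Proof.
move=> snu; split => [|a x a0]; first exact: measurable_green_potential.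
have sV : sfinite_measure (V a x) by exact: (sfinite_kernel_measure (mkcomp _ _)).
rewrite /rpot (tonelli sV snu mG) //.
have nGa : nnm (fun y => rpot V a (G ^~ y) x).
  have mG' : measurable_fun [set: Borel E * Borel E] (fun z => G z.2 z.1).
    exact: (measurableT_comp mG (measurable_fun_pair measurable_snd measurable_fst)).
  split; last by move=> y; exact: integral_ge0.
  exact: (@measurable_sfinite_integral _ _ (Borel E) (Borel E) R _ (fun y z => G z y) sV mG').
rewrite -[X in _ * X]/(\int[nu]_y rpot V a (G ^~ y) x).
rewrite -(nnm_integralZ nu (ltW a0) nGa); apply: nnm_le_integral => [||y].
- exact: (nnmZ (ltW a0) nGa).
- by split => //; have [] := G_excessiver x.
- by have [_] := excessive_rpot_supermedian hE hsep (G_excessivel y); apply.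
Qed.

Variables vr rho w : E -> R.
Variable C : R.
Hypothesis mvr : borel_fun vr.
Hypothesis vr0 : forall x, (0 < vr x)%R.
Hypothesis vr1 : \int[m]_x (vr x)%:E < +oo.
Hypothesis wE : forall x, rpot V 0 (fun y => (vr y)%:E) x = (w x)%:E.
Hypothesis wC : forall x, (w x <= C)%R.
Hypothesis erho : excessive XX (EFin \o rho).
Hypothesis wrho : \forall x \ae m, (w x <= rho x)%R.

(** The potential of [vr] in the second variable of the Green function; integrating it against a
    measure is integrating [vr] against the potential of the measure. *)
Definition dual_potential (y : E) : \bar R := \int[m]_x ((vr x)%:E * G x y).

Let nvr : nnm (fun x => (vr x)%:E).
Proof. by apply: nnm_EFin => // x; exact: ltW. Qed.

Let mvrG : measurable_fun [set: Borel E * Borel E] (fun z => (vr z.1)%:E * G z.1 z.2).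
Proof.
by apply: emeasurable_funM => //; apply/measurable_EFinP; exact: (measurableT_comp mvr measurable_fst).
Qed.

Lemma nnm_dual_potential : nnm dual_potential.
Proof.
have mG' : measurable_fun [set: Borel E * Borel E] (fun z => (vr z.2)%:E * G z.2 z.1).
  exact: (measurableT_comp mvrG (measurable_fun_pair measurable_snd measurable_fst)).
split; last by move=> y; apply: integral_ge0 => x _; rewrite mule_ge0 ?lee_fin // ltW.
apply: (@measurable_sfinite_integral _ _ (Borel E) (Borel E) R _ (fun y x => (vr x)%:E * G x y) sm mG').
by move=> y x; rewrite mule_ge0 ?lee_fin // ltW.
Qed.

Lemma integral_dual_potential h : nnm h ->
  \int[m]_y (h y * dual_potential y) = \int[m]_y (h y * (w y)%:E).
Proof.
move=> nh; have [mh h0] := nh.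
have mf : measurable_fun [set: Borel E * Borel E] (fun z => h z.2 * ((vr z.1)%:E * G z.1 z.2)).
  by apply: emeasurable_funM => //; exact: (measurableT_comp mh measurable_snd).
transitivity (\int[m]_y \int[m]_x (h y * ((vr x)%:E * G x y))).
  apply: eq_integral => y _; rewrite /dual_potential.
  have nG : nnm (fun x => (vr x)%:E * G x y) by apply: nnmM => //; exact: excessive_nnm.
  have [mg g0] := nG; exact/esym/ge0_integralZl.
pose f x y := h y * ((vr x)%:E * G x y).
have f0 x y : 0 <= f x y by rewrite !mule_ge0 ?lee_fin // ltW.
transitivity (\int[m]_x \int[m]_y f x y).
  by symmetry; exact: (@tonelli _ _ (Borel E) (Borel E) R m m f sm sm mf f0).
transitivity (\int[m]_x ((vr x)%:E * rpot V 0 h x)); last first.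
  by rewrite (res_sym HV (lexx 0%R) nh nvr); apply: eq_integral => x _; rewrite wE.
apply: eq_integral => x _; rewrite rpot0_green // /f.
have nG : nnm (fun y => G x y * h y) by apply: nnmM => //; exact: excessive_nnm.
have [mg g0] := nG; rewrite -ge0_integralZl ?lee_fin ?(ltW (vr0 x)) //.
by apply: eq_integral => y _; rewrite muleC -muleA.
Qed.

(** By symmetry of the resolvent the two sides have the same integral against every [h]. *)
Lemma dual_potential_ae : \forall y \ae m, dual_potential y <= (w y)%:E.
Proof.
have [nw _] := supermedian_w HV mvr vr0 wE.
have nd := nnm_dual_potential.
pose D := [set y | (w y)%:E < dual_potential y].
have mD : measurable (D : set (Borel E)).
  rewrite -[X in measurable X]setTI.
  by apply: (emeasurable_fun_lt measurableT); [case: nw|case: nd].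
pose k y := (\1_D y * vr y)%R.
have k0 y : (0 <= k y)%R by rewrite mulr_ge0 // ltW.
have mk : borel_fun k by apply: measurable_funM => //; exact: measurable_indic.
have nk : nnm (fun y => (k y)%:E) by exact: nnm_EFin.
have kE y : D y -> k y = vr y by move=> Dy; rewrite /k indicE mem_set // mul1r.
have kN y : ~ D y -> k y = 0%R by move=> Dy; rewrite /k indicE memNset // mul0r.
have w0 y : (0 <= w y)%R by rewrite -lee_fin; exact: (nnm_ge0 (y : Borel E) nw).
have : \forall y \ae m, (k y)%:E * dual_potential y - (k y)%:E * (w y)%:E = 0.
  apply: (@ae_eq_of_integral _ (Borel E) R m (fun y => (k y)%:E * dual_potential y)
    (fun y => (k y)%:E * (w y)%:E)).
  - exact: nnmM.
  - exact: nnmM.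
  - move=> y; have [Dy|nDy] := pselect (D y); last by rewrite kN // !mul0e.
    by apply: lee_wpmul2l; [rewrite lee_fin|exact: ltW].
  - by move=> y; rewrite -EFinM.
  - exact: integral_dual_potential.
  - apply: (@le_lt_trans _ _ (C%:E * \int[m]_x (vr x)%:E)).
      have C0 : (0 <= C)%R by apply: le_trans (wC point).
      rewrite -(nnm_integralZ m C0 nvr); apply: nnm_le_integral => [||y].
      + exact: nnmM.
      + exact: nnmZ.
      rewrite -!EFinM lee_fin mulrC; apply: ler_pM => //.
      by rewrite /k indicE; case: (y \in D); rewrite ?mul1r // mul0r ltW.
    rewrite -(fineK (_ : \int[m]_x (vr x)%:E \is a fin_num)) -?EFinM ?ltry //.
    by rewrite ge0_fin_numE //; exact: nnm_integral_ge0.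
apply: ae_impl => y; rewrite leNgt => h; apply/negP => Dy; move: h; rewrite kE //.
have vy := vr0 y; move: Dy; rewrite /D /=.
case: (dual_potential y) => [d| |//].
  by rewrite lte_fin -!EFinM -EFinB => wd [] /eqP; rewrite -mulrBr mulf_eq0 !gt_eqF ?subr_gt0.
by move=> _; rewrite gt0_muley ?lte_fin.
Qed.

(** The Green function is a density for the potential kernel, so the latter does not charge null
    sets; the kernels of positive index are smaller. *)
Lemma rpot_negligible (a : R) (h k : E -> \bar R) (y : E) : (0 <= a)%R -> nnm h -> nnm k ->
  (\forall x \ae m, h x <= k x) -> rpot V a h y <= rpot V a k y.
Proof.
move=> a0 nh nk hk.
apply: nnm_ae_le_integral => //.
have [N [mN N0 hN]] := hk; exists N; split => //.
have nN : nnm (fun x => (\1_N x)%:E) by apply: nnm_EFin => //; exact: measurable_indic.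
have V0 : rpot V 0 (fun x => (\1_N x)%:E) y = 0.
  rewrite rpot0_green //; have [mGy Gy0 _] := G_excessiver y.
  rewrite (ae_eq_integral (fun=> 0)) ?integral0 //.
    by apply: emeasurable_funM => //; case: nN.
  exists N; split => // x /= hx; apply: contrapT => nNx; apply: hx => _.
  by rewrite indicE memNset // mule0.
have -> : V a y N = rpot V a (fun x => (\1_N x)%:E) y.
  by symmetry; rewrite /rpot (integral_indic (V a y) measurableT mN) setIT.
apply/eqP; rewrite eq_le; apply/andP; split; last by apply: rpot_ge0 => x; rewrite lee_fin.
have [->|a0'] : a = 0%R \/ (0 < a)%R.
- by move: a0; rewrite le_eqVlt => /predU1P[<-|]; [left|right].
- by rewrite V0.
by rewrite -V0; exact: (le_rpot_index HV y (lexx 0%R) a0' nN).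
Qed.

(** Almost everywhere the bound follows from [dual_potential_ae], but it is needed at every point,
    since measures may charge null sets. Resolvents ignore null sets, so the bound holds at every
    point after applying [a U_a], hence after applying [Q s], and the dual potential is the limit of
    its images by [Q s] as [s] tends to 0. *)
Lemma dual_potential_le y : dual_potential y <= (rho y)%:E.
Proof.
have nd := nnm_dual_potential.
have [nrho srho] := excessive_rpot_supermedian hE hsep erho.
have [nw _] := supermedian_w HV mvr vr0 wE.
have main n : n.+1%:R%:E * rpot V n.+1%:R dual_potential y <= (rho y)%:E.
  have n0 : (0 < n.+1%:R :> R)%R by [].
  apply: le_trans (srho _ y n0); apply: lee_wpmul2l; first by rewrite lee_fin.
  apply: rpot_negligible => //.
  by apply: (ae_impl2 _ dual_potential_ae wrho) => x dx wx; apply: (le_trans dx); rewrite lee_fin.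
have Q_dual (t : R) z : Q p t dual_potential z = \int[m]_x ((vr x)%:E * Q p t (G x) z).
  have sp : sfinite_measure (p (z, t)) by exact: sfinite_kernel_measure.
  pose f x (z' : Borel E) := (vr x)%:E * G x z'.
  have f0 x z' : 0 <= f x z' by rewrite mule_ge0 ?lee_fin // ltW.
  transitivity (\int[m]_x \int[p (z, t)]_z' f x z').
    by symmetry; exact: (@tonelli _ _ (Borel E) (Borel E) R m (p (z, t)) f sm sp mvrG f0).
  apply: eq_integral => x _; have [mGx Gx0 _] := G_excessiver x.
  by rewrite /f /Q ge0_integralZl ?lee_fin ?(ltW (vr0 x)).
have nGx x : nnm (G x) by exact: excessive_nnm.
have Qint (t : R) z : nnm (fun x => (vr x)%:E * Q p t (G x) z).
  split; last by move=> x; rewrite mule_ge0 ?Q_ge0 // lee_fin ltW.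
  apply: emeasurable_funM; first exact/measurable_EFinP.
  have sp : sfinite_measure (p (z, t)) by exact: sfinite_kernel_measure.
  exact: (@measurable_sfinite_integral _ _ (Borel E) (Borel E) R _ G sp mG).
have Qle (t : R) z : (0 < t)%R -> Q p t dual_potential z <= dual_potential z.
  move=> t0; rewrite Q_dual; apply: nnm_le_integral => [||x] //.
    by apply: nnmM => //; exact: excessive_nnm.
  by apply: lee_wpmul2l; [rewrite lee_fin ltW|exact: excessive_Q_le].
have Qrho (n : nat) : Q p n.+1%:R^-1 dual_potential y <= (rho y)%:E.
  by apply: Q_le_of_rpot_le => //.
have : Q p n.+1%:R^-1 dual_potential y @[n --> \oo] --> dual_potential y.
  under eq_fun do rewrite Q_dual.
  have nd' x : {homo (fun n : nat => Q p n.+1%:R^-1 (G x) y) : n k / (n <= k)%N >-> n <= k}.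
    move=> i j; rewrite leq_eqVlt => /predU1P[->//|ij].
    by apply: excessive_Q_decr => //; rewrite ltf_pV2 ?posrE // ltr_nat.
  apply: (@cvg_nnm_integral _ (Borel E) R m (fun n x => (vr x)%:E * Q p n.+1%:R^-1 (G x) y)
    (fun x => (vr x)%:E * G x y)).
  - by move=> n; exact: Qint.
  - by move=> x i j ij; apply: lee_wpmul2l; [rewrite lee_fin ltW|exact: nd'].
  - by move=> x; apply: cvgeZl => //; exact: excessive_Q_cvg.
by move=> h; apply: (cvge_to_le h); exact: nearW.
Qed.

Lemma green_potential_integrable (nu : {measure set (Borel E) -> \bar R}) :
  sfinite_measure nu -> \int[nu]_y (rho y)%:E < +oo ->
  \int[m]_x ((vr x)%:E * \int[nu]_y G x y) < +oo.
Proof.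
move=> snu hnu; apply: le_lt_trans hnu.
pose f x (y : Borel E) := (vr x)%:E * G x y.
have f0 x y : 0 <= f x y by rewrite mule_ge0 ?lee_fin // ltW.
apply: (@le_trans _ _ (\int[m]_x \int[nu]_y f x y)).
  rewrite le_eqVlt; apply/orP; left; apply/eqP; apply: eq_integral => x _.
  have [mGx Gx0 _] := G_excessiver x.
  by rewrite /f ge0_integralZl ?lee_fin ?(ltW (vr0 x)).
rewrite (@tonelli _ _ (Borel E) (Borel E) R m nu f sm snu mvrG f0).
apply: nnm_le_integral => [||y]; first exact: nnm_dual_potential.
  exact: (excessive_nnm erho).
exact: dual_potential_le.
Qed.
End green_potentials.

(** * Transfer of good measures *)

Section good_measures.
Context {R : realType} {E : pmetricType R}.
Variable m : {measure set (Borel E) -> \bar R}.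
Variables (A : l2op m) (T : R -> (E -> R) -> (E -> R)).
Variables (XX : hunt_process E) (G : E -> E -> \bar R) (rho vrho : E -> R).
Hypothesis hE : locally_compact [set: E].
Hypothesis hsep : separable E.
Hypothesis hA : self_adjoint A.
Hypothesis hT : markov_semigroup m T.
Hypothesis hAT : generates A T.
Hypothesis hX : associated XX m T.
Hypothesis hG : is_green XX m G.
Hypothesis hrho0 : forall x, 0 < rho x.
Hypothesis hrho : excessive XX (EFin \o rho).
Hypothesis hvrho0 : forall x, 0 < vrho x.
Hypothesis hvrho_borel : borel_fun vrho.
Hypothesis hvrho_bnd : exists C : R, forall x, vrho x <= C.
Hypothesis hvrho1 : vrho \in Lfun m 1%:E.
Hypothesis hvrho2 : vrho \in Lfun m 2%:E.
Hypothesis hRvrho_bnd : exists C : R, forall x, (Rpot XX (EFin \o vrho) x <= C%:E)%E.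
Hypothesis hRvrho : \forall x \ae m, (Rpot XX (EFin \o vrho) x <= (rho x)%:E)%E.
Local Open Scope ereal_scope.
Local Notation nnm := (@nnm _ (Borel E) R).
Local Notation p := (transition hE hsep XX).
Local Notation V := (resolvent p).

Lemma nnm_vrho : nnm (EFin \o vrho).
Proof. by apply: nnm_EFin => // x; exact: ltW. Qed.

Lemma vrho_integrable : \int[m]_x (vrho x)%:E < +oo.
Proof.
have /integrableP[_] := (Lfun1_integrable m vrho).1 hvrho1.
apply: le_lt_trans; apply: nnm_le_integral => [||x]; first exact: nnm_vrho.
  by apply: nnm_abse; have [] := nnm_vrho.
exact: lee_abs.
Qed.

Lemma sfinite_m : sfinite_measure m.
Proof. exact: (weight_sfinite hvrho_borel hvrho0 vrho_integrable). Qed.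

Lemma transition_associated (t : R) (h : E -> R) : (0 <= t)%R -> (forall x, (0 <= h x)%R) ->
  L2 m h -> (exists C : R, forall x, (`|h x| <= C)%R) ->
  \forall x \ae m, (T t h x)%:E = Q p t (EFin \o h) x.
Proof.
move=> t0 h0 h2 hb; have nh : nnm (EFin \o h) by apply: nnm_EFin => //; exact: (L2_measurable h2).
by apply: (ae_impl _ (hX t0 h2 hb)) => x ->; rewrite (Q_Pt hE hsep XX x t0 nh).
Qed.

Lemma hunt_sym_resolvent : sym_resolvent m V.
Proof.
apply: sym_resolvent_resolvent.
- by move=> s t h x s0 t0 nh; exact: Q_semigroup.
- exact: sfinite_m.
- move=> t h k t0 nh nk.
  exact: (kernel_symmetric hA hT hAT transition_associated hvrho0 hvrho_borel hvrho_bnd hvrho2).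
Qed.

Definition wpot (x : E) : R := fine (Rpot XX (EFin \o vrho) x).

Lemma wpotE x : rpot V 0 (fun y => (vrho y)%:E) x = (wpot x)%:E.
Proof.
rewrite /wpot (Rpot_rpot hE hsep XX x nnm_vrho) fineK // ge0_fin_numE.
  have [C hC] := hRvrho_bnd; apply: (le_lt_trans _ (ltry C)).
  by rewrite -(Rpot_rpot hE hsep XX x nnm_vrho).
by apply: rpot_ge0 => y; rewrite lee_fin ltW.
Qed.

Lemma wpot_bounded : exists C : R, forall x, (wpot x <= C)%R.
Proof.
have [C hC] := hRvrho_bnd; exists C => x; rewrite -lee_fin -wpotE.
by rewrite -(Rpot_rpot hE hsep XX x nnm_vrho).
Qed.

Lemma wpot_gt0 x : (0 < wpot x)%R.
Proof. by rewrite -lte_fin -wpotE; exact: (potential_gt0 hE hsep x hrho hrho0 hvrho_borel hvrho0). Qed.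

Lemma wpot_le_rho : \forall x \ae m, (wpot x <= rho x)%R.
Proof.
apply: (ae_impl _ hRvrho) => x.
by rewrite (Rpot_rpot hE hsep XX x nnm_vrho) wpotE lee_fin.
Qed.

Lemma wpot_l1_cvg (f : E -> R) : borel_fun f -> (forall x, (0 <= f x)%R) ->
  \int[m]_x ((wpot x)%:E * (f x)%:E) < +oo ->
  \int[m]_x ((wpot x)%:E * resdist V n.+1%:R f x) @[n --> \oo] --> 0.
Proof.
have [C hC] := wpot_bounded.
apply: (l1_cvg_all hunt_sym_resolvent hvrho_borel hvrho0 wpotE hC).
- by move=> a x a0; exact: rpot1_le.
- move=> B N mB hB.
  exact: (indic_resolvent_cvg sfinite_m hT transition_associated hvrho0 hvrho2 mB hB).
Qed.

Lemma Rpot_signed_pot (k : E -> R) (x : E) : borel_fun k ->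
  rpot V 0 (fun y => `|k y|%:E) x < +oo -> Rpot_signed XX k x = (@pot _ (Borel E) R V k x)%:E.
Proof.
move=> mk kx.
have eP : (fun y => (EFin \o k)^\+ y) = (fun y => (Num.max (k y) 0%R)%:E).
  by apply/funext => y; rewrite funeposE /= EFin_max.
have eN : (fun y => (EFin \o k)^\- y) = (fun y => (Num.max (- k y) 0)%R%:E).
  by apply/funext => y; rewrite funenegE /= EFin_max.
have nP : nnm (fun y => (Num.max (k y) 0%R)%:E).
  by apply: nnm_EFin; [exact: measurable_maxr|move=> y; rewrite le_max lexx orbT].
have nN : nnm (fun y => (Num.max (- k y) 0)%R%:E).
  apply: nnm_EFin; last by move=> y; rewrite le_max lexx orbT.
  by apply: measurable_maxr => //; exact: measurableT_comp.
rewrite /Rpot_signed eP eN (Rpot_rpot hE hsep XX x nP) (Rpot_rpot hE hsep XX x nN) /pot /dpot.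
have [r _ ->] := @rpot_pos_fin _ (Borel E) R V k mk x kx.
by have [s _ ->] := @rpot_neg_fin _ (Borel E) R V k mk x kx.
Qed.

Lemma ae_rpot_abs (k : E -> R) : borel_fun k -> \int[m]_x ((wpot x)%:E * `|k x|%:E) < +oo ->
  \forall x \ae m, rpot V 0 (fun y => `|k y|%:E) x < +oo.
Proof.
move=> mk; apply: (ae_rpot_lty hunt_sym_resolvent hvrho_borel hvrho0 wpotE).
exact: nnm_abs.
Qed.

Lemma wpot_integral_le (k : E -> R) : borel_fun k ->
  \int[m]_x ((rho x)%:E * `|k x|%:E) < +oo -> \int[m]_x ((wpot x)%:E * `|k x|%:E) < +oo.
Proof.
move=> mk; apply: le_lt_trans.
have nk : nnm (fun x => `|k x|%:E) by exact: nnm_abs.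
have [nw _] := supermedian_w hunt_sym_resolvent hvrho_borel hvrho0 wpotE.
apply: nnm_ae_le_integral; [exact: nnmM|by apply: nnmM => //; exact: (excessive_nnm hrho)|].
by apply: (ae_impl _ wpot_le_rho) => x wr; apply: lee_wpmul2r; rewrite lee_fin.
Qed.

(** Continuity extends the sign condition from rational to all arguments, off a common null set; there
    [g'] is 0. *)
Lemma regular_version (g : E -> R -> R) : condCar m g -> condSig m g ->
  exists g' : E -> R -> R, [/\ forall y, borel_fun (g' ^~ y), forall x, continuous (g' x),
    forall x y, (g' x y * y <= 0)%R & \forall x \ae m, forall y, g x y = g' x y].
Proof.
move=> [mg cg] sg.
have sgq : \forall x \ae m, forall n : nat, forall q : rat, unpickle n = Some q ->
    (g x (ratr q) * ratr q <= 0)%R.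
  apply/ae_foralln => n; case: (unpickle n) => [q|]; last exact: ae_all.
  by apply: (ae_impl _ (sg (ratr q))) => x gx _ [<-].
have [N [mN N0 hN]] := ae_and cg sgq.
have good x : ~ N x -> continuous (g x) /\ forall q : rat, (g x (ratr q) * ratr q <= 0)%R.
  move=> nNx; have [cx sx] : continuous (g x) /\ (forall n : nat, forall q : rat,
      unpickle n = Some q -> (g x (ratr q) * ratr q <= 0)%R).
    by apply: contrapT => h; apply: nNx; exact: hN.
  by split => // q; apply: (sx (pickle q)); exact: pickleK.
exists (fun x y => \1_(~` N) x * g x y)%R.
have in1 x : ~ N x -> (\1_(~` N) x = 1 :> R)%R by move=> h; rewrite indicE mem_set.
have in0 x : N x -> (\1_(~` N) x = 0 :> R)%R by move=> h; rewrite indicE memNset.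
split.
- move=> y; apply: measurable_funM; last exact: mg.
  by apply: measurable_indic; exact: measurableC.
- move=> x; have [Nx|nNx] := pselect (N x).
    rewrite (_ : (fun y => _) = (fun=> 0%R)); first by move=> y; exact: cvg_cst.
    by apply/funext => y; rewrite in0 // mul0r.
  rewrite (_ : (fun y => _) = g x); first by have [] := good x nNx.
  by apply/funext => y; rewrite in1 // mul1r.
- move=> x y; have [Nx|nNx] := pselect (N x); first by rewrite in0 // !mul0r.
  rewrite in1 // mul1r leNgt; apply/negP => gy.
  have [cx sx] := good x nNx.
  have ch : continuous (fun z => g x z * z)%R by move=> z; apply: cvgM; [exact: cx|exact: cvg_id].
  have [z [gz [q _ qz]]] : [set z | (0 < g x z * z)%R] `&` range ratr !=set0.
    apply: dense_rat; first by exists y.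
    by apply: (open_comp _ (@open_gt R 0%R)) => z _; exact: ch.
  by move: gz; rewrite /= -qz ltNge sx.
- exists N; split => // x /= hx; apply: contrapT => nNx; apply: hx => y.
  by rewrite in1 // mul1r.
Qed.

Lemma continuous_sign_zero (h : R -> R) : continuous h -> (forall y, (h y * y <= 0)%R) -> h 0%R = 0%R.
Proof.
move=> ch hs; apply/eqP; have [//|h0] := eqVneq (h 0%R) 0%R.
have a0 : (0 < `|h 0%R|)%R by rewrite normr_gt0.
have := ch 0%R; move=> /cvgrPdist_lt /(_ _ a0) /nbhs_ballP[d /= d0 hd].
have dd : (0 < d / 2)%R by rewrite divr_gt0.
have d2 : (d / 2 < d)%R by rewrite ltr_pdivrMr // ltr_pMr // ltr1n.
have h1 : (`|h 0%R - h (d / 2)| < `|h 0%R|)%R.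
  by apply: hd; rewrite /ball /= sub0r normrN gtr0_norm.
have h2 : (`|h 0%R - h (- (d / 2))| < `|h 0%R|)%R.
  by apply: hd; rewrite /ball /= sub0r opprK gtr0_norm.
have s1 : (h (d / 2) <= 0)%R by have := hs (d / 2)%R; rewrite pmulr_lle0.
have s2 : (0 <= h (- (d / 2)))%R by have := hs (- (d / 2))%R; rewrite mulrN oppr_le0 pmulr_lge0.
move: h1 h2; rewrite !ltr_norml => /andP[p1 p2] /andP[q1 q2].
by case: (ltrgt0P (h 0%R)) p1 p2 q1 q2 h0 => [c0|c0|->]; rewrite ?eqxx //; lra.
Qed.

(** The solution [u] for [f] is the reference function of [semilinear_solvable]. The dominating
    function [H] comes from the integrability condition applied to the negative part [um] and the
    positive part [up] of [u]: [g(., um)] and [g(., up)] are integrable against [rho], because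
    [|g(., u)|] is at most [C |f(., u)|] where [|u|] is at least [r], and at most the supremum of
    [|g|] over the ball of radius [r] elsewhere. *)
Lemma good_sub (f g : E -> R -> R) (C r : R) :
  condCar m g -> condSig m g -> condInt m rho vrho g -> condM m rho g ->
  (0 <= C)%R -> (0 < r)%R ->
  (\forall x \ae m, forall y, (r <= `|y|)%R -> (`|g x y| <= C * `|f x y|)%R) ->
  good m XX G rho f `<=` good m XX G rho g.
Proof.
move=> gCar gSig gInt gM C0 r0 gf mu [Mmu [u0 [mu0 fu0 [k0 [mk0 fk0 ik0 eqn]]]]].
split => //.
have HV := hunt_sym_resolvent.
have nrho := excessive_nnm hrho.
have srho : supermedian V (fun x => (rho x)%:E) by exact: (excessive_rpot_supermedian hE hsep hrho).
have [Cw hCw] := wpot_bounded.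
have [g' [mg' cg' sg' gg']] := regular_version gCar gSig.
have nr x : (0 <= rho x)%R by exact: ltW.
have mrho : borel_fun rho by apply/measurable_EFinP; case: nrho.
have rhoE : \int[mpos mu]_x (rho x)%:E < +oo /\ \int[mneg mu]_x (rho x)%:E < +oo.
  move: Mmu; rewrite /Mrho /= /total_variation ge0_integral_measure_add //; last 2 first.
  - by move=> x _; rewrite lee_fin.
  - exact/measurable_EFinP.
  have i1 : 0 <= \int[mpos mu]_x (rho x)%:E by apply: integral_ge0 => x _; rewrite lee_fin.
  have i2 : 0 <= \int[mneg mu]_x (rho x)%:E by apply: integral_ge0 => x _; rewrite lee_fin.
  move=> h; split; apply: le_lt_trans h; [exact: leeDl|exact: leeDr].
have [rp rn] := rhoE.
have sp : sfinite_measure (mpos mu) by exact: (weight_sfinite mrho hrho0 rp).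
have sn : sfinite_measure (mneg mu) by exact: (weight_sfinite mrho hrho0 rn).
pose Wp x := \int[mpos mu]_y G x y.
pose Wn x := \int[mneg mu]_y G x y.
have supWp : supermedian V Wp by exact: (green_potential_supermedian hE hsep hG sp).
have supWn : supermedian V Wn by exact: (green_potential_supermedian hE hsep hG sn).
have [nWp _] := supWp; have [nWn _] := supWn.
have iWp : \int[m]_x ((vrho x)%:E * Wp x) < +oo.
  exact: (green_potential_integrable (hE := hE) (hsep := hsep) sfinite_m HV hG hvrho_borel hvrho0
    vrho_integrable wpotE hCw hrho wpot_le_rho sp rp).
have iWn : \int[m]_x ((vrho x)%:E * Wn x) < +oo.
  exact: (green_potential_integrable (hE := hE) (hsep := hsep) sfinite_m HV hG hvrho_borel hvrho0
    vrho_integrable wpotE hCw hrho wpot_le_rho sn rn).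
have fWp := ae_lty_of_integral hvrho_borel hvrho0 nWp iWp.
have fWn := ae_lty_of_integral hvrho_borel hvrho0 nWn iWn.
pose W0 x := Wp x + Wn x.
have supW0 : supermedian V W0 by exact: supermedianD.
have [nW0 _] := supW0.
have fW0 : \forall x \ae m, W0 x < +oo by apply: (ae_impl2 _ fWp fWn) => x; exact: lte_add_pinfty.
pose h0 x := fine (Rmeas G mu x).
have mh0 : borel_fun h0.
  apply: measurableT_comp => //; apply: emeasurable_funB; [by case: nWp|by case: nWn].
have Wfin x : Wp x < +oo -> Wn x < +oo -> Wp x \is a fin_num /\ Wn x \is a fin_num.
  by move=> wp wn; rewrite !ge0_fin_numE //; [exact: (nnm_ge0 (x : Borel E) nWn)|
    exact: (nnm_ge0 (x : Borel E) nWp)].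
have h0E : \forall x \ae m, Rmeas G mu x = (h0 x)%:E.
  apply: (ae_impl2 _ fWp fWn) => x wp wn; rewrite /h0 fineK //.
  by have [fp fn] := Wfin x wp wn; rewrite /Rmeas fin_numB; apply/andP.
have h0W0 : \forall x \ae m, `|h0 x|%:E <= W0 x.
  apply: (ae_impl2 _ h0E (ae_and fWp fWn)) => x hx [wp wn].
  rewrite -abse_EFin -hx /Rmeas; apply: (le_trans (lee_abs_sub _ _)).
  by rewrite !gee0_abs ?lexx //; [exact: (nnm_ge0 (x : Borel E) nWn)|exact: (nnm_ge0 (x : Borel E) nWp)].
have ik0' : \int[m]_x ((rho x)%:E * `|k0 x|%:E) < +oo by exact: ik0.
have wk0 := wpot_integral_le mk0 ik0'.
have rk0 := ae_rpot_abs mk0 wk0.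
pose u x := fine (u0 x).
have mu' : borel_fun u by apply: measurableT_comp.
have uE : \forall x \ae m, u x = (h0 x + @pot _ (Borel E) R V k0 x)%R.
  apply: (ae_impl2 _ (ae_and eqn h0E) rk0) => x [ux hx] rx.
  by rewrite /u ux hx (Rpot_signed_pot mk0 rx) -EFinD /= addrC.
have uint : \int[m]_x ((vrho x)%:E * `|u x|%:E) < +oo.
  have nk0 : nnm (fun x => `|k0 x|%:E) by exact: nnm_abs.
  have nU := nnm_rpot HV (lexx 0%R) nk0.
  apply: (@le_lt_trans _ _ (\int[m]_x ((vrho x)%:E * rpot V 0 (fun y => `|k0 y|%:E) x) +
     \int[m]_x ((vrho x)%:E * W0 x))); last first.
    rewrite lte_add_pinfty //.
      by rewrite (int_vr_rpot0 HV hvrho_borel hvrho0 wpotE nk0).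
    rewrite (_ : \int[m]_x ((vrho x)%:E * W0 x) =
        \int[m]_x ((vrho x)%:E * Wp x) + \int[m]_x ((vrho x)%:E * Wn x)).
      exact: lte_add_pinfty.
    rewrite -nnm_integralD; [|exact: (nnmM nnm_vrho nWp)|exact: (nnmM nnm_vrho nWn)].
    apply: eq_integral => x _; rewrite ge0_muleDr //;
      [exact: (nnm_ge0 (x : Borel E) nWp)|exact: (nnm_ge0 (x : Borel E) nWn)].
  rewrite -nnm_integralD; [|exact: (nnmM nnm_vrho nU)|exact: (nnmM nnm_vrho nW0)].
  apply: nnm_ae_le_integral.
  - by apply: (nnmM nnm_vrho); exact: nnm_abs.
  - by apply: nnmD; [exact: (nnmM nnm_vrho nU)|exact: (nnmM nnm_vrho nW0)].
  apply: (ae_impl2 _ (ae_and uE h0W0) rk0) => x [ux hx] rx.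
  rewrite -ge0_muleDr; [|exact: (nnm_ge0 (x : Borel E) nU)|exact: (nnm_ge0 (x : Borel E) nW0)].
  apply: lee_wpmul2l; first by rewrite lee_fin ltW.
  rewrite ux; apply: (@le_trans _ _ (`|h0 x|%:E + `|@pot _ (Borel E) R V k0 x|%:E)).
    by rewrite -EFinD lee_fin ler_normD.
  rewrite addeC; apply: leeD => //.
  exact: (@pot_le _ (Borel E) R V k0 mk0 x rx).
have kball (M : R) : exists b : E -> R, [/\ borel_fun b, forall x, (0 <= b x)%R,
    \int[m]_x ((rho x)%:E * (b x)%:E) < +oo &
    \forall x \ae m, forall y : R, (`|y| <= M)%R -> (`|g' x y| <= b x)%R].
  have M1 : (0 < Num.max M 1)%R by rewrite lt_max ltr01 orbT.
  have [k [mk kE ik]] := gM _ M1.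
  exists (fun x => `|k x|%R); split => //; first exact: measurableT_comp.
  apply: (ae_impl2 _ kE gg') => x kx gx y yM.
  rewrite -gx -lee_fin; apply: (@le_trans _ _ (sup_ball g (Num.max M 1)%R x)).
    by apply: ereal_sup_ubound; exists y => //=; rewrite le_max yM.
  by rewrite kx lee_fin ler_norm.
have gzero x : g' x 0%R = 0%R by apply: continuous_sign_zero.
have L1g (v : E -> R) : borel_fun v -> (\forall x \ae m, v x = u x \/ v x = 0%R) ->
    inL1 m rho (fun x => (g x (v x))%:E).
  move=> mv vu.
  have mgv : borel_fun (fun x => g' x (v x)) by exact: (@caratheodory_measurable _ (Borel E) R g' v).
  have [b [mb b0 ib bE]] := kball r.
  exists (fun x => g' x (v x)); split => //; first by apply: (ae_impl _ gg') => x ->.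
  apply: (@le_lt_trans _ _ (\int[m]_x (C%:E * ((rho x)%:E * `|k0 x|%:E) + (rho x)%:E * (b x)%:E))).
    have nk : nnm (fun x => (rho x)%:E * `|k0 x|%:E) by apply: (nnmM nrho); exact: nnm_abs.
    have nb : nnm (fun x => (rho x)%:E * (b x)%:E) by apply: (nnmM nrho); exact: nnm_EFin.
    apply: nnm_ae_le_integral.
    - apply: nnm_EFin; last by move=> x; rewrite mulr_ge0.
      by apply: measurable_funM => //; exact: measurableT_comp.
    - by apply: nnmD => //; exact: nnmZ.
    apply: (ae_impl2 _ (ae_and (ae_and vu bE) (ae_and gg' gf)) fk0) => x [[vx bx] [gx gfx]] fx.
    rewrite -!EFinM -EFinD lee_fin mulrCA -mulrDr ler_wpM2l //.
    have Ck : (0 <= C * `|k0 x|)%R by rewrite mulr_ge0.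
    case: vx => [->|->]; last by rewrite gzero normr0 addr_ge0.
    have [ru|ru] := leP r `|u x|%R.
      by apply: ler_wpDr => //; rewrite -gx -fx; exact: gfx.
    by apply: ler_wpDl => //; apply: bx; exact: ltW.
  rewrite nnm_integralD; last 2 first.
  - by apply: nnmZ => //; apply: (nnmM nrho); exact: nnm_abs.
  - by apply: (nnmM nrho); exact: nnm_EFin.
  rewrite lte_add_pinfty // nnm_integralZ //; last by apply: (nnmM nrho); exact: nnm_abs.
  have ki : \int[m]_x ((rho x)%:E * `|k0 x|%:E) \is a fin_num.
    by rewrite ge0_fin_numE //; apply: nnm_integral_ge0; apply: (nnmM nrho); exact: nnm_abs.
  by rewrite -(fineK ki) -EFinM ltry.
pose um x := Num.min (u x) 0%R; pose up x := Num.max (u x) 0%R.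
have mum : borel_fun um by exact: measurable_minr.
have mup : borel_fun up by exact: measurable_maxr.
have L1v (v : E -> R) : borel_fun v -> (forall x, (`|v x| <= `|u x|)%R) -> inL1 m vrho (EFin \o v).
  move=> mv vu; exists v; split => //; first exact: ae_all.
  apply: le_lt_trans uint; apply: nnm_le_integral => [||x].
  - apply: nnm_EFin; last by move=> x; rewrite mulr_ge0 // ltW.
    by apply: measurable_funM => //; exact: measurableT_comp.
  - by apply: (nnmM nnm_vrho); exact: nnm_abs.
  by rewrite -EFinM lee_fin ler_wpM2l // ltW.
have um_u x : (`|um x| <= `|u x|)%R by rewrite /um; case: (leP (u x) 0%R) => //; rewrite normr0.
have up_u x : (`|up x| <= `|u x|)%R by rewrite /up; case: (leP (u x) 0%R) => //; rewrite normr0.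
have umD x : um x = u x \/ um x = 0%R by rewrite /um; case: (leP (u x) 0%R); [left|right].
have upD x : up x = u x \/ up x = 0%R by rewrite /up; case: (leP (u x) 0%R); [right|left].
have [H [mH HE iH]] := gInt um up (L1v um mum um_u) (L1v up mup up_u)
  (L1g um mum (ae_all _ umD)) (L1g up mup (ae_all _ upD)).
have gH : \forall x \ae m, forall y : R, (0 <= y <= u x)%R || (u x <= y <= 0)%R ->
    (`|g' x y| <= `|H x|)%R.
  apply: (ae_impl2 _ HE gg') => x hx gx y yu.
  rewrite -gx -lee_fin; apply: (@le_trans _ _ (sup_between g um up x)).
    rewrite /sup_between le_max; apply/orP; right; apply: ereal_sup_ubound; exists y => //=.
    rewrite in_itv /= /um /up ge_min le_max.
    by case/orP: yu => /andP[-> ->]; rewrite ?orbT.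
  by rewrite hx lee_fin ler_norm.
have iH' : \int[m]_x ((rho x)%:E * `|H x|%:E) < +oo by exact: iH.
have [v [mv iv wv vE]] := @semilinear_solvable _ (Borel E) R m V HV vrho wpot hvrho_borel hvrho0 wpotE
  wpot_l1_cvg Cw rho g' hCw vrho_integrable wpot_gt0 srho wpot_le_rho mg' cg' sg' h0 W0 mh0 supW0
  fW0 h0W0 u k0 (fun x => `|H x|%R) mk0 ik0' uE (measurableT_comp (@normr_measurable R setT) mH)
  (fun x => normr_ge0 (H x)) iH' gH kball.
have mk : borel_fun (fun x => g' x (v x)) by exact: (@caratheodory_measurable _ (Borel E) R g' v).
exists (EFin \o v); split; [exact/measurable_EFinP|exact: ae_all|].
exists (fun x => g' x (v x)); split; [exact: mk| |exact: iv|].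
  by apply: (ae_impl _ gg') => x gx; rewrite /= gx.
apply: (ae_impl2 _ (ae_and vE h0E) (ae_rpot_abs mk wv)) => x [vx hx] rx.
by rewrite /= vx hx (Rpot_signed_pot mk rx) -EFinD addrC.
Qed.

End good_measures.

Unset Implicit Arguments.

Theorem corollary7p5 (R : realType) (E : pmetricType R)
  (m : {measure set (Borel E) -> \bar R})
  (A sqrtNA : l2op m) (T : R -> (E -> R) -> (E -> R))
  (XX : hunt_process E) (G : E -> E -> \bar R) (rho vrho : E -> R)
  (hE : locally_compact [set: E]) (hsep : separable E)
  (hm : radon m) (hsupp : full_support m)
  (hA : self_adjoint A) (hT : markov_semigroup m T) (hAT : generates A T)
  (hsqrt : is_sqrt_opp A sqrtNA) (hreg : regular_form sqrtNA)
  (htrans : transient m T)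
  (hX : associated XX m T) (hG : is_green XX m G)
  (hrho0 : forall x, 0 < rho x) (hrho : excessive XX (EFin \o rho))
  (hvrho0 : forall x, 0 < vrho x) (hvrho_borel : borel_fun vrho)
  (hvrho_bnd : exists C : R, forall x, vrho x <= C)
  (hvrho1 : vrho \in Lfun m 1%:E) (hvrho2 : vrho \in Lfun m 2%:E)
  (hRvrho_bnd : exists C : R, forall x, (Rpot XX (EFin \o vrho) x <= C%:E)%E)
  (hRvrho : \forall x \ae m, (Rpot XX (EFin \o vrho) x <= (rho x)%:E)%E)
  (f g : E -> R -> R)
  (hfCar : condCar m f) (hfSig : condSig m f) (hfInt : condInt m rho vrho f)
  (hfqM : condqM sqrtNA f) (hfM : condM m rho f)
  (hgCar : condCar m g) (hgSig : condSig m g) (hgInt : condInt m rho vrho g)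
  (hgqM : condqM sqrtNA g) (hgM : condM m rho g)
  (c1 c2 r : R) (hc1 : 0 < c1) (hc2 : 0 < c2) (hr : 0 < r)
  (hfg : \forall x \ae m, forall y : R, r <= `|y| ->
     c1 <= `|f x y| / `|g x y| <= c2) :
  (forall mu, Mrho rho mu ->
     sm_eq (Pi m XX G rho f mu) (Pi m XX G rho g mu)) /\
  (forall mu, Mrho rho mu -> positive_sm mu ->
     sm_eq (upper_reduced m XX G rho f mu) (upper_reduced m XX G rho g mu)).
Proof.
have good_sub' := good_sub hE hsep hA hT hAT hX hG hrho0 hrho hvrho0 hvrho_borel hvrho_bnd
  hvrho1 hvrho2 hRvrho_bnd hRvrho.
(* Division by 0 gives 0, so the lower bound makes the divisor nonzero. *)
have ratio x y : c1 <= `|f x y| / `|g x y| <= c2 ->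
    `|g x y| <= c1^-1 * `|f x y| /\ `|f x y| <= c2 * `|g x y|.
  move=> /andP[c1r rc2]; have g0 : 0 < `|g x y|.
    rewrite lt_def normr_ge0 andbT; apply: contraL (lt_le_trans hc1 c1r) => /eqP ->.
    by rewrite invr0 mulr0 ltxx.
  split; last by rewrite -ler_pdivrMr.
  by rewrite ler_pdivlMl // mulrC; move: c1r; rewrite ler_pdivlMr // mulrC.
have efg : good m XX G rho f = good m XX G rho g.
  apply/seteqP; split.
    apply: (good_sub' f g c1^-1 r) => //; first by rewrite invr_ge0 ltW.
    by apply: (ae_impl _ hfg) => x fgx y ry; have [] := ratio _ _ (fgx y ry).
  apply: (good_sub' g f c2 r) => //; first exact: ltW.
  by apply: (ae_impl _ hfg) => x fgx y ry; have [] := ratio _ _ (fgx y ry).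
have eup : upper_reduced m XX G rho f = upper_reduced m XX G rho g.
  by apply/funext => mu; rewrite /upper_reduced /good_le efg.
have elow : lower_reduced m XX G rho f = lower_reduced m XX G rho g.
  by apply/funext => mu; rewrite /lower_reduced /good_ge efg.
by split=> [mu _|mu _ _]; rewrite ?/Pi eup ?elow.
Qed.
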